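(* Let $f(z)\notin\overline{\mathbb{Q}}(z)$ be an element of $\mathrm{NGA}\{0\}_0^{\mathbb{C}}$ which is a solution of an inhomogeneous differential equation $f'(z)=a(z)f(z)+b(z)$ with $a(z)\in\overline{\mathbb{Q}}(z)$ and $b(z)\in\overline{\mathbb{Q}}(z)\setminus\{0\}$. Then $\frac{d}{dz}-a(z)$ is a $G$-operator and, letting $g(z)\neq0$ be one of its solutions, we have $$f(z)=g(z)\int\frac{b(z)}{g(z)}\,dz .$$
   Context: An embedding of $\overline{\mathbb{Q}}$ into $\mathbb{C}$ is fixed. Nilsson-Gevrey arithmetic series of order $0$: $\mathrm{NGA}\{0\}_0^{\mathbb{C}}$ is the set of functions of the form $\sum_{(\alpha,j,k)\in\mathbb{S}}\lambda_{\alpha,j,k}\,z^{\alpha}\log(z)^j f_{\alpha,j,k}(z)$, where $\mathbb{S}$ is a finite subset of $\mathbb{Q}\times\mathbb{N}\times\mathbb{N}$, $\lambda_{\alpha,j,k}\in\mathbb{C}$, the determination of $\log(z)$ is arbitrary, and each $f_{\alpha,j,k}(z)=\sum_{n\ge0}a_nz^n$ is a power series with coefficients $a_n\in\overline{\mathbb{Q}}$ (depending also on $\alpha,j,k$) such that, for some $C>0$: (a) $|\sigma(a_n)|\le C^{n+1}$ for every $\sigma\in\mathrm{Gal}(\overline{\mathbb{Q}}/\mathbb{Q})$ and every $n$; (b) there is a sequence of positive integers $d_n\le C^{n+1}$ such that $d_na_m$ is an algebraic integer for all $m\le n$. Such series define analytic functions in a slit neighbourhood of $0$. ''Solution of a differential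 operator $L$'' means solution of the homogeneous linear equation $Ly(z)=0$. $G$-operators: let $A(z)\in M_{s\times s}(\overline{\mathbb{Q}}(z))$ and consider the system $Y'=AY$. Define $A_1:=A$, $A_{n+1}:=A_nA_1+A_n'$, so that $Y^{(n)}=A_nY$. Let $T(z)\in\overline{\mathbb{Q}}[z]\setminus\{0\}$ be of minimal degree such that $TA$ has entries in $\overline{\mathbb{Q}}[z]$; then $T^nA_n$ has polynomial entries for every $n$. Let $D_k\ge1$ be the least integer such that all the matrices $\frac{D_kT(z)^n}{n!}A_n(z)$, $n=1,\dots,k$, have entries in $\mathcal{O}_{\overline{\mathbb{Q}}}[z]$ ($\mathcal{O}_{\overline{\mathbb{Q}}}$ being the ring of algebraic integers). Galochkin's condition is that $D_k$ has at most geometric growth in $k$. A differential operator is a $G$-operator if its companion differential system satisfies Galochkin's condition; $G$-operators are taken in $\overline{\mathbb{Q}}(z)[\frac{d}{dz}]$. $\int u(z)\,dz$ denotes a primitive of $u(z)$, the arbitrary complex constant being unspecified; thus the formula means that it holds for some primitive of $b/g$. *)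

(* Defs.v *)
From HB Require Import structures.
From mathcomp Require Import all_boot all_order all_algebra all_field.
From mathcomp Require Import finmap.
From mathcomp Require Import all_classical all_reals all_analysis.
From mathcomp Require Import complex.

Set Implicit Arguments.
Unset Strict Implicit.
Unset Printing Implicit Defensive.

Import Order.TTheory GRing.Theory Num.Theory.
Import numFieldNormedType.Exports.

Local Open Scope classical_set_scope.
Local Open Scope ring_scope.
Local Open Scope complex_scope.

(* The field of algebraic numbers is [algC]; every ring morphism
   [iota : algC -> R[i]] is an embedding of it into the complex numbers.
   [R[i]^o] is [R[i]] with its topology and its normed space structure over
   itself, so that derivatives of functions [R[i]^o -> R[i]^o] are complex
   derivatives. *)

Notation ratfun := {fraction {poly algC}}.

Local Notation "p %:F" := (@tofrac _ p).

Section RationalFunctions.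

(* Numerator and denominator in lowest terms: the representative stored in a
   fraction need not be reduced. *)
Definition rf_num (x : ratfun) : {poly algC} :=
  let u := frac (repr x) in u.1 %/ gcdp u.1 u.2.
Definition rf_den (x : ratfun) : {poly algC} :=
  let u := frac (repr x) in u.2 %/ gcdp u.1 u.2.

Definition rf_deriv (x : ratfun) : ratfun :=
  ((rf_num x)^`() * rf_den x - rf_num x * (rf_den x)^`())%:F
  / (rf_den x ^+ 2)%:F.

Variables (R : realType) (iota : {rmorphism algC -> R[i]}).

Definition rf_regular (x : ratfun) (z : R[i]) : Prop :=
  (map_poly iota (rf_den x)).[z] != 0.

(* Meaningful only where [rf_regular x z] holds. *)
Definition rf_eval (x : ratfun) (z : R[i]) : R[i] :=
  (map_poly iota (rf_num x)).[z] / (map_poly iota (rf_den x)).[z].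

End RationalFunctions.

Section GOperators.

(* [sys_iter A n] is A_n (n >= 1), with A_1 = A and A_{n+1} = A_n A_1 + A_n'. *)
Definition sys_iter s (A : 'M[ratfun]_s) (n : nat) : 'M[ratfun]_s :=
  iter n.-1 (fun B => B *m A + map_mx rf_deriv B) A.

Definition clears_denom s (A : 'M[ratfun]_s) (T : {poly algC}) : Prop :=
  T != 0 /\ forall i j, exists p : {poly algC}, T%:F * A i j = p%:F.

Definition min_denom s (A : 'M[ratfun]_s) (T : {poly algC}) : Prop :=
  clears_denom A T /\
  forall U : {poly algC}, clears_denom A U -> (size T <= size U)%N.

Definition galochkin_denom s (A : 'M[ratfun]_s) (T : {poly algC})
    (k D : nat) : Prop :=
  (0 < D)%N /\
  forall n, (1 <= n <= k)%N -> forall i j,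
    exists p : {poly algC}, p \is a polyOver Aint /\
      (D%:R * T%:F ^+ n / (n`!)%:R) * sys_iter A n i j = p%:F.

Definition least_galochkin_denom s (A : 'M[ratfun]_s) (T : {poly algC})
    (k D : nat) : Prop :=
  galochkin_denom A T k D /\
  forall E, galochkin_denom A T k E -> (D <= E)%N.

(* T is only determined up to a nonzero constant factor, which changes D_k by
   an at most geometric factor; the condition is asked for every choice. *)
Definition galochkin s (A : 'M[ratfun]_s) : Prop :=
  forall T : {poly algC}, min_denom A T ->
  exists D : nat -> nat,
    (forall k, least_galochkin_denom A T k (D k)) /\
    exists C : nat, forall k, (D k <= C ^ k.+1)%N.

(* A differential operator \sum_i L_i (d/dz)^i is represented by the polynomial
   with coefficients L_i: only the additive structure of {poly ratfun} is
   relevant, its product is not the composition of operators. *)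
Definition diffop := {poly ratfun}.

(* [companionmx] of the monic normalisation: the system Y' = A Y satisfied by
   the column vector Y = (y, y', ..., y^(m-1)). *)
Definition G_operator (L : diffop) : Prop :=
  L != 0 /\ galochkin (companionmx ((lead_coef L)^-1 *: L)).

End GOperators.

Section Analytic.

Variable R : realType.
Local Notation C := (R[i]^o).

Definition cexp (z : C) : C :=
  (expR (complex.Re z))%:C * (cos (complex.Im z) +i* sin (complex.Im z)).

(* The disc |z| < r cut along the ray from 0 through w. *)
Definition slit_disc (w : C) (r : R) : set C :=
  [set z | `|z| < r%:C /\ forall t : R, 0 <= t -> z != t%:C * w].

Definition log_determination (U : set C) (l : C -> C) : Prop :=
  {within U, continuous l} /\ forall z, U z -> cexp (l z) = z.

Variable iota : {rmorphism algC -> R[i]}.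

(* Ring endomorphisms of [algC] are bijective, so [sigma] ranges over
   Gal(Qbar/Q). *)
Definition gevrey0_coefs (a : nat -> algC) : Prop :=
  exists c : R, 0 < c /\
    (forall (sigma : {rmorphism algC -> algC}) n,
        `|iota (sigma (a n))| <= (c ^+ n.+1)%:C) /\
    exists d : nat -> nat, forall n,
      (0 < d n)%N /\ (d n)%:R <= c ^+ n.+1 /\
      forall m, (m <= n)%N -> (d n)%:R * a m \in Aint.

(* NGA{0}_0^C on the slit disc [slit_disc w r]. *)
Definition NGA0 (w : C) (r : R) (f : C -> C) : Prop :=
  exists (l : C -> C) (S : {fset rat * nat * nat})
         (lambda : rat * nat * nat -> C)
         (a : rat * nat * nat -> nat -> algC)
         (F : rat * nat * nat -> C -> C),
    log_determination (slit_disc w r) l /\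
    (forall s, s \in S -> gevrey0_coefs (a s)) /\
    (forall s, s \in S -> forall z, slit_disc w r z ->
       series (fun n => iota (a s n) * z ^+ n : C) @ \oo --> F s z) /\
    forall z, slit_disc w r z ->
      f z = \sum_(s <- S)
              lambda s * cexp (ratr s.1.1 * l z) * l z ^+ s.1.2 * F s z.

Definition diffop_solution (L : diffop) (U : set C) (y : C -> C) : Prop :=
  forall z, U z ->
    (forall i, rf_regular iota L`_i z) /\
    (forall i, (i.+1 < size L)%N -> derivable (derive1n i y : C -> C) z 1) /\
    \sum_(i < size L) rf_eval iota L`_i z * derive1n i y z = 0.

End Analytic.

(* Main.v *)
Require Import Defs.
From HB Require Import structures.
From mathcomp Require Import all_boot all_order all_algebra all_field.
From mathcomp Require Import all_classical all_reals all_analysis.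
From mathcomp Require Import complex.
From mathcomp Require polyrcf.
From mathcomp Require Import zify ring lra.

Import Order.TTheory GRing.Theory Num.Theory.
Import numFieldNormedType.Exports.

Set Implicit Arguments.
Unset Strict Implicit.
Unset Printing Implicit Defensive.

Local Open Scope classical_set_scope.
Local Open Scope ring_scope.

(** Write a = p/T and b = q/T with polynomials T, p, q over the algebraic
    numbers. The n-th derivative of a solution y of y' = a y is A_n y, and the
    polynomials F_n = T^n A_n / n! decide whether d/dz - a is a G-operator:
    their common denominators must grow geometrically ([gal_bounded]). This
    condition does not depend on the chosen fraction p/T, is additive in a,
    and holds for a = alpha/z with alpha rational, because the binomial
    coefficients of alpha have geometric denominators ([gal_bounded_power]),
    and for logarithmic derivatives of rational functions
    ([gal_bounded_rational]).

    The arithmetic core is the theorem of the Chudnovskys ([chudnovsky]): if a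
    power series y with geometric heights and denominators satisfies a first
    order inhomogeneous equation and is not rational, then the F_n of that
    equation have geometric denominators. Siegel's lemma provides a polynomial
    Q with small integer coefficients and a polynomial P, both of degree less
    than n, such that Q y - P vanishes to the order n + M, where n and M are
    proportional to k. Differentiating k times along the equation gives k
    further pairs, all integral up to the denominator of the first Taylor
    coefficients of y; their 2 x 2 determinants, summed suitably, form a
    family H_i such that every F_n H_0 with n <= k is an integral combination
    of twisted Hasse derivatives of the H_i ([flow_alternating]). H_0 is not
    zero, for otherwise y - P/Q would solve a homogeneous equation whose
    indicial polynomial has no root that large ([approximant_det_neq0]). By
    Dedekind's theorem on products of polynomials with integral coefficients,
    any nonzero coefficient eta of H_0, made integral, is then a denominator
    of F_0, ..., F_k, and the norm of eta is a rational integer of geometric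
    size.

    It remains to extract such a series from f. On the ray z = exp(-x) z_0 the
    function f is an asymptotic series in exp(-b x) x^j with rational
    exponents b. Such expansions are unique, so that the differential equation
    for f holds coefficient by coefficient ([formal_coef_derive]). The complex
    constants of f are then expressed in a family that contains 1 and is free
    over the algebraic numbers, which splits these relations into relations
    between algebraic numbers. If a nonzero coefficient occurs with an
    exponent outside Z, with a logarithm, or in a coordinate other than that
    of 1, the highest logarithm in its class of exponents modulo Z yields a
    solution of the homogeneous equation, twisted by z^alpha, whose
    coefficients are of the required kind. Otherwise f is given by one Laurent
    series with algebraic coefficients. If this series is irrational, the
    theorem above applies to the inhomogeneous equation; if it is rational,
    then f is the value of an element of Qbar(z) on the whole slit disc, which
    is excluded.

    For the integral formula, the quotient f/g has derivative b/g wherever g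
    does not vanish. By uniqueness for the linear equation g' = a g, proved
    here by Gronwall's inequality along segments, the zero set of g is both
    open and closed in the connected open set U, hence empty. *)

(** * Twisted derivatives of polynomials *)

Local Notation integral := (polyOver Aint).

Section Flows.
Implicit Types T A p q h S : {poly algC}.

(** In closed form, x_n = (T^n / n!) (d/dz - A/T)^n x_0. The powers of T keep
    the terms polynomial; stating the recurrence instead of the closed form
    avoids fractions. *)
Definition flow (T A : {poly algC}) (x : nat -> {poly algC}) : Prop :=
  forall n, x n.+1 *+ n.+1 = T * (x n)^`() - (T^`() *+ n + A) * x n.

Definition conv (x y : nat -> {poly algC}) (n : nat) : {poly algC} :=
  \sum_(i < n.+1) x i * y (n - i)%N.

Fixpoint flow_from (T A h : {poly algC}) (n : nat) : {poly algC} :=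
  if n is m.+1 then
    (m.+1%:R^-1 : algC) *:
      (T * (flow_from T A h m)^`() - (T^`() *+ m + A) * flow_from T A h m)
  else h.

Lemma poly_mulrn_inj n (u v : {poly algC}) : u *+ n.+1 = v *+ n.+1 -> u = v.
Proof.
rewrite -!scaler_nat => /(congr1 (fun w => n.+1%:R^-1 *: w)).
by rewrite !scalerA mulVf ?scale1r // pnatr_eq0.
Qed.

Lemma flow_fromP T A h : flow T A (flow_from T A h).
Proof.
by move=> n; rewrite -scaler_nat /= scalerA mulfV ?scale1r // pnatr_eq0.
Qed.

Lemma flow_uniq T A x y : flow T A x -> flow T A y -> x 0%N = y 0%N -> x =1 y.
Proof.
move=> fx fy e0; elim=> [|n IHn] //.
by apply: (@poly_mulrn_inj n); rewrite fx fy IHn.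
Qed.

(** Leibniz's rule for (d/dz - A/T)^n / n!: it turns a sum of two twists into
    the Cauchy product of the two sequences. *)
Lemma flow_conv T A B x y :
  flow T A x -> flow T B y -> flow T (A + B) (conv x y).
Proof.
move=> fx fy n; rewrite /conv.
have -> : (\sum_(i < n.+2) x i * y (n.+1 - i)%N) *+ n.+1 =
    \sum_(i < n.+1) (x i.+1 *+ i.+1) * y (n - i)%N +
    \sum_(i < n.+1) x i * (y (n - i).+1 *+ (n - i).+1).
  rewrite -sumrMnl.
  have -> : \sum_(i < n.+2) (x i * y (n.+1 - i)%N) *+ n.+1 =
      \sum_(i < n.+2) (x i *+ i) * y (n.+1 - i)%N +
      \sum_(i < n.+2) x i * (y (n.+1 - i)%N *+ (n.+1 - i)).
    rewrite -big_split /=; apply: eq_bigr => i _.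
    by rewrite mulrnAl mulrnAr -mulrnDr subnKC // -ltnS.
  congr (_ + _).
    by rewrite big_ord_recl /= mulr0n mul0r add0r; apply: eq_bigr => i _.
  rewrite big_ord_recr /= subnn mulr0n mulr0 addr0; apply: eq_bigr => i _.
  by rewrite subSn // -ltnS.
rewrite raddf_sum mulr_sumr [in RHS]mulr_sumr -sumrB -big_split /=.
apply: eq_bigr => i _; rewrite fx fy derivM.
have -> : T^`() *+ n = T^`() *+ i + T^`() *+ (n - i).
  by rewrite -mulrnDr subnKC // -ltnS.
by ring.
Qed.

Lemma conv0 x y : conv x y 0%N = x 0%N * y 0%N.
Proof. by rewrite /conv big_ord_recl big_ord0 addr0. Qed.

Lemma deriv_nderivn n (h : {poly algC}) : h^`N(n)^`() = h^`N(n.+1) *+ n.+1.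
Proof.
apply/polyP => i; rewrite coef_deriv coefMn !coef_nderivn.
rewrite -!mulrnA addnS addSn; congr (_ *+ _).
have := mul_bin_left (n + i).+1 n.
by rewrite subSn ?leq_addr // addKn; lia.
Qed.

Lemma flow_nderivn T h : flow T 0 (fun n => T ^+ n * h^`N(n)).
Proof.
move=> n; rewrite derivM deriv_exp deriv_nderivn exprS.
case: n => [|n] /=; first by rewrite !mulr0n mul0r add0r !addr0 mul0r subr0 mulrA.
rewrite addr0 mulrDr addrAC [X in _ - X]mulrA.
have -> : T * (T^`() * T ^+ n *+ n.+1 * h^`N(n.+1)) =
    T^`() *+ n.+1 * T ^+ n.+1 * h^`N(n.+1).
  by rewrite exprS -mulrnAl; set t := T^`() *+ n.+1; set u := T ^+ n; ring.
by rewrite subrr add0r mulrA mulrnAr.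
Qed.

Lemma integral_nderivn n h : h \is a integral -> h^`N(n) \is a integral.
Proof.
by move=> /polyOverP ih; apply/polyOverP => i; rewrite coef_nderivn rpredMn.
Qed.

(** Here x_n = T^(n+s) (x_0 / T^s)^(n) / n!, whose integrality is an instance
    of the integrality of Hasse derivatives for power series. The induction on
    s multiplies the sequence by that of T itself, which lowers s by one up to
    a factor T; the factor is harmless because the leading term of the product
    is T x_n and the other terms involve only x_m with m < n. *)
Lemma flow_integral T s x : T \is a integral -> x 0%N \is a integral ->
  flow T (T^`() *+ s) x -> forall n, x n \is a integral.
Proof.
move=> iT; elim: s x => [|s IHs] x ix fx.
  have e : x =1 (fun n => T ^+ n * (x 0%N)^`N(n)).
    apply: (flow_uniq fx) => [|]; last by rewrite nderivn0 mul1r.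
    by rewrite mulr0n; exact: flow_nderivn.
  by move=> n; rewrite e rpredM ?rpredX ?integral_nderivn.
have fz : flow T (T^`() *+ s.+1) (conv (fun n => T ^+ n * T^`N(n)) x).
  have := flow_conv (flow_nderivn T T) fx; rewrite add0r; exact.
pose z n := x n + \sum_(i < n) T ^+ i * T^`N(i.+1) * x (n - i.+1)%N.
have ez n : conv (fun n => T ^+ n * T^`N(n)) x n = T * z n.
  rewrite /conv big_ord_recl /= subn0 nderivn0 mul1r /z mulrDr mulr_sumr.
  congr (_ + _); apply: eq_bigr => i _.
  by rewrite /bump /= exprS; ring.
have [T0|nzT] := eqVneq T 0.
  case=> [//|n]; have := fx n.
  rewrite T0 deriv0 !mul0rn add0r !mul0r subr0 -{1}[0](mul0rn _ n.+1).
  by move/poly_mulrn_inj->; rewrite rpred0.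
have iz : forall n, z n \is a integral.
  apply: IHs; first by rewrite /z big_ord0 addr0.
  move=> n; apply: (mulfI nzT); rewrite mulrnAr.
  by have := fz n; rewrite !ez derivM => ->; rewrite mulrS; ring.
move=> n; elim/ltn_ind: n => n IHn.
have -> : x n = z n - \sum_(i < n) T ^+ i * T^`N(i.+1) * x (n - i.+1)%N.
  by rewrite /z addrK.
rewrite rpredB // rpred_sum // => i _.
by have li := ltn_ord i; rewrite !rpredM ?rpredX ?integral_nderivn ?IHn //; lia.
Qed.

(** Leibniz's rule read backwards: v u^(n) is an alternating sum of the
    derivatives (u^(i) v)^(n-i). The F_n, of unknown denominators, play the
    role of the derivatives on the left, the H_k that of the other factor; on
    the right only the sequences G i started at H_i occur, and these are
    integral as soon as the H_i are, by [flow_integral]. *)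
Lemma flow_alternating T p (F : nat -> {poly algC}) (H : nat -> {poly algC})
    (G : nat -> nat -> {poly algC}) :
  flow T (- p) F -> F 0%N = 1 ->
  flow T (T^`() + p) H ->
  (forall i, G i 0%N = H i /\ flow T (T^`() *+ i.+1) (G i)) ->
  forall n k, F n * H k =
    \sum_(i < n.+1) (-1) ^+ i * G (i + k)%N (n - i)%N *+ 'C(i + k, k).
Proof.
move=> fF F0 fH fG; elim=> [|n IHn] k.
  by rewrite big_ord_recl big_ord0 F0 mul1r expr0 mul1r add0n binn (fG k).1 addr0.
apply: (@poly_mulrn_inj n); rewrite -mulrnAl fF.
have -> : (T * (F n)^`() - (T^`() *+ n + - p) * F n) * H k =
   (T * (F n * H k)^`() - (T^`() *+ (n + k.+1)) * (F n * H k))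
   - (F n * H k.+1) *+ k.+1.
  rewrite -mulrnAr fH derivM addnS -addSn mulrnDr mulrS.
  move: (T^`() *+ n) (T^`() *+ k) => t1 t2; ring.
rewrite !IHn raddf_sum !mulr_sumr -sumrB -sumrMnl /=.
have e1 : \sum_(i < n.+1) (T * ((-1) ^+ i * G (i + k)%N (n - i)%N *+ 'C(i + k, k))^`()
     - T^`() *+ (n + k.+1) * ((-1) ^+ i * G (i + k)%N (n - i)%N *+ 'C(i + k, k))) =
   \sum_(i < n.+2) (-1) ^+ i * G (i + k)%N (n.+1 - i)%N *+ 'C(i + k, k) *+ (n.+1 - i).
  rewrite [RHS]big_ord_recr /= subnn mulr0n addr0; apply: eq_bigr => i _.
  have lin : (i <= n)%N by rewrite -ltnS.
  have -> : (n.+1 - i)%N = (n - i).+1 by lia.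
  have e a b c d : a * b *+ c *+ d = a * (b *+ d) *+ c :> {poly algC}.
    by rewrite mulrnAC mulrnAr.
  rewrite e (fG _).2.
  have -> : T^`() *+ (n + k.+1) = T^`() *+ (n - i) + T^`() *+ (i + k).+1.
    by rewrite -mulrnDr; congr (_ *+ _); lia.
  move: (T^`() *+ (n - i)) (T^`() *+ (i + k).+1) 'C(i + k, k) => t1 t2 c.
  move: (G _ _) => g; rewrite derivMn -signr_odd.
  by case: (odd i); rewrite ?expr1 ?expr0 ?mul1r ?mulN1r ?derivN; ring.
have e2 : \sum_(i < n.+1) (-1) ^+ i * G (i + k.+1)%N (n - i)%N *+ 'C(i + k.+1, k.+1) *+ k.+1
   = - \sum_(i < n.+2) (-1) ^+ i * G (i + k)%N (n.+1 - i)%N *+ 'C(i + k, k) *+ i.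
  rewrite [in RHS]big_ord_recl /= mulr0n add0r -sumrN; apply: eq_bigr => i _.
  rewrite /bump /= add1n exprS mulN1r mulNr !mulNrn opprK subSS addSnnS.
  rewrite -!mulrnA; congr (_ *+ _).
  rewrite addnS; have := mul_bin_left (i + k).+1 k.
  by rewrite subSn ?leq_addl // addnK; lia.
rewrite e1 e2 opprK -big_split -sumrMnl /=; apply: eq_bigr => i _.
by rewrite -mulrnDr subnK //; have := ltn_ord i; lia.
Qed.

(** A first order operator with a singular point at 0 does not lower the order
    of vanishing at 0. *)
Lemma dvdXn_flow n T p (u : {poly algC}) : 'X %| T -> 'X^n %| u ->
  'X^n %| T * u^`() - p * u.
Proof.
move=> /dvdpP[S ->] /dvdpP[v ->]; apply: dvdp_sub; last by rewrite !dvdp_mull.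
rewrite derivM derivXn mulrDr; apply: dvdp_add; first by rewrite !dvdp_mull.
case: n => [|n] /=; first by rewrite expr0 dvd1p.
apply/dvdpP; exists (S * v *+ n.+1).
by rewrite exprS !(mulrnAr, mulrnAl); congr (_ *+ _); ring.
Qed.

End Flows.

(** * Integrality, conjugates and norms of algebraic numbers *)

Lemma root_integral_monic_Aint (q : {poly algC}) x :
  q \is monic -> root q x -> q \is a polyOver Aint -> x \in Aint.
Proof.
move=> mq rq /polyOverP iq.
have intA y : y \in Aint <-> integralOver (intr : int -> algC) y.
  split=> [|[p mp rp]].
    rewrite unfold_in => /floorpP[p Dp]; exists p; last by rewrite -Dp root_minCpoly.
    have := minCpoly_monic y; rewrite Dp !monicE lead_coef_map_inj //; last exact: intr_inj.
    by rewrite -[1](rmorph1 (intr : int -> algC)) => /eqP/intr_inj->.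
  apply: root_monic_Aint rp _ _; first by rewrite monic_map.
  by apply/polyOverP => i; rewrite coef_map /= intr_int.
apply: (intA _).2; apply: (integral_root_monic mq rq).
by apply/integral_poly => i; apply: (intA _).1.
Qed.

(** Multiplying u by a power of its leading coefficient c turns it into a
    monic integral equation for c r. *)
Lemma lead_root_integral (u : {poly algC}) r :
  u \is a integral -> root u r -> lead_coef u * r \in Aint.
Proof.
move=> /polyOverP iu ru.
have [->|nzu] := eqVneq u 0; first by rewrite lead_coef0 mul0r Aint0.
set c := lead_coef u; set m := (size u).-1.
have szu : size u = m.+1 by rewrite prednK // size_poly_gt0.
have mgt0 : (0 < m)%N.
  by have := root_size_gt1 nzu ru; rewrite szu.
pose w : {poly algC} := 'X^m + \poly_(i < m) (u`_i * c ^+ (m.-1 - i)).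
apply: (@root_integral_monic_Aint w).
- rewrite monicE lead_coefDl ?lead_coefXn // size_polyXn ltnS; exact: size_poly.
- rewrite rootE hornerD hornerXn horner_poly.
  have := rootP ru; rewrite horner_coef szu big_ord_recr /=.
  have -> : u`_m = c by [].
  move=> e; have -> : (c * r) ^+ m = c ^+ m.-1 * (c * r ^+ m).
    by rewrite exprMn mulrA -exprSr prednK.
  have -> : \sum_(i < m) u`_i * c ^+ (m.-1 - i) * (c * r) ^+ i =
      c ^+ m.-1 * \sum_(i < m) u`_i * r ^+ i.
    rewrite mulr_sumr; apply: eq_bigr => i _; rewrite exprMn.
    have -> : c ^+ m.-1 = c ^+ (m.-1 - i) * c ^+ i.
      by rewrite -exprD subnK //; have := ltn_ord i; lia.
    by ring.
  by rewrite -mulrDr addrC e mulr0.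
- rewrite rpredD ?polyOverXn //; apply/polyOverP => i; rewrite coef_poly.
  by case: ifP => _; rewrite ?rpred0 // rpredM ?rpredX // /c lead_coefE.
Qed.

(** The leading coefficient c of v is integral, and so is c r because r is a
    root of an integral polynomial with leading coefficient c; hence the
    leading term of v can be removed. *)
Lemma integral_XsubC_factor r (v : {poly algC}) :
  ('X - r%:P) * v \is a integral -> v \is a integral /\ r *: v \is a integral.
Proof.
elim: (size v).+1 {-2}v (ltnSn (size v)) => // n IHn {}v ltvn iu.
have [->|nzv] := eqVneq v 0; first by rewrite scaler0 rpred0.
set m := (size v).-1; set c := lead_coef v.
have szv : size v = m.+1 by rewrite prednK // size_poly_gt0.
have ic : c \in Aint.
  have : lead_coef (('X - r%:P) * v) \in Aint by rewrite lead_coefE; apply: (polyOverP iu).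
  by rewrite lead_coefM lead_coefXsubC mul1r.
have icr : c * r \in Aint.
  rewrite /c -(mul1r (lead_coef v)) -(lead_coefXsubC r) -lead_coefM.
  by apply: lead_root_integral; rewrite ?rootM ?root_XsubC ?eqxx.
pose v' := v - c *: 'X^m.
have iXn (a : algC) k : a \in Aint -> a *: 'X^k \is a integral.
  move=> ia; apply/polyOverP => i; rewrite coefZ coefXn.
  by case: eqP => _; rewrite ?mulr1 ?mulr0 ?rpred0.
have iu' : ('X - r%:P) * v' \is a integral.
  rewrite /v' mulrBr rpredB // mulrBl rpredB //.
    by rewrite -scalerAr -exprS iXn.
  by rewrite -scalerAr mul_polyC scalerA iXn.
have ltv' : (size v' < n)%N.
  rewrite ltnS in ltvn; apply: leq_trans ltvn; rewrite szv ltnS.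
  apply/leq_sizeP => j lemj; rewrite coefB coefZ coefXn.
  have [->|nejm] := eqVneq j m; first by rewrite mulr1 /c lead_coefE subrr.
  rewrite mulr0 subr0 nth_default // szv; lia.
have [iv' irv'] := IHn _ ltv' iu'.
have -> : v = v' + c *: 'X^m by rewrite subrK.
split; first by rewrite rpredD ?iXn.
by rewrite scalerDr scalerA [r * c]mulrC rpredD ?iXn.
Qed.

(** A form of Gauss's lemma without contents. Peeling off one linear factor X
    - r of p passes from p q to both p_1 q and r p_1 q, where p = p_1 (X - r). *)
Lemma dedekind (p q : {poly algC}) :
  p * q \is a integral -> forall i j, p`_i * q`_j \in Aint.
Proof.
elim: (size p) {-2}p (leqnn (size p)) => [|n IHn] {}p lepn ipq i j.
  by move: lepn; rewrite leqn0 size_poly_eq0 => /eqP->; rewrite coef0 mul0r Aint0.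
have [le1|gt1] := leqP (size p) 1.
  rewrite (size1_polyC le1) mul_polyC in ipq *.
  rewrite coefC; case: eqP => _; last by rewrite mul0r Aint0.
  by rewrite -coefZ; apply: (polyOverP ipq).
have /closed_rootP[r /factor_theorem[p1 Dp]] : size p != 1%N by rewrite neq_ltn gt1 orbT.
have nzp1 : p1 != 0.
  by apply: contraTneq gt1 => p10; rewrite Dp p10 mul0r size_poly0.
have szp1 : (size p1 <= n)%N.
  by rewrite Dp size_Mmonic ?monicXsubC // size_XsubC addn2 in lepn.
have [iv irv] : p1 * q \is a integral /\ r *: (p1 * q) \is a integral.
  by apply: integral_XsubC_factor; rewrite mulrA [_ * p1]mulrC -Dp.
have i1 := IHn _ szp1 iv.
have i2 := IHn (r *: p1) (leq_trans (size_scale_leq _ _) szp1).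
rewrite -scalerAl in i2; have {}i2 := i2 irv.
rewrite Dp mulrBr coefB coefMX coefMC mulrBl rpredB //.
  by case: eqP => _; rewrite ?mul0r ?Aint0.
by have := i2 i j; rewrite coefZ [p1`_i * r]mulrC.
Qed.

(** Every conjugate comes from an automorphism: the Galois group of a
    splitting field acts transitively on the roots, and automorphisms extend
    to all algebraic numbers. *)
Lemma conj_root_minCpoly x r : root (minCpoly x) r ->
  exists sigma : {rmorphism algC -> algC}, sigma x = r.
Proof.
move=> rr; have [s Ds] := closed_field_poly_normal (minCpoly x).
rewrite (monicP (minCpoly_monic x)) scale1r in Ds.
have [Qs [QsC [s1 Ds1 genQs]]] := num_field_exists s.
have [q [Dq mq] minq] := minCpolyP x.
pose qQ : {poly Qs} := map_poly (in_alg Qs) q.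
have DqQ : map_poly QsC qQ = minCpoly x.
  rewrite Dq -map_poly_comp; apply: eq_map_poly => a /=.
  by rewrite alg_num_field fmorph_rat.
have factq : qQ = \prod_(z <- s1) ('X - z%:P).
  apply: (@map_poly_inj _ _ QsC); rewrite DqQ Ds -Ds1 big_map rmorph_prod /=.
  by apply: eq_bigr => i _; rewrite map_polyXsubC.
have Qq : qQ \is a polyOver 1%VS.
  by apply/polyOverP => i; rewrite coef_map /=; apply: rpredZ; apply: rpred1.
have gal_s : SplittingField.axiom Qs.
  by exists qQ => //; exists s1; rewrite ?factq ?eqpxx.
pose QsM := FieldExt_isSplittingField.Build _ Qs gal_s.
pose Qn : splittingFieldType rat := HB.pack Qs QsM.
have memx y : root (minCpoly x) y -> exists y1 : Qs, QsC y1 = y.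
  rewrite Ds root_prod_XsubC -Ds1 => /mapP[y1 _ ->]; by exists y1.
have [x1 Dx1] := memx x (root_minCpoly x).
have [r1 Dr1] := memx r rr.
have rmin : root (minPoly (1%AS : {subfield Qn}) (x1 : Qn)) (r1 : Qn).
  have Hmin : minPoly (1%AS : {subfield Qn}) (x1 : Qn) \is a polyOver 1%VS := minPolyOver _ _.
  have [p Dp] : exists p : {poly rat}, minPoly (1%AS : {subfield Qn}) (x1 : Qn) = map_poly (in_alg Qs) p.
    have aP i : (minPoly (1%AS : {subfield Qn}) (x1 : Qn))`_i \in 1%VS by apply/polyOverP.
    have {}aP i := sig_eqW (vlineP _ _ (aP i)).
    exists (\poly_(i < size (minPoly (1%AS : {subfield Qn}) (x1 : Qn))) sval (aP i)).
    apply/polyP=> i; rewrite coef_map coef_poly /=.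
    case: ltnP => [_|le]; first by case: (aP i).
    by rewrite scale0r nth_default.
  have eC (y : Qs) : root (map_poly (in_alg Qs) p) y = root (map_poly ratr p) (QsC y).
    rewrite -(fmorph_root QsC) -map_poly_comp; congr (root _ _).
    by apply: eq_map_poly => a /=; rewrite alg_num_field fmorph_rat.
  have := root_minPoly (1%AS : {subfield Qn}) (x1 : Qn).
  rewrite Dp !eC Dr1 Dx1 minq => /dvdpP[g ->].
  by rewrite rmorphM /= rootM -Dq rr orbT.
have [phi _ Dphi] := normalField_root_minPoly (sub1v _) (normalFieldf (1%AS : {subfield Qn}))
   (memvf _) rmin.
have [nu Dnu] := extend_algC_subfield_aut QsC (phi : {rmorphism Qn -> Qn}).
by exists nu; rewrite -Dx1 -Dnu -Dr1; congr (QsC _).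
Qed.

Lemma number_field_degree (s : seq algC) :
  exists (K : fieldExtType rat) (j : {rmorphism K -> algC}) (d : nat),
    (forall x, x \in s -> exists u, j u = x) /\
    (forall u, size (minCpoly (j u)) <= d.+1)%N.
Proof.
have [K [j [s1 Ds1 _]]] := num_field_exists s.
exists K, j, (\dim {:K}); split=> [x|u].
  by rewrite -Ds1 => /mapP[y _ ->]; exists y.
have [q [Dq mq] minq] := minCpolyP (j u).
pose m := minPoly 1%AS u.
have [p Dp] : exists p : {poly rat}, m = map_poly (in_alg K) p.
  have aP i : m`_i \in 1%VS by apply/polyOverP; apply: minPolyOver.
  have {}aP i := sig_eqW (vlineP _ _ (aP i)).
  exists (\poly_(i < size m) sval (aP i)).
  apply/polyP=> i; rewrite coef_map coef_poly /=.
  case: ltnP => [_|le]; first by case: (aP i).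
  by rewrite scale0r nth_default.
have rp : root (map_poly ratr p) (j u).
  have := root_minPoly 1%AS u; rewrite -/m Dp -(fmorph_root j) -map_poly_comp.
  congr (root _ _); apply: eq_map_poly => a /=.
  by rewrite alg_num_field fmorph_rat.
rewrite minq in rp.
have nzm : m != 0 by apply: monic_neq0; apply: monic_minPoly.
have nzp : p != 0 by apply: contraNneq nzm => p0; rewrite Dp p0 rmorph0.
have := dvdp_leq nzp rp; rewrite -(size_map_poly (ratr : {rmorphism rat -> algC})) -Dq.
move/leq_trans; apply.
rewrite -(size_map_poly (in_alg K)) -Dp size_minPoly ltnS.
rewrite /adjoin_degree dimv1 divn1.
by rewrite prednK ?adim_gt0 // dimvS ?subvf.
Qed.

Section House.
Variables (R : realType) (iota : {rmorphism algC -> R[i]}).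

Definition house_le (x : algC) (B : nat) : Prop :=
  forall sigma : {rmorphism algC -> algC}, `|iota (sigma x)| <= B%:R.

Lemma house_leD x y B C : house_le x B -> house_le y C -> house_le (x + y) (B + C)%N.
Proof.
move=> hx hy s; rewrite !rmorphD; apply: le_trans (ler_normD _ _) _.
exact: lerD.
Qed.

Lemma house_leM x y B C : house_le x B -> house_le y C -> house_le (x * y) (B * C)%N.
Proof.
by move=> hx hy s; rewrite !rmorphM normrM ler_pM.
Qed.

Lemma house_leW x B C : (B <= C)%N -> house_le x B -> house_le x C.
Proof. by move=> lBC hx s; apply: le_trans (hx s) _; rewrite ler_nat. Qed.

Lemma house_leN x B : house_le x B -> house_le (- x) B.
Proof. by move=> hx s; rewrite !rmorphN normrN. Qed.

Lemma house_nat n : house_le n%:R n.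
Proof. by move=> s; rewrite !rmorph_nat normr_nat. Qed.

Lemma house_le_sum (I : Type) (r : seq I) (P : pred I) (F : I -> algC) (B : I -> nat) :
  (forall i, P i -> house_le (F i) (B i)) ->
  house_le (\sum_(i <- r | P i) F i) (\sum_(i <- r | P i) B i)%N.
Proof.
move=> h; elim/big_rec2: _ => [|i n y Pi hy]; first exact: house_nat 0.
exact: house_leD (h _ Pi) hy.
Qed.

Lemma house_exists x : exists B, house_le x B.
Proof.
have [s Ds] := closed_field_poly_normal (minCpoly x).
rewrite (monicP (minCpoly_monic x)) scale1r in Ds.
have [B hB] : exists B : nat, forall r, r \in s -> `|iota r| <= B%:R.
  elim: s {Ds} => [|r s [B IH]]; first by exists 0%N.
  have [b hb] : exists b : nat, `|iota r| <= b%:R.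
    exists (Num.bound (complex.Re `|iota r|)).
    have -> : `|iota r| = (complex.Re `|iota r|)%:C%C.
      by rewrite normc_def /=.
    rewrite -(rmorph_nat (real_complex R)) lecR.
    by apply/ltW/archi_boundP; rewrite (normc_def (iota r)) /= sqrtr_ge0.
  exists (maxn b B) => y; rewrite inE => /predU1P[->|/IH h].
    by apply: le_trans hb _; rewrite ler_nat leq_maxl.
  by apply: le_trans h _; rewrite ler_nat leq_maxr.
exists B => sg; apply: hB; rewrite -root_prod_XsubC -Ds.
by rewrite -(minCpoly_aut sg) root_minCpoly.
Qed.

(** The witness m is the absolute value of the product z of all conjugates of
    x. Bounding all the conjugates gives its size, bounding all but x itself
    gives the lower bound for x, and the product of the other conjugates is
    the cofactor. *)
Lemma norm_divisor x d B : x \in Aint -> x != 0 -> (size (minCpoly x) <= d.+1)%N ->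
  (0 < B)%N -> house_le x B ->
  exists m : nat, [/\ (0 < m <= B ^ d)%N, (m%:R <= `|iota x| * B%:R ^+ d)
    & exists2 y, y \in Aint & m%:R = x * y].
Proof.
move=> ix nzx szx B0 hx.
have [s Ds] := closed_field_poly_normal (minCpoly x).
rewrite (monicP (minCpoly_monic x)) scale1r in Ds.
have conj_s r : r \in s -> exists sigma : {rmorphism algC -> algC}, sigma x = r.
  by move=> rs; apply: conj_root_minCpoly; rewrite Ds root_prod_XsubC.
have xs : x \in s by rewrite -root_prod_XsubC -Ds root_minCpoly.
have szs : (size s <= d)%N.
  by move: szx; rewrite Ds size_prod_XsubC.
pose z := \prod_(r <- s) r.
have iz : z \in Num.int.
  have : (minCpoly x)`_0 \in Num.int.
    by have := ix; rewrite unfold_in => /polyOverP.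
  rewrite Ds -horner_coef0 horner_prod.
  have -> : \prod_(r <- s) ('X - r%:P).[0] = (-1) ^+ size s * z.
    rewrite /z; elim: (s) => [|r s' IH]; first by rewrite !big_nil mul1r.
    by rewrite !big_cons IH hornerXsubC sub0r /= exprS; ring.
  have [e|e] := boolP (odd (size s)).
    by rewrite -signr_odd e expr1 mulN1r rpredN.
  by rewrite -signr_odd (negbTE e) expr0 mul1r.
have nzz : z != 0.
  rewrite /z prodf_seq_neq0; apply/allP => r /conj_s[sg <-] /=.
  by rewrite fmorph_eq0.
have [m Dm] : exists m : nat, z = m%:R \/ z = - m%:R.
  have /intrP[[k|k] ->] := iz; first by exists k; left; rewrite pmulrn.
  by exists k.+1; right; rewrite NegzE mulrNz.
have Nz : `|iota z| = m%:R.
  by case: Dm => ->; rewrite ?rmorphN ?normrN rmorph_nat normr_nat.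
have m0 : (0 < m)%N.
  rewrite lt0n; apply: contraNneq nzz => m0.
  by case: Dm => ->; rewrite m0 ?oppr0.
have hr (t : seq algC) : {subset t <= s} -> \prod_(r <- t) `|iota r| <= B%:R ^+ size t.
  elim: t => [|r t IH] sub; first by rewrite big_nil expr0.
  rewrite big_cons /= exprS ler_pM ?prodr_ge0 //.
    by have [sg <-] := conj_s r (sub _ (mem_head _ _)); apply: hx.
  by apply: IH => y yt; apply: sub; rewrite inE yt orbT.
have Dz : z = x * \prod_(r <- rem x s) r by rewrite /z (perm_big _ (perm_to_rem xs)) big_cons.
have B1 : 1 <= B%:R :> R[i] by rewrite (ler_nat _ 1).
exists m; split.
- rewrite m0 /= -(ler_nat R[i]) -Nz /z rmorph_prod normr_prod.
  apply: le_trans (hr s _) _ => //.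
  by rewrite natrX; apply: ler_weXn2l.
- rewrite -Nz Dz rmorphM normrM ler_wpM2l // rmorph_prod normr_prod.
  apply: le_trans (hr _ _) _; first by move=> y; apply: mem_rem.
  by apply: ler_weXn2l => //; rewrite size_rem // (leq_trans (leq_pred _)).
- have irest : \prod_(r <- rem x s) r \in Aint.
    rewrite big_seq rpred_prod // => r /mem_rem /conj_s[sg <-].
    by rewrite Aint_aut.
  case: Dm => e; last first.
    by exists (- \prod_(r <- rem x s) r); rewrite ?rpredN // mulrN -Dz e opprK.
  by exists (\prod_(r <- rem x s) r); rewrite // -Dz e.
Qed.

Lemma liouville x d B : x \in Aint -> x != 0 -> (size (minCpoly x) <= d.+1)%N ->
  (0 < B)%N -> house_le x B -> 1 <= `|iota x| * B%:R ^+ d.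
Proof.
move=> ix nzx szx B0 hx.
have [m [/andP[m0 _] h _]] := norm_divisor ix nzx szx B0 hx.
by apply: le_trans h; rewrite (ler_nat _ 1).
Qed.

End House.

(** * Equations of rank one with geometric denominators *)

(** F_n = T^n A_n / n!, where A_n y is the n-th derivative of a solution of
    y' = (p/T) y; no coprimality of p and T is assumed. *)
Definition gal_seq (T p : {poly algC}) : nat -> {poly algC} := flow_from T (- p) 1.

Definition gal_bounded (T p : {poly algC}) : Prop :=
  exists C : nat, forall k, exists D : nat,
    (0 < D <= C ^ k.+1)%N /\
    forall n, (n <= k)%N -> D%:R *: gal_seq T p n \is a integral.

Lemma integralZ (c : algC) (q : {poly algC}) :
  c \in Aint -> q \is a integral -> c *: q \is a integral.
Proof. by move=> ic /polyOverP iq; apply/polyOverP => i; rewrite coefZ rpredM. Qed.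

Lemma Aint_nat n : n%:R \in Aint.
Proof. by rewrite rpred_nat. Qed.

Lemma Aint_denom (x : algC) : exists2 m : nat, (0 < m)%N & m%:R * x \in Aint.
Proof.
have [q [Dq mq] _] := minCpolyP x.
have [z [a nza Dz]] := rat_poly_scale q.
pose u : {poly algC} := map_poly intr z.
have Du : u = (a%:~R : algC) *: minCpoly x.
  rewrite Dq Dz map_polyZ /= -map_poly_comp scalerA fmorphV /= rmorph_int.
  rewrite mulfV ?intr_eq0 // scale1r; apply: eq_map_poly => b /=.
  by rewrite rmorph_int.
have : lead_coef u * x \in Aint.
  apply: lead_root_integral; last first.
    by rewrite Du rootZ ?intr_eq0 // root_minCpoly.
  by apply/polyOverP => i; rewrite coef_map /= Aint_int.
rewrite Du lead_coefZ (monicP (minCpoly_monic x)) mulr1.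
case: a nza {Dz u Du} => [m|m] nza; first by exists m => //; rewrite lt0n.
by rewrite NegzE mulrNz mulNr rpredN => h; exists m.+1.
Qed.

Lemma integral_denom (q : {poly algC}) :
  exists2 m : nat, (0 < m)%N & m%:R *: q \is a integral.
Proof.
elim/poly_ind: q => [|q c [m m0 iq]].
  by exists 1%N => //; rewrite scaler0 rpred0.
have [d d0 ic] := Aint_denom c.
exists (m * d)%N; first by rewrite muln_gt0 m0.
rewrite scalerDr rpredD //.
  rewrite mulnC natrM -scalerA integralZ ?Aint_nat //.
  by rewrite scalerAl rpredM ?polyOverX.
by rewrite -mul_polyC -polyCM polyOverC natrM -mulrA rpredM ?Aint_nat.
Qed.

Lemma gal_seq_flow T p : flow T (- p) (gal_seq T p).
Proof. exact: flow_fromP. Qed.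

Lemma gal_seq_eq T p x : flow T (- p) x -> x 0%N = 1 -> gal_seq T p =1 x.
Proof. by move=> fx x0; apply: (flow_uniq (gal_seq_flow T p) fx); rewrite x0. Qed.

Lemma gal_seqM S T p n : gal_seq (S * T) (S * p) n = S ^+ n * gal_seq T p n.
Proof.
apply: (gal_seq_eq (x := fun n => S ^+ n * gal_seq T p n)); last by rewrite mul1r.
move=> {}n; rewrite -mulrnAr gal_seq_flow derivM deriv_exp derivM.
case: n => [|n] /=; first by rewrite expr0 expr1 !mulr0n; ring.
by rewrite !exprS; move: (S ^+ n) (gal_seq T p n.+1) => s g; ring.
Qed.

Lemma gal_boundedM S T p : gal_bounded T p -> gal_bounded (S * T) (S * p).
Proof.
move=> [C hC]; have [m m0 iS] := integral_denom S.
exists (m * C)%N => k; have [D [/andP[D0 DC] hD]] := hC k.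
exists (m ^ k * D)%N; split=> [|n lenk].
  rewrite muln_gt0 expn_gt0 m0 D0 expnMn leq_mul //.
  by rewrite leq_pexp2l.
rewrite gal_seqM natrM natrX -(subnK lenk) exprD -!scalerA.
rewrite [_ ^+ n *: _](_ : _ = (m%:R *: S) ^+ n * (D%:R *: gal_seq T p n)).
  by rewrite integralZ ?rpredX ?Aint_nat // rpredM ?rpredX ?hD.
by rewrite exprZn -scalerAr -scalerAl !scalerA mulrC.
Qed.

(** Passing from S T to T divides the n-th term by S^n. By [dedekind] it
    suffices to multiply by the leading coefficient of S^n, whose inverse has
    a geometric denominator. *)
Lemma gal_bounded_cancel S T p : S != 0 -> gal_bounded (S * T) (S * p) -> gal_bounded T p.
Proof.
move=> nzS [C hC]; set s := lead_coef S.
have nzs : s != 0 by rewrite lead_coef_eq0.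
have [m m0 is_] := Aint_denom s^-1.
exists (m * C)%N => k; have [D [/andP[D0 DC] hD]] := hC k.
exists (m ^ k * D)%N; split=> [|n lenk].
  rewrite muln_gt0 expn_gt0 m0 D0 expnMn leq_mul //.
  by rewrite leq_pexp2l.
have := hD n lenk; rewrite gal_seqM scalerAr => /dedekind h.
apply/polyOverP => i; rewrite coefZ natrM natrX -(subnK lenk) exprD.
have := h (size (S ^+ n)).-1 i; rewrite -lead_coefE lead_coef_exp -/s coefZ => hi.
have -> : m%:R ^+ (k - n) * m%:R ^+ n * D%:R * (gal_seq T p n)`_i =
   m%:R ^+ (k - n) * (m%:R * s^-1) ^+ n * (s ^+ n * (D%:R * (gal_seq T p n)`_i)).
  by rewrite exprMn exprVn; field; rewrite expf_neq0.
by rewrite rpredM // rpredM ?rpredX ?Aint_nat.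
Qed.

(** The solution of y' = ((p + q)/T) y is a product of solutions, so that its
    sequence is the Cauchy product of the two sequences. *)
Lemma gal_boundedD T p q : gal_bounded T p -> gal_bounded T q -> gal_bounded T (p + q).
Proof.
move=> [C hC] [C' hC']; exists (C * C')%N => k.
have [D [/andP[D0 DC] hD]] := hC k; have [D' [/andP[D0' DC'] hD']] := hC' k.
exists (D * D')%N; split=> [|n lenk].
  by rewrite muln_gt0 D0 D0' expnMn leq_mul.
have fx : flow T (- (p + q)) (conv (gal_seq T p) (gal_seq T q)).
  by rewrite opprD; apply: flow_conv; apply: gal_seq_flow.
rewrite (gal_seq_eq fx) ?conv0 ?mulr1 // /conv scaler_sumr rpred_sum // => i _.
rewrite natrM -scalerA scalerAr scalerAl rpredM ?hD ?hD' //.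
  by apply: leq_trans lenk; rewrite -ltnS.
by apply: leq_trans lenk; apply: leq_subr.
Qed.

(** Legendre's formula, with the series for p compared to the one for 2. *)
Lemma logn_fact_leq p n : prime p -> (logn p n`! <= n)%N.
Proof.
move=> pp; rewrite logn_fact //.
have h j : (\sum_(1 <= k < j.+1) n %/ 2 ^ k + n %/ 2 ^ j <= n)%N.
  elim: j => [|j IH]; first by rewrite big_geq // expn0 divn1.
  apply: leq_trans IH; rewrite big_nat_recr //= -addnA leq_add2l addnn -muln2.
  by rewrite expnSr divnMA leq_trunc_div.
apply: leq_trans (h n); apply: leq_trans (leq_addr _ _).
apply: leq_sum => -[|k] _; first by rewrite !expn0.
by rewrite leq_div2l ?expn_gt0 // leq_exp2r // prime_gt1.
Qed.

Lemma dvdz_prodB (d : int) n (x y : 'I_n -> int) :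
  (forall i, (d %| x i - y i)%Z) -> (d %| \prod_i x i - \prod_i y i)%Z.
Proof.
move=> h; elim/big_rec2: _ => [|i u v _ IH]; first by rewrite subrr dvdz0.
rewrite (_ : _ - _ = x i * (v - u) + (x i - y i) * u); last by ring.
by apply: rpredD; [exact: dvdz_mull | exact: dvdz_mulr].
Qed.

Lemma prod_ffact (m n : nat) : \prod_(i < n) (m%:Z - i%:Z) = (m ^_ n)%:Z.
Proof.
elim: n => [|n IH]; first by rewrite big_ord0 ffactn0.
rewrite big_ord_recr /= IH ffactnSr PoszM.
have [lenm|ltmn] := leqP n m; first by rewrite subzn.
by rewrite ffact_small // !mul0r.
Qed.

(** Split n! as N_1 N_2, where N_1 has only prime factors of q and N_2 is
    prime to q. N_1 divides q^n by [logn_fact_leq]. Modulo N_2 the number q is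
    invertible, so the progression becomes q^n m (m - 1) ... (m - n + 1), a
    multiple of n!. *)
Lemma fact_dvd_progression (a : int) (q n : nat) : (0 < q)%N ->
  ((n`!)%:Z %| q%:Z ^+ n * \prod_(i < n) (a - i%:Z * q%:Z))%Z.
Proof.
move=> q0; pose pi : nat_pred := \pi(q); set N := n`!.
have Nuv : N = (N`_pi * N`_pi^')%N by rewrite partnC ?fact_gt0.
set v := (N`_pi)%N in Nuv *; set u := (N`_pi^')%N in Nuv *.
have vdvd : (v %| q ^ n)%N.
  apply/dvdn_partP => [|p pv]; first exact: part_gt0.
  have : p \in pi by apply: pnatPpi pv; apply: part_pnat.
  rewrite mem_primes => /and3P[pp _ pq].
  rewrite p_part; apply: (@dvdn_trans (p ^ n)); last exact: dvdn_exp2r.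
  apply: dvdn_exp2l; apply: leq_trans (logn_fact_leq n pp).
  by rewrite dvdn_leq_log ?fact_gt0 // dvdn_part.
have cop : coprimez q%:Z u%:Z.
  rewrite coprimezE; apply: (@pnat_coprime pi); first exact: pnat_pi.
  exact: part_pnat.
have [[b c] /= Dbc] := coprimezP _ _ cop.
have u0 : (0 < u)%N by apply: part_gt0.
(* m represents a/q modulo u and is made nonnegative by adding a multiple of u. *)
have [m Dm] : exists m : nat, m%:Z = a * b + `|a * b| * u%:Z.
  have : 0 <= a * b + `|a * b| * u%:Z.
    have : `|a * b| <= `|a * b| * u%:Z by rewrite ler_peMr.
    by have := ler_norm (- (a * b)); rewrite normrN; lia.
  by case: (_ + _) => // m _; exists m.
have hu : (u%:Z %| \prod_(i < n) (a - i%:Z * q%:Z))%Z.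
  have h1 : (u%:Z %| \prod_(i < n) (a - i%:Z * q%:Z) - \prod_(i < n) (q%:Z * (m%:Z - i%:Z)))%Z.
    apply: dvdz_prodB => i; apply/dvdzP; exists (a * c - q%:Z * `|a * b|).
    rewrite Dm -[X in X - _ - _]mulr1 -Dbc; ring.
  have h2 : (u%:Z %| \prod_(i < n) (q%:Z * (m%:Z - i%:Z)))%Z.
    rewrite big_split /= prod_ffact dvdz_mull // -bin_ffact PoszM dvdz_mull //.
    by rewrite dvdzE /= dvdn_part.
  by have := rpredD h1 h2; rewrite subrK.
by rewrite Nuv PoszM dvdz_mul // dvdzE abszX.
Qed.

Lemma binomial_denom (al : rat) : exists2 q : nat, (0 < q)%N &
  forall n, q%:R ^+ (2 * n) * (\prod_(i < n) (ratr al - i%:R) / n`!%:R) \in Aint.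
Proof.
set q := `|denq al|%N.
have q0 : (0 < q)%N by rewrite absz_gt0 denq_eq0.
exists q => // n.
have Dal : ratr al = (numq al)%:~R / q%:R :> algC.
  by rewrite -[in LHS](divq_num_den al) fmorph_div /= !rmorph_int pmulrn absz_denq.
have /dvdzP[c Dc] := fact_dvd_progression (numq al) n q0.
rewrite (_ : _ * _ = c%:~R) ?Aint_int //.
have nzf : n`!%:R != 0 :> algC by rewrite pnatr_eq0 -lt0n fact_gt0.
apply: (mulIf nzf); rewrite -[RHS](rmorphM intr c n`!%:Z) -Dc rmorphM /=.
rewrite mulrA mulfVK // mul2n -addnn exprD -mulrA rmorphXn /= -pmulrn; congr (_ * _).
rewrite rmorph_prod -[n in q%:R ^+ n]card_ord -prodr_const -big_split /=.
apply: eq_bigr => i _; rewrite rmorphB rmorphM /= -!pmulrn mulrBr Dal.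
by rewrite mulrC mulfVK ?pnatr_eq0 -?lt0n // [i%:R * _]mulrC.
Qed.

(** For y = z^alpha the F_n are the binomial coefficients of alpha times S^n. *)
Lemma gal_bounded_power (al : rat) S : gal_bounded ('X * S) ((ratr al)%:P * S).
Proof.
have [q q0 hq] := binomial_denom al.
pose b n : algC := \prod_(i < n) (ratr al - i%:R) / n`!%:R.
have [m m0 iS] := integral_denom S.
exists (m * q ^ 2)%N => k; exists (m ^ k * (q ^ 2) ^ k)%N; split=> [|n lenk].
  by rewrite muln_gt0 !expn_gt0 m0 q0 expnMn leq_mul ?leq_pexp2l ?expn_gt0 ?q0.
have fx : flow ('X * S) (- ((ratr al)%:P * S)) (fun n => b n *: S ^+ n).
  move=> j; have -> : b j.+1 = (ratr al - j%:R) * b j / j.+1%:R.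
    by rewrite /b big_ord_recr /= factS natrM invfM; ring.
  rewrite -scaler_nat scalerA mulrCA mulfV ?pnatr_eq0 // mulr1.
  move: (b j) (ratr al) => c d.
  rewrite derivZ deriv_exp derivM derivX mul1r -!mul_polyC !rmorphM rmorphB rmorph_nat /=.
  move: (c%:P) (d%:P) => c' d'.
  case: j => [|j] /=; first by rewrite expr0 expr1 !mulr0n; ring.
  by rewrite !exprS; move: (S ^+ j) S^`() => e f; ring.
rewrite (gal_seq_eq fx) /b ?big_ord0 ?fact0 ?divr1 ?scale1r //.
rewrite -[_ / _]/(b n) scalerA -expnM.
have -> : (m ^ k * q ^ (2 * k))%:R * b n =
    m%:R ^+ (k - n) * q%:R ^+ (2 * (k - n)) * (q%:R ^+ (2 * n) * b n) * m%:R ^+ n.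
  have -> : (m ^ k * q ^ (2 * k) = m ^ (k - n) * m ^ n * (q ^ (2 * (k - n)) * q ^ (2 * n)))%N.
    by rewrite -!expnD -mulnDr subnK.
  rewrite -!natrX !natrM; move: (b n) => c.
  move: (q ^ (2 * (k - n)))%N (q ^ (2 * n))%N (m ^ (k - n))%N (m ^ n)%N => *; ring.
rewrite -scalerA -exprZn integralZ ?rpredX //.
by rewrite rpredM ?hq // rpredM ?rpredX ?Aint_nat.
Qed.

(** This is the case y = P/Q, split into the factors P and 1/Q. The
    derivatives of P are integral up to the denominator of P, those of 1/Q by
    [flow_integral]. *)
Lemma gal_bounded_rational P Q T p : P != 0 -> Q != 0 ->
  T * (P^`() * Q - P * Q^`()) = p * (P * Q) -> gal_bounded T p.
Proof.
move=> nzP nzQ e.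
have bP : gal_bounded P P^`().
  have [m m0 iP] := integral_denom P.
  have nzm : (m%:R)%:P != 0 :> {poly algC} by rewrite polyC_eq0 pnatr_eq0 -lt0n.
  apply: (gal_bounded_cancel nzm); rewrite mul_polyC mul_polyC -derivZ.
  set P1 := _ *: P in iP *.
  exists 1%N => k; exists 1%N; split=> [|n _]; first by rewrite exp1n.
  have fx : flow P1 (- P1^`()) (fun n => if n is n'.+1 then P1 ^+ n' * P1^`N(n'.+1) else 1).
    case=> [|{}n]; first by rewrite nderivn1 derivC; ring.
    rewrite derivM deriv_nderivn deriv_exp.
    case: n => [|n]; first by rewrite expr1 expr0 !mulr0n; ring.
    rewrite /= !exprS.
    move: (P1 ^+ n) P1^`() (P1^`N(n.+3)) P1^`N(n.+2) => a b c d; ring.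
  rewrite (gal_seq_eq fx) // scale1r; case: n => [|n]; first exact: rpred1.
  by rewrite rpredM ?rpredX ?integral_nderivn.
have bQ : gal_bounded Q (- Q^`()).
  have [m m0 iQ] := integral_denom Q.
  have nzm : (m%:R)%:P != 0 :> {poly algC} by rewrite polyC_eq0 pnatr_eq0 -lt0n.
  apply: (gal_bounded_cancel nzm); rewrite mul_polyC mul_polyC scalerN -derivZ.
  set Q1 := _ *: Q in iQ *.
  exists 1%N => k; exists 1%N; split=> [|n _]; first by rewrite exp1n.
  rewrite scale1r; apply: (@flow_integral Q1 1); rewrite ?rpred1 //.
  by have := @gal_seq_flow Q1 (- Q1^`()); rewrite opprK.
have := gal_boundedM Q bP; rewrite [Q * P]mulrC => h1.
have := gal_boundedD h1 (gal_boundedM P bQ) => /(gal_boundedM T) h.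
apply: (@gal_bounded_cancel (P * Q)); first by rewrite mulf_neq0.
have e1 : P * Q * T = T * (P * Q) by rewrite mulrC.
have e2 : P * Q * p = T * (Q * P^`() + P * - Q^`()) by rewrite mulrC -e; ring.
by rewrite e1 e2.
Qed.

(** * Siegel's lemma *)

Section Siegel.
Variables (R : realType) (iota : {rmorphism algC -> R[i]}).

Lemma normc_le_Re_Im (z : R[i]) :
  `|z| <= (`|complex.Re z| + `|complex.Im z|)%:C%C.
Proof.
have h0 : 0 <= `|complex.Re z| + `|complex.Im z| by rewrite addr_ge0.
rewrite normc_def lecR -[X in _ <= X]ger0_norm // -sqrtr_sqr ler_wsqrtr //.
rewrite sqrrD !real_normK ?num_real // addrAC lerDl mulrn_wge0 // mulr_ge0.
Qed.

Lemma normc_ge_Im (z : R[i]) : `|complex.Im z|%:C%C <= `|z|.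
Proof. by rewrite normc_def lecR -sqrtr_sqr ler_wsqrtr // lerDr sqr_ge0. Qed.

Lemma norm_lt_Re_Im (z : R[i]) (c : R) :
  `|complex.Re z| < c -> `|complex.Im z| < c -> `|z| < (c *+ 2)%:C%C.
Proof.
move=> hre him; apply: le_lt_trans (normc_le_Re_Im z) _.
by rewrite ltcR mulr2n ltrD.
Qed.

Lemma abs_Re_le (z : R[i]) (B : nat) : `|z| <= B%:R -> `|complex.Re z| <= B%:R.
Proof.
move=> h; rewrite -lecR rmorph_nat; apply: le_trans h; exact: normc_ge_Re.
Qed.

Lemma abs_Im_le (z : R[i]) (B : nat) : `|z| <= B%:R -> `|complex.Im z| <= B%:R.
Proof.
move=> h; rewrite -lecR rmorph_nat; apply: le_trans h; exact: normc_ge_Im.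
Qed.

(** Index of the interval of length 1/G containing x, counted from - V. *)
Definition cell (G V : nat) (x : R) : nat := Num.truncn (G%:R * (x + V%:R)).

Lemma cell_bound G V x : `|x| <= V%:R -> (cell G V x < (G * (V * 2)).+1)%N.
Proof.
rewrite ler_norml => /andP[h1 h2]; rewrite ltnS /cell.
have h0 : 0 <= G%:R * (x + V%:R) by rewrite mulr_ge0 // -(opprK V%:R) subr_ge0.
rewrite -(ler_nat R); have := truncn_le (G%:R * (x + V%:R)); rewrite h0 => h.
by apply: le_trans h _; rewrite natrM ler_wpM2l // natrM mulr_natr mulr2n lerD2r.
Qed.

Lemma cell_eq G V x y : `|x| <= V%:R -> `|y| <= V%:R -> cell G V x = cell G V y ->
  G%:R * `|x - y| < 1.
Proof.
move=> hx hy; rewrite /cell => e.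
have h (z : R) : `|z| <= V%:R -> 0 <= G%:R * (z + V%:R).
  by rewrite ler_norml => /andP[h1 h2]; rewrite mulr_ge0 // -(opprK V%:R) subr_ge0.
have /andP[a1 a2] := truncn_itv (h _ hx); have /andP[b1 b2] := truncn_itv (h _ hy).
rewrite e in a1 a2; rewrite -[G%:R]ger0_norm // -normrM ltr_norml.
move: a1 a2 b1 b2; rewrite -natr1; set u := (Num.truncn _)%:R => a1 a2 b1 b2.
by apply/andP; split; lra.
Qed.

Lemma absz_subn_le (x y h : nat) : (x < h.+1)%N -> (y < h.+1)%N ->
  (`|x%:Z - y%:Z| <= h)%N.
Proof. by rewrite !ltnS; lia. Qed.

(** Thue's form of Siegel's lemma. The vectors q with entries in [0, H]
    outnumber the cells in which the real and imaginary parts of the M linear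
    forms can fall. Two vectors in the same cells give values of size less
    than 2/G = V^-d, which by [liouville] can only be zero. *)
Lemma siegel (K : fieldExtType rat) (j : {rmorphism K -> algC}) (d n M B : nat)
    (a : 'I_M -> 'I_n -> algC) :
  (forall u, size (minCpoly (j u)) <= d.+1)%N ->
  (0 < n)%N -> (0 < B)%N -> (4 * d.+1 * M <= n)%N ->
  (forall k i, [/\ exists u, j u = a k i, a k i \in Aint & house_le iota (a k i) B]) ->
  exists q : 'I_n -> int,
    [/\ exists i, q i != 0, forall i, (`|q i| <= 5 * n * B)%N
      & forall k, \sum_i (q i)%:~R * a k i = 0].
Proof.
move=> hd n0 B0 hM ha; set H := (5 * n * B)%N; set V := (n * (H * B))%N.
have H0 : (0 < H)%N by rewrite !muln_gt0 n0.
have V0 : (0 < V)%N by rewrite /V muln_gt0 n0 /= muln_gt0; apply/andP.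
(* The mesh 1/G makes the difference of two values in one cell smaller than V^-d. *)
set G := (2 * V ^ d)%N; set L := (G * (V * 2))%N.
pose v (q : 'I_n -> int) k := \sum_i (q i)%:~R * a k i.
have hv q k : (forall i, (`|q i| <= H)%N) -> house_le iota (v q k) V.
  move=> hq; have -> : V = (\sum_(i < n) H * B)%N by rewrite sum_nat_const card_ord.
  apply: house_le_sum => i _; apply: house_leM; last by case: (ha k i).
  by move=> s; rewrite !rmorph_int -intr_norm -natr_absz ler_nat.
pose pos (q : {ffun 'I_n -> 'I_H.+1}) (i : 'I_n) : int := (q i : nat)%:Z.
pose code (q : {ffun 'I_n -> 'I_H.+1}) : {ffun 'I_M -> 'I_L.+1 * 'I_L.+1} :=
  [ffun k => (inord (cell G V (complex.Re (iota (v (pos q) k)))),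
              inord (cell G V (complex.Im (iota (v (pos q) k)))))].
have hpos q i : (`|pos q i| <= H)%N by rewrite /pos /= -ltnS.
have card_lt : (#|{ffun 'I_M -> 'I_L.+1 * 'I_L.+1}| < #|{ffun 'I_n -> 'I_H.+1}|)%N.
  rewrite !card_ffun card_prod !card_ord mulnn -expnM.
  apply: (@leq_ltn_trans (H ^ n)); last by rewrite ltn_exp2r.
  apply: (@leq_trans ((H ^ (2 * d.+1)) ^ (2 * M))).
    have h1 : (L.+1 <= H ^ (2 * d.+1))%N.
      have -> : (H ^ (2 * d.+1) = (5 * V) ^ d.+1)%N.
        by rewrite expnM; congr (_ ^ _)%N; rewrite /V /H; lia.
      rewrite /L /G expnMn expnS; have : (0 < V ^ d.+1)%N by rewrite expn_gt0 V0.
      rewrite expnS; have : (0 < 5 ^ d)%N by rewrite expn_gt0.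
      by move: (V ^ d)%N (5 ^ d)%N => x z; nia.
    by case: (M) => // m; rewrite leq_exp2r // muln_gt0.
  rewrite -expnM leq_pexp2l //; lia.
have /injectivePn : ~~ injectiveb code.
  apply: contraTN card_lt => /injectiveP inj; rewrite -leqNgt.
  exact: leq_card inj.
case=> q [q' neq ecode].
pose dq i : int := pos q i - pos q' i.
have hdq i : (`|dq i| <= H)%N.
  rewrite /dq /pos; move: (q i) (q' i) => [x hx] [y hy] /=.
  exact: absz_subn_le.
exists dq; split=> //.
  have [i ni|h] := pickP (fun i => q i != q' i).
    by exists i; rewrite subr_eq0 eqz_nat.
  by case/eqP: neq; apply/ffunP => i; apply/eqP; have := h i; case: eqP.
move=> k; rewrite -/(v dq k); apply/eqP; apply: contraT => nz.
have [inK iA] : (exists u, j u = v dq k) /\ v dq k \in Aint.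
  split; last by rewrite rpred_sum // => i _; rewrite rpredM ?Aint_int //; case: (ha k i).
  apply: (big_ind (fun x => exists u, j u = x)).
  - by exists 0; rewrite rmorph0.
  - by move=> _ _ [u <-] [w <-]; exists (u + w); rewrite rmorphD.
  - by move=> i _; case: (ha k i) => -[u <-] _ _; exists ((dq i)%:~R * u); rewrite rmorphM rmorph_int.
have [u Du] := inK.
have szm : (size (minCpoly (v dq k)) <= d.+1)%N by rewrite -Du.
have := liouville iA nz szm V0 (hv dq k hdq).
have Dv : v dq k = v (pos q) k - v (pos q') k.
  by rewrite /v -sumrB; apply: eq_bigr => i _; rewrite -mulrBl -rmorphB.
have hV q1 : `|iota (v (pos q1) k)| <= V%:R by apply: (hv _ _ (hpos q1) idfun).
have eRe : G%:R * `|complex.Re (iota (v dq k))| < 1.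
  rewrite Dv rmorphB; have -> : forall x y : R[i], complex.Re (x - y) = complex.Re x - complex.Re y.
    by case=> ? ? [? ?].
  apply: (@cell_eq G V); rewrite ?abs_Re_le //.
  have := congr1 (fun f : {ffun 'I_M -> 'I_L.+1 * 'I_L.+1} => (f k).1 : nat) ecode.
  by rewrite !ffunE /= !inordK // cell_bound ?abs_Re_le.
have eIm : G%:R * `|complex.Im (iota (v dq k))| < 1.
  rewrite Dv rmorphB; have -> : forall x y : R[i], complex.Im (x - y) = complex.Im x - complex.Im y.
    by case=> ? ? [? ?].
  apply: (@cell_eq G V); rewrite ?abs_Im_le //.
  have := congr1 (fun f : {ffun 'I_M -> 'I_L.+1 * 'I_L.+1} => (f k).2 : nat) ecode.
  by rewrite !ffunE /= !inordK // cell_bound ?abs_Im_le.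
have G0 : 0 < G%:R :> R by rewrite ltr0n muln_gt0 expn_gt0 V0.
rewrite mulrC -ltr_pdivlMr // mul1r in eRe; rewrite mulrC -ltr_pdivlMr // mul1r in eIm.
have := norm_lt_Re_Im eRe eIm => hlt.
move=> h1; suff h2 : `|iota (v dq k)| * V%:R ^+ d < 1.
  by have := le_lt_trans h1 h2; rewrite ltxx.
apply: (@lt_le_trans _ _ ((G%:R^-1 *+ 2)%:C%C * V%:R ^+ d)).
  by rewrite ltr_pM2r // exprn_gt0 // ltr0n.
rewrite -(rmorph_nat (real_complex R)) -rmorphXn -rmorphM /= lecR.
have nz2 : V%:R ^+ d != 0 :> R by rewrite expf_neq0 // pnatr_eq0 -lt0n.
rewrite -mulr_natr /G natrM natrX (_ : _ * _ = 1) //.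
by field.
Qed.
End Siegel.

(** * Formal solutions of first order equations *)

Definition cauchy_coef (u : {poly algC}) (y : nat -> algC) (k : nat) : algC :=
  \sum_(i < k.+1) u`_i * y (k - i)%N.

(** The equation X S y' - p y = e, for the formal series y with coefficients
    y n. *)
Definition euler_eq (S p e : {poly algC}) (y : nat -> algC) : Prop :=
  forall m, \sum_(i < m.+1) (S`_i * (m - i)%:R - p`_i) * y (m - i)%N = e`_m.

(** Irrationality of the power series with coefficients y n. *)
Definition irrational_seq (y : nat -> algC) : Prop :=
  forall Q : {poly algC}, Q != 0 -> forall n, exists2 k, (n <= k)%N & cauchy_coef Q y k != 0.

Lemma dvdXnP n (u : {poly algC}) :
  'X^n %| u <-> forall i, (i < n)%N -> u`_i = 0.
Proof.
split=> [/dvdpP[v ->] i ltin|h]; first by rewrite coefMXn ltin.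
apply/dvdpP; exists (drop_poly n u).
rewrite -[LHS](poly_take_drop n) [take_poly n u](_ : _ = 0) ?add0r //.
by apply/polyP => i; rewrite coef_take_poly coef0; case: ifP => // /h.
Qed.

Lemma coef_mul_trunc (u : {poly algC}) y L k :
  (k < L)%N -> (u * \poly_(i < L) y i)`_k = cauchy_coef u y k.
Proof.
move=> ltkL; rewrite coefM; apply: eq_bigr => i _; rewrite coef_poly.
by rewrite (leq_ltn_trans (leq_subr _ _) ltkL).
Qed.

Lemma euler_trunc (S p e : {poly algC}) y L : euler_eq S p e y ->
  'X^L %| 'X * S * (\poly_(i < L) y i)^`() - p * (\poly_(i < L) y i) - e.
Proof.
move=> he; apply/dvdXnP => k ltkL; rewrite -mulrA mulrCA !coefB -he coef_mul_trunc //.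
rewrite coefM -!sumrB big1 // => i _; rewrite coefXM coef_deriv coef_poly.
case E : (k - i)%N => [|m]; first by rewrite eqxx /=; ring.
rewrite /= -E (leq_ltn_trans (leq_subr _ _) ltkL) E -mulr_natr; ring.
Qed.

Lemma lowest_coef (u : {poly algC}) : u != 0 ->
  exists q u1, [/\ u = u1 * 'X^q, u1`_0 != 0 & (q < size u)%N].
Proof.
move=> nzu; have ex : exists i, u`_i != 0.
  by exists (size u).-1; rewrite -lead_coefE lead_coef_eq0.
case: (ex_minnP ex) => q nzq minq.
have /dvdXnP/dvdpP[u1 Du] : forall i, (i < q)%N -> u`_i = 0.
  move=> i ltiq; apply/eqP; apply: contraTT ltiq => /minq.
  by rewrite -leqNgt.
exists q, u1; split=> //; first by move: nzq; rewrite Du coefMXn ltnn subnn.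
by rewrite ltnNge; apply: contra nzq => /leq_sizeP/(_ q (leqnn q))->.
Qed.

(** The recurrence of coefficients has leading factor S_s x - p_s at index x:
    a nonzero polynomial of degree at most one, hence nonzero for large x. *)
Lemma indicial (S p : {poly algC}) : S != 0 -> exists s k0 : nat,
  (forall i, (i < s)%N -> S`_i = 0 /\ p`_i = 0) /\
  (forall x : nat, (k0 < x)%N -> S`_s * x%:R - p`_s != 0).
Proof.
move=> nzS; have ex : exists i, (S`_i != 0) || (p`_i != 0).
  by exists (size S).-1; rewrite -lead_coefE lead_coef_eq0 nzS.
case: (ex_minnP ex) => s nzs mins.
have [k0 hk0] : exists k0 : nat, forall x : nat, (k0 < x)%N -> S`_s * x%:R - p`_s != 0.
  have [S0|nzSs] := eqVneq S`_s 0.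
    exists 0%N => x _; rewrite S0 mul0r sub0r oppr_eq0.
    by move: nzs; rewrite S0 eqxx.
  have [[x0 e0]|no] := pselect (exists x0 : nat, S`_s * x0%:R = p`_s).
    exists x0 => x ltx; rewrite -e0 -mulrBr mulf_neq0 // -natrB ?(ltnW ltx) //.
    by rewrite pnatr_eq0 subn_eq0 -ltnNge.
  by exists 0%N => x _; apply/eqP => /eqP; rewrite subr_eq0 => /eqP e; apply: no; exists x.
exists s, k0; split=> // i ltis.
have := contraNN (mins i); rewrite -ltnNge => /(_ ltis).
by rewrite negb_or !negbK => /andP[/eqP-> /eqP->].
Qed.

(** Beyond the largest root of the indicial polynomial, the recurrence
    expresses each coefficient rationally in the previous ones. *)
Lemma euler_number_field (S p e : {poly algC}) y : S != 0 -> euler_eq S p e y ->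
  exists (K : fieldExtType rat) (j : {rmorphism K -> algC}) (d : nat),
    [/\ forall m, exists u, j u = y m,
      forall i, [/\ exists u, j u = S`_i, exists u, j u = p`_i & exists u, j u = e`_i]
      & forall u, (size (minCpoly (j u)) <= d.+1)%N].
Proof.
move=> nzS he; have [s [k0 [hs hk0]]] := indicial p nzS.
have [K [j [d [hK hd]]]] := number_field_degree
  (polyseq S ++ polyseq p ++ polyseq e ++ [seq y i | i <- iota 0 k0.+1]).
exists K, j, d; pose inK x := exists u, j u = x.
have K0 : inK 0 by exists 0; rewrite rmorph0.
have KD a b : inK a -> inK b -> inK (a + b).
  by move=> [u <-] [v <-]; exists (u + v); rewrite rmorphD.
have KN a : inK a -> inK (- a) by move=> [u <-]; exists (- u); rewrite rmorphN.
have KM a b : inK a -> inK b -> inK (a * b).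
  by move=> [u <-] [v <-]; exists (u * v); rewrite rmorphM.
have KV a : inK a -> inK a^-1 by move=> [u <-]; exists u^-1; rewrite fmorphV.
have Kn n : inK n%:R by exists n%:R; rewrite rmorph_nat.
have coefK (u : {poly algC}) i : (forall x, x \in polyseq u -> inK x) -> inK u`_i.
  move=> h; case: (ltnP i (size u)) => [lt|ge]; first by apply: h; apply: mem_nth.
  by rewrite nth_default.
have SK i : inK S`_i by apply: coefK => x xS; apply: hK; rewrite !mem_cat xS.
have pK i : inK p`_i by apply: coefK => x xS; apply: hK; rewrite !mem_cat xS orbT.
have eK i : inK e`_i by apply: coefK => x xS; apply: hK; rewrite !mem_cat xS !orbT.
split=> [|i|]; [|split; [apply: SK|apply: pK|apply: eK]|exact: hd].
elim/ltn_ind => m IH; have [lemk|ltkm] := leqP m k0.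
  apply: hK; rewrite !mem_cat; apply/or4P/Or44; apply/mapP; exists m => //.
  by rewrite mem_iota.
have := he (m + s)%N.
have lts : (s < (m + s).+1)%N by rewrite ltnS leq_addl.
rewrite (bigD1 (Ordinal lts)) //= addnK.
set X := \sum_(_ < _ | _) _ => e0.
have e1 : (S`_s * m%:R - p`_s) * y m = e`_(m + s) - X by rewrite -e0 addrK.
rewrite -/(inK _).
have XK : inK X.
  apply: (big_ind inK) => // i nis.
  have [ltis|leis] := ltnP i s.
    by have [-> ->] := hs i ltis; rewrite mul0r subr0 mul0r.
  apply/KM; first by apply/KD; [apply/KM | apply/KN].
  apply: IH; have : (i : nat) != s by apply: contraNneq nis => e'; apply/eqP/val_inj.
  by lia.
have -> : y m = (e`_(m + s) - X) / (S`_s * m%:R - p`_s).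
  by rewrite -e1 mulrC mulKf // hk0.
by apply/KM; [apply/KD => //; apply/KN | apply/KV/KD; [apply/KM|apply/KN]].
Qed.

(** If the determinant vanished, P/Q would satisfy the equation, and the
    remainder r = Q y - P divided by Q would satisfy the homogeneous equation.
    Its order at 0 is v - q, where q < n is the order of Q, so that it exceeds
    M >= k0; but the order of a solution is a root of the indicial polynomial. *)
Lemma approximant_det_neq0 (S p e : {poly algC}) y (Q : {poly algC}) n M s k0 :
  euler_eq S p e y -> Q != 0 -> (size Q <= n)%N ->
  (forall i, (i < s)%N -> S`_i = 0 /\ p`_i = 0) ->
  (forall x : nat, (k0 < x)%N -> S`_s * x%:R - p`_s != 0) ->
  (k0 <= M)%N ->
  (forall k, (n <= k < n + M)%N -> cauchy_coef Q y k = 0) ->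
  (exists2 k, (n <= k)%N & cauchy_coef Q y k != 0) ->
  forall P, P = \poly_(k < n) cauchy_coef Q y k ->
  Q * ('X * S * P^`() - p * P - e * Q) - 'X * S * Q^`() * P != 0.
Proof.
move=> he nzQ szQ hs hk0 leM hvan [k1 lek1 nzk1] P DP; apply/eqP => e0.
have ex : exists v, (n <= v)%N && (cauchy_coef Q y v != 0) by exists k1; rewrite lek1.
case: (ex_minnP ex) => v /andP[lenv nzv] minv.
have lev : (n + M <= v)%N.
  rewrite leqNgt; apply: contra nzv => ltv.
  by rewrite hvan // lenv ltv.
have [q [Q1 [DQ nzQ1 ltq]]] := lowest_coef nzQ.
(* The contradiction is read off from the coefficient of X^(s + q + v): s is the common
   order of S and p, q that of Q, and v that of the remainder. *)
pose L := (s + q + v).+1; pose Y : {poly algC} := \poly_(i < L) y i.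
have ltvL : (v < L)%N by rewrite /L; lia.
have [E DE] := dvdpP _ _ (euler_trunc L he); rewrite -/Y in DE.
pose r := Q * Y - P.
have rk k : (k < v)%N -> r`_k = 0.
  move=> ltkv; rewrite coefB coef_mul_trunc; last exact: ltn_trans ltvL.
  rewrite DP coef_poly; case: ltnP => [_|lenk]; first by rewrite subrr.
  rewrite subr0; apply/eqP; apply: contraTT ltkv => nzk.
  by rewrite -leqNgt minv // lenk.
have rv : r`_v != 0.
  rewrite coefB coef_mul_trunc // DP coef_poly ltnNge lenv subr0; exact: nzv.
have /dvdXnP/dvdpP[r1 Dr] := rk.
have nzr1 : r1`_0 != 0 by move: rv; rewrite Dr coefMXn ltnn subnn.
have [S1 DS] : exists S1, S = S1 * 'X^s.
  by apply/dvdpP/dvdXnP => i /hs[].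
have [p1 Dp] : exists p1, p = p1 * 'X^s.
  by apply/dvdpP/dvdXnP => i /hs[].
have S1s : S1`_0 = S`_s by rewrite DS coefMXn ltnn subnn.
have p1s : p1`_0 = p`_s by rewrite Dp coefMXn ltnn subnn.
have id1 : S * (Q * ('X * r^`()) - ('X * Q^`()) * r) = p * Q * r + Q ^+ 2 * (E * 'X^L).
  have -> : r^`() = Q^`() * Y + Q * Y^`() - P^`() by rewrite derivB derivM.
  rewrite -DE /r; apply/eqP; rewrite -subr_eq0; apply/eqP; rewrite -[RHS]oppr0 -[X in _ = - X]e0; ring.
have XD (u : {poly algC}) k : 'X * (u * 'X^k)^`() = 'X^k * ('X * u^`() + u *+ k).
  rewrite derivM derivXn; case: k => [|k]; first by rewrite expr0 !mulr0n; ring.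
  by rewrite /= exprS; ring.
have id2 : S1 * (Q1 * ('X * r1^`() + r1 *+ v) - ('X * Q1^`() + Q1 *+ q) * r1) =
    p1 * Q1 * r1 + Q ^+ 2 * E * 'X.
  apply: (@mulIf _ 'X^(s + q + v)); first by rewrite expf_neq0 // polyX_eq0.
  have -> : (p1 * Q1 * r1 + Q ^+ 2 * E * 'X) * 'X^(s + q + v) =
      p * Q * r + Q ^+ 2 * (E * 'X^L).
    by rewrite Dp Dr {2}DQ /L (exprS 'X) !exprD; ring.
  rewrite -id1 Dr [in RHS]DQ !XD DS !exprD; ring.
have := congr1 (fun u : {poly algC} => u.[0]) id2.
rewrite !hornerE /= -!horner_coef0 in nzQ1 nzr1 S1s p1s *.
rewrite !hornerMn S1s p1s => e1.
have : (S`_s * (v - q)%:R - p`_s) * (Q1.[0] * r1.[0]) = 0.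
  rewrite natrB; last by lia.
  move: e1; rewrite ?(mul0r, add0r, mulr0, addr0) => e1.
  rewrite -[RHS](subrr (p`_s * Q1.[0] * r1.[0])) -{1}e1; ring.
by apply/eqP; rewrite !mulf_neq0 // hk0 //; lia.
Qed.

(** * Pade approximants and their determinants *)

Section Approximants.
Variables (T p e Q : {poly algC}) (n : nat) (y : nat -> algC).

(** The pair ([hasse] i, [partner] i) is T^i/i! times the i-th derivative of
    (Q, P), where the second component is differentiated modulo the equation
    satisfied by y. *)
Definition hasse (i : nat) : {poly algC} := T ^+ i * Q^`N(i).

Fixpoint partner (i : nat) : {poly algC} :=
  if i is m.+1 then
    (m.+1%:R^-1 : algC) *:
      (T * (partner m)^`() - (T^`() *+ m + p) * partner m - e * hasse m)
  else \poly_(k < n) cauchy_coef Q y k.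

Lemma partnerS i : partner i.+1 *+ i.+1 =
  T * (partner i)^`() - (T^`() *+ i + p) * partner i - e * hasse i.
Proof. by rewrite -scaler_nat /= scalerA mulfV ?scale1r // pnatr_eq0. Qed.

Lemma hasseS i : hasse i.+1 *+ i.+1 = T * (hasse i)^`() - (T^`() *+ i) * hasse i.
Proof. by rewrite /hasse (flow_nderivn T Q i) addr0. Qed.

Lemma hasse0 : hasse 0 = Q. Proof. by rewrite /hasse mul1r nderivn0. Qed.

Lemma hasse1 : hasse 1 = T * Q^`(). Proof. by rewrite /hasse expr1 nderivn1. Qed.

Lemma size_mulX_deriv S t (u : {poly algC}) : T = 'X * S ->
  (size S <= t)%N -> (size (T * u^`())%R <= size u + t)%N.
Proof.
move=> DT st; have [->|nzu] := eqVneq u 0; first by rewrite deriv0 mulr0 size_poly0.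
rewrite DT mulrAC; apply: leq_trans (size_polyMleq _ _) _.
have : (size ('X * u^`())%R <= size u)%N.
  rewrite mulrC; have [->|nzd] := eqVneq u^`() 0; first by rewrite mul0r size_poly0.
  by rewrite size_mulX // lt_size_deriv.
by move=> h; apply: leq_trans (leq_pred _) _; rewrite leq_add.
Qed.

Lemma size_derivX S t (i : nat) : T = 'X * S -> (size S <= t)%N ->
  (size (T^`() *+ i) <= t)%N.
Proof.
move=> DT st; rewrite -scaler_nat; apply: leq_trans (size_scale_leq _ _) _.
apply/leq_sizeP => k lek; rewrite coef_deriv DT coefXM /= nth_default ?mul0rn //.
exact: leq_trans lek.
Qed.

Lemma size_hasse S t i : T = 'X * S -> (size Q <= n)%N -> (size S <= t)%N -> (size (hasse i) <= n + i * t)%N.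
Proof.
move=> DT sQ st; elim: i => [|i IH]; first by rewrite hasse0 mul0n addn0.
have -> : (size (hasse i.+1) = size (hasse i.+1 *+ i.+1))%N.
  by rewrite -scaler_nat size_scale // pnatr_eq0.
rewrite hasseS mulSn; apply: leq_trans (size_polyD _ _) _; rewrite geq_max size_polyN.
apply/andP; split; first by apply: leq_trans (size_mulX_deriv _ DT st) _; rewrite [(t + _)%N]addnC addnA leq_add2r.
apply: leq_trans (size_polyMleq _ _) _; apply: leq_trans (leq_pred _) _.
by rewrite addnCA leq_add // (size_derivX _ DT).
Qed.

Lemma size_partner S t i : T = 'X * S -> (size Q <= n)%N -> (size S <= t)%N -> (size p <= t)%N ->
  (size e <= t)%N -> (size (partner i) <= n + i * t)%N.
Proof.
move=> DT sQ st sp se; elim: i => [|i IH]; first by rewrite mul0n addn0 size_poly.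
have -> : (size (partner i.+1) = size (partner i.+1 *+ i.+1))%N.
  by rewrite -scaler_nat [in RHS]size_scale // pnatr_eq0.
rewrite partnerS mulSn; apply: leq_trans (size_polyD _ _) _; rewrite geq_max size_polyN.
apply/andP; split.
  apply: leq_trans (size_polyD _ _) _; rewrite geq_max size_polyN.
  apply/andP; split.
    by apply: leq_trans (size_mulX_deriv _ DT st) _; rewrite [(t + _)%N]addnC addnA leq_add2r.
  apply: leq_trans (size_polyMleq _ _) _.
  have : (size (T^`() *+ i + p)%R <= t)%N.
    apply: leq_trans (size_polyD _ _) _; rewrite geq_max sp andbT.
    exact: size_derivX DT st.
  by move=> h; apply: leq_trans (leq_pred _) _; rewrite addnCA leq_add.
apply: leq_trans (size_polyMleq _ _) _.
by apply: leq_trans (leq_pred _) _; rewrite addnCA leq_add // (size_hasse i DT sQ st).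
Qed.

(** [hasse] i times y minus [partner] i is obtained from Q y - P by i steps of
    the first order operator of the equation, none of which lowers the order
    at 0. *)
Lemma remainder_order S M i : T = 'X * S -> euler_eq S p e y ->
  (forall k, (n <= k < n + M)%N -> cauchy_coef Q y k = 0) ->
  'X^(n + M) %| hasse i * (\poly_(k < n + M) y k) - partner i.
Proof.
move=> DT he hvan; set L := (n + M)%N; set Y := \poly_(k < L) y k.
elim: i => [|i IH].
  rewrite hasse0; apply/dvdXnP => k ltk; rewrite coefB coef_mul_trunc // coef_poly.
  by case: ltnP => [_|lenk]; rewrite ?subrr // hvan ?subr0 // lenk.
have [E DE] := dvdpP _ _ (euler_trunc L he); rewrite -/Y -DT in DE.
suff : 'X^L %| (hasse i.+1 * Y - partner i.+1) *+ i.+1.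
  by rewrite -scaler_nat dvdpZr // pnatr_eq0.
rewrite mulrnBl -mulrnAl hasseS partnerS.
set r := hasse i * Y - partner i.
have -> : (T * (hasse i)^`() - T^`() *+ i * hasse i) * Y -
   (T * (partner i)^`() - (T^`() *+ i + p) * partner i - e * hasse i) =
   (T * r^`() - (T^`() *+ i + p) * r) - hasse i * (E * 'X^L).
  by rewrite -DE /r derivB (derivM (hasse i)); move: (T^`() *+ i) (hasse i) => t h; ring.
apply: dvdp_sub; last by rewrite !dvdp_mull.
by apply: dvdXn_flow => //; rewrite DT dvdp_mulr.
Qed.

Definition wedge j k : {poly algC} := hasse j * partner k - hasse k * partner j.

Lemma wedgeS j k : T * (wedge j k)^`() - (T^`() *+ (j + k) + p) * wedge j k =
  wedge j.+1 k *+ j.+1 + wedge j k.+1 *+ k.+1.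
Proof.
have -> : wedge j.+1 k *+ j.+1 =
    (hasse j.+1 *+ j.+1) * partner k - hasse k * (partner j.+1 *+ j.+1).
  by rewrite mulrnBl mulrnAl mulrnAr.
have -> : wedge j k.+1 *+ k.+1 =
    hasse j * (partner k.+1 *+ k.+1) - (hasse k.+1 *+ k.+1) * partner j.
  by rewrite mulrnBl mulrnAl mulrnAr.
rewrite !hasseS !partnerS /wedge; move: (hasse j) (hasse k) => hj hk.
rewrite derivB !derivM mulrnDr.
move: (T^`() *+ j) (T^`() *+ k) => tj tk; ring.
Qed.

(** Weighted sums of the 2 x 2 determinants of total order i + 1; the weights
    k are those for which the sequence is a flow again. *)
Definition minor (i : nat) : {poly algC} :=
  \sum_(k < i.+2) wedge (i.+1 - k) k *+ k.

Lemma minor0 : minor 0 = wedge 0 1.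
Proof. by rewrite /minor !big_ord_recl big_ord0 /= mulr0n add0r addr0. Qed.

(** Differentiating a determinant differentiates one of its columns at a time
    ([wedgeS]); in the weighted sum the two contributions recombine. *)
Lemma flow_minor : flow T (T^`() + p) minor.
Proof.
move=> i; have -> : T^`() *+ i + (T^`() + p) = T^`() *+ i.+1 + p by rewrite mulrS; ring.
rewrite {2 3}/minor raddf_sum !mulr_sumr -sumrB.
have -> : \sum_(k < i.+2) (T * (wedge (i.+1 - k) k *+ k)^`() -
     (T^`() *+ i.+1 + p) * (wedge (i.+1 - k) k *+ k)) =
   \sum_(k < i.+2) wedge (i.+2 - k) k *+ (i.+2 - k) *+ k +
   \sum_(k < i.+2) wedge (i.+1 - k) k.+1 *+ k.+1 *+ k.
  rewrite -big_split /=; apply: eq_bigr => k _.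
  have lek : (k <= i.+1)%N by rewrite -ltnS.
  rewrite derivMn !mulrnAr -mulrnBl (_ : T^`() *+ i.+1 = T^`() *+ (i.+1 - k + k)); last by rewrite subnK.
  by rewrite wedgeS -subSn // -mulrnDl.
have -> : \sum_(k < i.+2) wedge (i.+2 - k) k *+ (i.+2 - k) *+ k =
   \sum_(k < i.+3) wedge (i.+2 - k) k *+ (i.+2 - k) *+ k.
  by rewrite [RHS]big_ord_recr /= subnn mulr0n mul0rn addr0.
have -> : \sum_(k < i.+2) wedge (i.+1 - k) k.+1 *+ k.+1 *+ k =
   \sum_(k < i.+3) wedge (i.+2 - k) k *+ k *+ k.-1.
  by rewrite [RHS]big_ord_recl /= mulr0n add0r; apply: eq_bigr => k _.
rewrite -big_split /minor -sumrMnl; apply: eq_bigr => -[[|k] ltk] _ /=.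
  by rewrite !mulr0n mul0rn addr0.
rewrite -!mulrnA -mulrnDr; congr (_ *+ _).
by rewrite subSS [((i.+1 - k) * _)%N]mulnC -mulnDr subnK.
Qed.

(** The coefficients of [partner] i are, up to its degree, those of [hasse] i
    times y, because the remainder starts later; these are integral once
    multiplied by D, whereas the defining recurrence of [partner] would bring
    in factorials. *)
Lemma integral_approximants S t M D i : T = 'X * S ->
  euler_eq S p e y -> S \is a integral -> Q \is a integral ->
  (size Q <= n)%N -> (size S <= t)%N -> (size p <= t)%N -> (size e <= t)%N ->
  (forall k, (n <= k < n + M)%N -> cauchy_coef Q y k = 0) ->
  (forall k, (k < n + M)%N -> D%:R * y k \in Aint) ->
  (i * t <= M)%N ->
  hasse i \is a integral /\ D%:R *: partner i \is a integral.
Proof.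
move=> DT he iS iQ sQ sS sp se hvan hD leM.
have iT : T \is a integral by rewrite DT rpredM ?polyOverX.
have ih : hasse i \is a integral by rewrite rpredM ?rpredX ?integral_nderivn.
split=> //; apply/polyOverP => k.
have [lek|ltk] := leqP (size (D%:R *: partner i)) k; first by rewrite nth_default.
have {}ltk : (k < n + M)%N.
  apply: leq_trans ltk _; apply: leq_trans (size_scale_leq _ _) _.
  by apply: leq_trans (@size_partner S t i DT sQ sS sp se) _; rewrite leq_add2l.
have /dvdXnP/(_ k ltk)/eqP := remainder_order i DT he hvan.
rewrite coefB subr_eq0 coefZ => /eqP <-; rewrite coef_mul_trunc // mulr_sumr.
rewrite rpred_sum // => m _; rewrite mulrCA rpredM ?(polyOverP ih) //.
by apply: hD; apply: leq_ltn_trans ltk; apply: leq_subr.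
Qed.

Lemma integral_minor D k i : (forall j, (j <= k.+1)%N ->
    hasse j \is a integral /\ D%:R *: partner j \is a integral) ->
  (i <= k)%N -> D%:R *: minor i \is a integral.
Proof.
move=> h leik; rewrite /minor scaler_sumr rpred_sum // => j _.
have [h1 h2] : hasse (i.+1 - j) \is a integral /\ D%:R *: partner (i.+1 - j) \is a integral.
  by apply: h; apply: leq_trans (leq_subr _ _) _.
have [h3 h4] : hasse j \is a integral /\ D%:R *: partner j \is a integral.
  by apply: h; have := ltn_ord j; lia.
rewrite -scalerMnr rpredMn // scalerBr rpredB //.
  by rewrite scalerAr rpredM.
by rewrite scalerAr rpredM.
Qed.

(** The sequences G j started at the minors are the integral ones of
    [flow_integral], and the identity [flow_alternating] expresses F_i H_0 in
    them. *)
Lemma integral_gal_minor D k : T \is a integral ->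
  (forall i, (i <= k)%N -> D%:R *: minor i \is a integral) ->
  forall i, (i <= k)%N -> D%:R *: (gal_seq T p i * minor 0) \is a integral.
Proof.
move=> iT hm i leik.
pose G j := flow_from T (T^`() *+ j.+1) (minor j).
have hG j : G j 0%N = minor j /\ flow T (T^`() *+ j.+1) (G j).
  by split=> //; apply: flow_fromP.
rewrite (flow_alternating (@gal_seq_flow T p) _ flow_minor hG) //.
rewrite scaler_sumr rpred_sum // => j _; rewrite -scalerMnr rpredMn // scalerAr rpredM //.
  by rewrite rpredX // rpredN rpred1.
rewrite addn0.
have fG : flow T (T^`() *+ j.+1) (fun m => D%:R *: G j m).
  by move=> m; rewrite scalerMnr (hG j).2 derivZ scalerBr -!scalerAr.
apply: (flow_integral iT _ fG) => /=.
by apply: hm; have := ltn_ord j; lia.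
Qed.

End Approximants.

Section SizeBounds.
Variables (R : realType) (iota : {rmorphism algC -> R[i]}).

Definition phouse (u : {poly algC}) (A : nat) : Prop := forall i, house_le iota u`_i A.

Lemma phouseW u A B : (A <= B)%N -> phouse u A -> phouse u B.
Proof. by move=> le h i; apply: house_leW (h i). Qed.

Lemma phouseD u v A B : phouse u A -> phouse v B -> phouse (u + v) (A + B)%N.
Proof. by move=> hu hv i; rewrite coefD; apply: house_leD. Qed.

Lemma phouseB u v A B : phouse u A -> phouse v B -> phouse (u - v) (A + B)%N.
Proof. by move=> hu hv i; rewrite coefB; apply: house_leD => //; apply: house_leN. Qed.

Lemma sum_ltn_leq (k s : nat) : (\sum_(i < k) (i < s)%N <= s)%N.
Proof.
suff -> : (\sum_(i < k) (i < s)%N = minn k s)%N by apply: geq_minr.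
elim: k => [|k IH]; first by rewrite big_ord0 min0n.
by rewrite big_ord_recr /= IH; lia.
Qed.

Lemma house_cauchy (u : {poly algC}) (y : nat -> algC) A B s k :
  phouse u A -> (forall i, (i <= k)%N -> house_le iota (y i) B) -> (size u <= s)%N ->
  house_le iota (cauchy_coef u y k) (s * (A * B))%N.
Proof.
move=> hu hv su.
have h : house_le iota (cauchy_coef u y k) (\sum_(i < k.+1) (i < s)%N * (A * B))%N.
  apply: house_le_sum => i _.
  case: ltnP => [_|le]; first by rewrite mul1n; apply: house_leM => //; apply/hv/leq_subr.
  rewrite nth_default ?mul0r ?mul0n; last exact: leq_trans le.
  exact: house_nat 0.
by apply: house_leW h; rewrite -big_distrl /= leq_mul2r sum_ltn_leq orbT.
Qed.

Lemma phouseM u v A B s : phouse u A -> phouse v B -> (size u <= s)%N ->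
  phouse (u * v) (s * (A * B))%N.
Proof.
by move=> hu hv su k; rewrite coefM; apply: (@house_cauchy u (fun i => v`_i)).
Qed.

Lemma phouse_deriv u A s : phouse u A -> (size u <= s)%N -> phouse u^`() (s * A)%N.
Proof.
move=> hu su i; rewrite coef_deriv -mulr_natl.
have [lt|ge] := ltnP i.+1 (size u); last first.
  rewrite nth_default // mulr0; apply: house_leW (house_nat iota 0) => //.
apply: (@house_leW _ _ _ (i.+1 * A)); first by rewrite leq_mul2r (leq_trans (ltnW lt) su) orbT.
by apply: house_leM => //; apply: house_nat.
Qed.

Lemma phouse_exists u : exists A, phouse u A.
Proof.
elim/poly_ind: u => [|u c [A hA]].
  by exists 0%N => i; rewrite coef0; apply: house_nat 0.
have [B hB] := house_exists iota c.
exists (A + B)%N; apply: phouseD.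
  move=> i; rewrite coefMX; case: eqP => _ //; apply: house_leW (house_nat iota 0) => //.
move=> i; rewrite coefC; case: eqP => _ //; apply: house_leW (house_nat iota 0) => //.
Qed.

End SizeBounds.

(** * The theorem of the Chudnovskys *)

Section Chudnovsky.
Variables (R : realType) (iota : {rmorphism algC -> R[i]}).

(** Heights and denominators are bounded by powers of the same integer K,
    which makes the condition stable under sums and shifts. *)
Definition gevrey_seq (y : nat -> algC) : Prop :=
  exists K : nat, (forall n, house_le iota (y n) (K ^ n.+1)) /\
    forall n, exists2 D : nat, (0 < D <= K ^ n.+1)%N &
      forall m, (m <= n)%N -> D%:R * y m \in Aint.

(** The conditions are the vanishing of M coefficients of Q y, that is, M
    linear equations in n unknowns; D clears the denominators of their
    coefficients. *)
Lemma pade_numerator (K : fieldExtType rat) (j : {rmorphism K -> algC}) d n M D X y :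
  (forall u, size (minCpoly (j u)) <= d.+1)%N -> (forall m, exists u, j u = y m) ->
  (0 < n)%N -> (0 < X)%N -> (0 < D <= X)%N -> (4 * d.+1 * M <= n)%N ->
  (forall k, (k < n + M)%N -> D%:R * y k \in Aint) ->
  (forall k, (k < n + M)%N -> house_le iota (y k) X) ->
  exists q : 'I_n -> int, let Q : {poly algC} :=
      \poly_(i < n) oapp (fun i => (q i)%:~R) 0 (insub i : option 'I_n) in
    [/\ Q != 0, phouse iota Q (5 * n * (X * X)),
      forall k, (n <= k < n + M)%N -> cauchy_coef Q y k = 0
      & exists s : seq int, Q = map_poly intr (Poly s)].
Proof.
move=> hd hK n0 X0 /andP[D0 DX] hM hD hy.
pose a (k : 'I_M) (i : 'I_n) : algC := D%:R * y (n + k - i)%N.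
have lt (k : 'I_M) i : (n + k - i < n + M)%N.
  by apply: leq_ltn_trans (leq_subr _ _) _; rewrite ltn_add2l.
have XX0 : (0 < X * X)%N by rewrite muln_gt0 X0.
have [k i|q [[i0 nzq] hq eq0]] := @siegel R iota K j d n M (X * X) a hd n0 XX0 hM.
  split.
  - rewrite /a; have [u <-] := hK (n + k - i)%N; exists (D%:R * u).
    by rewrite rmorphM rmorph_nat.
  - exact: hD.
  - apply: house_leM; last exact: hy.
    by apply: house_leW DX _; apply: house_nat.
exists q; set Q := \poly_(i < n) _.
have Qq (i : 'I_n) : Q`_i = (q i)%:~R by rewrite coef_poly ltn_ord valK.
have Q0 i : (n <= i)%N -> Q`_i = 0 by move=> le; rewrite coef_poly ltnNge le.
split.
- apply: contraNneq nzq => e; have := Qq i0; rewrite e coef0 => /esym/eqP.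
  by rewrite intr_eq0.
- move=> i; have [lti|lei] := ltnP i n; last first.
    by rewrite Q0 //; apply: house_leW (house_nat iota 0).
  rewrite (Qq (Ordinal lti)) => s; rewrite !rmorph_int -intr_norm -natr_absz ler_nat.
  exact: hq.
- move=> k /andP[lenk ltk].
  have ltkM : (k - n < M)%N by lia.
  have := eq0 (Ordinal ltkM); rewrite /a /= subnKC // => e.
  have nzD : D%:R != 0 :> algC by rewrite pnatr_eq0 -lt0n.
  apply: (mulfI nzD); rewrite mulr0 -[RHS]e mulr_sumr.
  have -> : \sum_(i < n) (q i)%:~R * (D%:R * y (k - i)%N) =
      \sum_(i < n) Q`_i * (D%:R * y (k - i)%N) by apply: eq_bigr => i _; rewrite Qq.
  rewrite (big_ord_widen k.+1 (fun i => Q`_i * (D%:R * y (k - i)%N))) ?(leqW lenk) //.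
  rewrite [RHS]big_mkcond /=; apply: eq_bigr => i _; rewrite mulrCA.
  by case: ifP => // /negbT; rewrite -leqNgt => /Q0->; rewrite mul0r.
- exists [seq q i | i <- enum 'I_n].
  apply/polyP => i; rewrite coef_map coef_Poly /=.
  have [lti|lei] := ltnP i n; last first.
    by rewrite Q0 // nth_default ?rmorph0 // size_map size_enum_ord.
  rewrite (nth_map (Ordinal lti)) ?size_enum_ord // (Qq (Ordinal lti)).
  by congr (_ (q _)); apply: val_inj; rewrite /= nth_enum_ord.
Qed.

Lemma leq_triple (X Z : nat) : (5 <= X)%N -> (Z + Z + Z <= X * Z)%N.
Proof. by move=> h; nia. Qed.

Lemma leq_exponent (w c k d : nat) : (w <= c * k)%N -> (w * (17 * d) <= 17 * c * d * k)%N.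
Proof.
move=> h; have -> : (17 * c * d * k = c * k * (17 * d))%N by ring.
by rewrite leq_mul.
Qed.

Lemma linear_width (d k k0 t : nat) (M := ((k.+1 + k0) * t)%N) :
  ((4 * d.+1 * M + M).+1 <= ((4 * d.+1).+1 * (t * k0.+1)).+1 * k.+1)%N.
Proof.
have leM : (M <= t * k0.+1 * k.+1)%N.
  by rewrite /M mulnC -mulnA leq_mul2l; apply/orP; right; nia.
rewrite -mulSnr [leqRHS]mulSn -[leqLHS]add1n leq_add // -mulnA leq_mul2l /=.
exact: leM.
Qed.

(** Every quantity is measured in powers of X = K^w, where w is proportional
    to k: the degree, the denominators and the conjugates of the first n + M
    coefficients of y are all at most X, and each product or derivative of
    polynomials of degree less than X costs one more factor X. The exponent 17
    is the outcome for the coefficient eta of the determinant, whose norm is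
    therefore at most X^(17 d). *)
Lemma chudnovsky_integral (S p e : {poly algC}) (y : nat -> algC) :
  S \is a integral -> p \is a integral -> e \is a integral ->
  S != 0 -> euler_eq S p e y -> gevrey_seq y -> irrational_seq y ->
  gal_bounded ('X * S) p.
Proof.
move=> iS ip ie nzS he [K0 [hK0 hD0]] irr.
have [s [k0 [hs hk0]]] := indicial p nzS.
have [F [j [d [hF coefF hd]]]] := euler_number_field nzS he.
pose t := (size S + size p + size e).+1.
have [sS sp se] : [/\ size S <= t, size p <= t & size e <= t]%N by rewrite /t; split; lia.
have [AS hAS] := phouse_exists iota S; have [Ap hAp] := phouse_exists iota p.
have [Ae hAe] := phouse_exists iota e.
pose K := (K0 + AS + Ap + Ae + 5)%N.
have [K0K ASK ApK AeK] : [/\ K0 <= K, AS <= K, Ap <= K & Ae <= K]%N by rewrite /K; split; lia.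
(* w <= c (k + 1), see linear_width *)
pose c := ((4 * d.+1).+1 * (t * k0.+1)).+1.
exists (K ^ (17 * c * d))%N => k.
(* M makes the remainders vanish beyond the degrees of all k + 1 pairs and beyond the
   roots of the indicial polynomial; n is what Siegel's lemma asks for M equations. *)
pose M := ((k.+1 + k0) * t)%N; pose n := (4 * d.+1 * M)%N; pose w := (n + M).+1.
pose X := (K ^ w)%N.
have M0 : (0 < M)%N by rewrite muln_gt0.
have n0 : (0 < n)%N by rewrite muln_gt0.
have tM : (t <= M)%N by rewrite leq_pmull.
have K5 : (5 <= K)%N by rewrite leq_addl.
have KX : (K <= X)%N by rewrite -{1}[K]expn1 leq_pexp2l // (leq_trans _ K5).
have X5 : (5 <= X)%N := leq_trans K5 KX.
have X0 : (0 < X)%N by apply: leq_trans X5.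
have wX : (w <= X)%N.
  by apply: ltnW; apply: ltn_expl; apply: leq_trans K5.
have [nX tX] : (n <= X)%N /\ (n + t <= X)%N.
  by split; apply: leq_trans wX; rewrite /w; lia.
have hy i : (i < n + M)%N -> house_le iota (y i) X.
  move=> lti; apply: house_leW (hK0 i); rewrite /X.
  apply: (@leq_trans (K ^ i.+1)); first by rewrite leq_exp2r.
  by rewrite leq_pexp2l ?(leq_trans _ K5) // /w (leq_trans lti).
have [D /andP[D0 DX'] hD'] := hD0 (n + M)%N.
have DX : (D <= X)%N.
  by apply: leq_trans DX' _; rewrite leq_exp2r.
have hD i : (i < n + M)%N -> D%:R * y i \in Aint by move=> lti; apply: hD'; apply: ltnW.
have [||q [nzQ hQ hvan [sq DQ]]] := @pade_numerator F j d n M D X y hd hF n0 X0 _ _ hD hy.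
- by rewrite D0.
- by [].
move: nzQ hQ hvan DQ; set Q := \poly_(i < n) _ => nzQ hQ hvan DQ.
have sQ : (size Q <= n)%N by apply: size_poly.
have iQ : Q \is a integral.
  by rewrite DQ; apply/polyOverP => i; rewrite coef_map /= Aint_int.
have e0 : 'X * S = 'X * S by [].
have happ i : (i <= k.+1)%N -> hasse ('X * S) Q i \is a integral /\
    D%:R *: partner ('X * S) p e Q n y i \is a integral.
  move=> lei; apply: (@integral_approximants _ p e Q n y S t M D i e0) => //.
  by rewrite leq_mul2r (leq_trans lei) ?orbT // leq_addr.
set P := partner ('X * S) p e Q n y 0.
set m0 := minor ('X * S) p e Q n y 0.
have Dm0 : m0 = Q * ('X * S * P^`() - p * P - e * Q) - 'X * S * Q^`() * P.
  rewrite /m0 minor0 /wedge hasse0 hasse1 /= invr1 scale1r mulr0n add0r -/P.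
  by rewrite hasse0.
have nzm0 : m0 != 0.
  rewrite Dm0; apply: (approximant_det_neq0 he nzQ sQ hs hk0 _ hvan) => //.
    by rewrite /M; apply: leq_trans (leq_pmulr _ _); rewrite ?leq_addl.
  by have [k1 l1 l2] := irr Q nzQ n; exists k1.
have im0 : D%:R *: m0 \is a integral by apply: (integral_minor (k := k) happ).
have nzDm0 : D%:R *: m0 != 0 by rewrite scaler_eq0 negb_or nzm0 pnatr_eq0 -lt0n D0.
have [i0 nzeta] : exists i, (D%:R *: m0)`_i != 0.
  by exists (size (D%:R *: m0)).-1; rewrite -lead_coefE lead_coef_eq0.
set eta := _`_i0 in nzeta.
have ieta : eta \in Aint by apply: (polyOverP im0).
(* The coefficients of Q, P and the equation, hence eta, lie in one number field:
   this bounds the degree of eta independently of k. *)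
have [yF DyF] : exists yF : nat -> F, forall m, j (yF m) = y m.
  by have /choice[yF h] := hF; exists yF.
have polyF (u : {poly algC}) : (forall i, exists v, j v = u`_i) -> exists v, map_poly j v = u.
  move=> /choice[v hv]; exists (\poly_(i < size u) v i).
  apply/polyP => i; rewrite coef_map coef_poly /=; case: ltnP => [_|le]; first exact: hv.
  by rewrite rmorph0 nth_default.
have [SF DSF] : exists v, map_poly j v = S by apply: polyF => i; have [] := coefF i.
have [pF DpF] : exists v, map_poly j v = p by apply: polyF => i; have [] := coefF i.
have [eF DeF] : exists v, map_poly j v = e by apply: polyF => i; have [] := coefF i.
have [QF DQF] : exists v, map_poly j v = Q.
  by apply: polyF => i; rewrite DQ coef_map /=; eexists; apply: rmorph_int.
have [PF DPF] : exists v, map_poly j v = P.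
  apply: polyF => i; rewrite coef_poly; case: ifP => _; last by exists 0; rewrite rmorph0.
  exists (\sum_(i1 < i.+1) QF`_i1 * yF (i - i1)%N); rewrite rmorph_sum /=.
  by apply: eq_bigr => i1 _; rewrite rmorphM /= DyF -DQF coef_map.
have [etaF DetaF] : exists u, j u = eta.
  exists (D%:R * (QF * ('X * SF * PF^`() - pF * PF - eF * QF) - 'X * SF * QF^`() * PF)`_i0).
  rewrite rmorphM rmorph_nat /eta coefZ Dm0 -coef_map; congr (_ * _`_ _).
  rewrite !(rmorphB, rmorphM) /= !map_polyX -!deriv_map.
  by rewrite DQF DSF DPF DpF DeF.
have sz_eta : (size (minCpoly eta) <= d.+1)%N by rewrite -DetaF.
have sT : (size ('X * S)%R <= X)%N.
  apply: leq_trans tX; apply: leq_trans (size_polyMleq _ _) _; rewrite size_polyX add2n /=.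
  by rewrite -add1n leq_add.
have KXs A : (A <= K)%N -> (A <= X)%N by move=> h; apply: leq_trans KX.
have hS : phouse iota S X by apply: phouseW hAS; apply: KXs.
have hp : phouse iota p X by apply: phouseW hAp; apply: KXs.
have he' : phouse iota e X by apply: phouseW hAe; apply: KXs.
have hT : phouse iota ('X * S) X.
  by move=> i; rewrite coefXM; case: eqP => _ //; apply: house_leW (house_nat iota 0).
have pM a b (u v : {poly algC}) : phouse iota u (X ^ a) -> phouse iota v (X ^ b) ->
    (size u <= X)%N -> phouse iota (u * v) (X ^ (a + b).+1).
  move=> hu hv su; apply: phouseW (phouseM hu hv su).
  by rewrite expnS expnD.
have pdM b (u v : {poly algC}) : phouse iota u (X ^ b) ->
    (size u <= X)%N -> phouse iota u^`() (X ^ b.+1).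
  by move=> hu su; apply: phouseW (phouse_deriv hu su); rewrite expnS.
have h1 (u : {poly algC}) : phouse iota u X -> phouse iota u (X ^ 1) by rewrite expn1.
have hQ4 : phouse iota Q (X ^ 4).
  have X4 : (X ^ 4 = X * X * (X * X))%N by rewrite !expnS expn0 muln1 !mulnA.
  by apply: phouseW hQ; rewrite X4 leq_mul // leq_mul.
have hP6 : phouse iota P (X ^ 6).
  move=> i; rewrite coef_poly; case: ifP => lti; last by apply: house_leW (house_nat iota 0).
  have : house_le iota (cauchy_coef Q y i) (n * (X ^ 4 * X)).
    apply: house_cauchy => // i1 lei; apply: hy.
    by apply: leq_ltn_trans lei _; apply: leq_trans lti _; apply: leq_addr.
  by apply: house_leW; rewrite -expnSr expnS leq_mul.
have sP : (size P <= X)%N by apply: leq_trans nX; apply: size_poly.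
have sQX : (size Q <= X)%N by apply: leq_trans nX.
have tX' : (t <= X)%N by apply: leq_trans tX; apply: leq_addl.
have hP1 : phouse iota ('X * S * P^`() - p * P - e * Q) (X ^ 10).
  have a1 : phouse iota ('X * S * P^`()) (X ^ 9).
    by apply: (pM 1%N 7%N); [apply: h1|apply: (pdM 6%N P P)|].
  have a2 : phouse iota (p * P) (X ^ 9).
    apply: phouseW (pM 1%N 6%N _ _ (h1 _ hp) hP6 (leq_trans sp tX')).
    by rewrite leq_pexp2l.
  have a3 : phouse iota (e * Q) (X ^ 9).
    apply: phouseW (pM 1%N 4%N _ _ (h1 _ he') hQ4 (leq_trans se tX')).
    by rewrite leq_pexp2l.
  apply: phouseW (phouseB (phouseB a1 a2) a3).
  by rewrite expnS; apply: leq_triple.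
have heta : house_le iota eta (X ^ 17).
  have b1 : phouse iota (Q * ('X * S * P^`() - p * P - e * Q)) (X ^ 15).
    exact: (pM 4%N 10%N).
  have b2 : phouse iota ('X * S * Q^`()) (X ^ 7).
    by apply: (pM 1%N 5%N); [apply: h1|apply: (pdM 4%N Q Q)|].
  have b3 : phouse iota ('X * S * Q^`() * P) (X ^ 15).
    apply: phouseW (pM 7%N 6%N _ _ b2 hP6 _); first by rewrite leq_pexp2l.
    apply: leq_trans tX; rewrite -hasse1; have := @size_hasse ('X * S) Q n S t 1 e0 sQ sS.
    by rewrite mul1n.
  have hm : phouse iota m0 (X ^ 16).
    rewrite Dm0; apply: phouseW (phouseB b1 b3).
    by rewrite [X in (_ <= X)%N]expnS; apply: leq_trans (leq_triple _ X5); apply: leq_addr.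
  rewrite /eta coefZ expnS; apply: house_leM => //.
  by apply: house_leW DX _; apply: house_nat.
have X17 : (0 < X ^ 17)%N by rewrite expn_gt0 X0.
have [m [/andP[m_gt0 lem] _ [x ix Dm]]] := norm_divisor ieta nzeta sz_eta X17 heta.
exists m; split=> [|i leik].
  rewrite m_gt0; apply: leq_trans lem _; rewrite /X -!expnM leq_pexp2l ?(leq_trans _ K5) //.
  have lew : (w <= c * k.+1)%N by apply: linear_width.
  exact: leq_exponent.
have /dedekind hded : gal_seq ('X * S) p i * (D%:R *: m0) \is a integral.
  rewrite -scalerAr; apply: (@integral_gal_minor _ p e Q n y D k) => //.
    by rewrite rpredM ?polyOverX.
  by move=> i1; apply: (integral_minor happ).
apply/polyOverP => l; rewrite coefZ Dm mulrC mulrA.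
by rewrite rpredM // hded.
Qed.

(** Multiplying S, p and e by a common denominator reduces to integral
    coefficients. *)
Theorem chudnovsky (S p e : {poly algC}) (y : nat -> algC) :
  S != 0 -> euler_eq S p e y -> gevrey_seq y -> irrational_seq y ->
  gal_bounded ('X * S) p.
Proof.
move=> nzS he hy irr.
have [a a0 iS] := integral_denom S; have [b b0 ip] := integral_denom p.
have [c c0 ie] := integral_denom e.
pose m := (a * b * c)%N.
have nzm : m%:R != 0 :> algC by rewrite pnatr_eq0 !muln_eq0 !negb_or -!lt0n a0 b0 c0.
have nzmP : (m%:R)%:P != 0 :> {poly algC} by rewrite polyC_eq0.
apply: (gal_bounded_cancel nzmP).
rewrite mulrCA !mul_polyC.
have up n (u : {poly algC}) : (n %| m)%N -> n%:R *: u \is a integral -> m%:R *: u \is a integral.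
  by move=> /dvdnP[l ->] iu; rewrite natrM -scalerA integralZ ?Aint_nat.
have iS' := up a S (dvdn_mulr _ (dvdn_mulr _ (dvdnn a))) iS.
have ip' := up b p (dvdn_mulr _ (dvdn_mull _ (dvdnn b))) ip.
have ie' := up c e (dvdn_mull _ (dvdnn c)) ie.
apply: (chudnovsky_integral iS' ip' ie' _ _ hy irr); first by rewrite scaler_eq0 negb_or nzm.
move=> k; rewrite coefZ -he mulr_sumr; apply: eq_bigr => i _.
by rewrite !coefZ; ring.
Qed.

End Chudnovsky.

(** * Galochkin's condition for operators of order one *)

Local Notation "p %:F" := (@tofrac _ p).

Lemma ratfun_repr (x : ratfun) : let u := frac (repr x) in
  x * (u.2)%:F = (u.1)%:F /\ u.2 != 0.
Proof.
split; last exact: denom_ratioP.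
rewrite -[X in X * _]reprK; set u := repr x.
rewrite /tofrac; unlock tofrac.
have -> : forall y z : ratfun, y * z = FracField.mul y z by [].
rewrite -FracField.pi_mul; apply/eqP; rewrite FracField.equivf_def.
by rewrite /FracField.mulf !numden_Ratio ?mulf_neq0 ?oner_neq0 ?denom_ratioP // !mulr1 mulrC.
Qed.

Lemma rf_den_neq0 (x : ratfun) : rf_den x != 0.
Proof.
have [_ nz] := ratfun_repr x; rewrite /rf_den dvdp_div_eq0 ?dvdp_gcdr //.
Qed.

Lemma rf_numden (x : ratfun) : x * (rf_den x)%:F = (rf_num x)%:F.
Proof.
have [e nz] := ratfun_repr x; set u := frac (repr x) in e nz.
have nzg : gcdp u.1 u.2 != 0 by rewrite gcdp_eq0 negb_and nz orbT.
have nzgF : (gcdp u.1 u.2)%:F != 0 by rewrite tofrac_eq0.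
apply: (mulIf nzgF); rewrite -mulrA -!tofracM.
by rewrite /rf_den /rf_num -/u !divpK ?dvdp_gcdl ?dvdp_gcdr.
Qed.

Lemma coprime_rf (x : ratfun) : coprimep (rf_num x) (rf_den x).
Proof.
have [e nz] := ratfun_repr x; apply: coprimep_div_gcd.
by rewrite nz orbT.
Qed.

Lemma rf_cross (x : ratfun) p q : q != 0 -> x * q%:F = p%:F ->
  rf_num x * q = p * rf_den x.
Proof.
move=> nzq e; apply/eqP; rewrite -tofrac_eq !tofracM -e -rf_numden; apply/eqP; ring.
Qed.

Lemma rf_derivE (x : ratfun) p q : q != 0 -> x * q%:F = p%:F ->
  rf_deriv x * (q ^+ 2)%:F = (p^`() * q - p * q^`())%:F.
Proof.
move=> nzq e; have := rf_cross nzq e.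
rewrite /rf_deriv; have nzd := rf_den_neq0 x.
move: (rf_num x) (rf_den x) nzd => n d nzd e1.
have nzd2 : (d ^+ 2)%:F != 0 by rewrite tofrac_eq0 expf_neq0.
apply: (mulIf nzd2); rewrite mulrAC mulfVK // -!tofracM; congr (_%:F).
have := congr1 (@deriv _) e1; rewrite !derivM => e2.
have e3 : n^`() * q = p^`() * d + p * d^`() - n * q^`() by rewrite -e2 addrK.
transitivity (d * q * (n^`() * q) - (n * q) * q * d^`()); first by ring.
by rewrite e3 -[d * q * _]/(d * q * _) mulrBr e1; transitivity
  (d * q * (p^`() * d + p * d^`()) - d * q^`() * (n * q) - p * d * q * d^`());
  [ring | rewrite e1; ring].
Qed.

(** For a system of size one, the recurrence of the iterated matrices is the
    recurrence of [gal_seq], up to the factor n! / T^n. *)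
Lemma sys_iter_gal_seq (a : ratfun) T p (A : 'M[ratfun]_1) :
  T != 0 -> a * T%:F = p%:F -> A = a%:M ->
  forall n, sys_iter A n.+1 = (sys_iter A n.+1 0 0)%:M /\
    sys_iter A n.+1 0 0 * (T ^+ n.+1)%:F = (n.+1)`!%:R * (gal_seq T p n.+1)%:F.
Proof.
move=> nzT e DA n; split; first by apply/matrixP => i j; rewrite !ord1 mxE mulr1n.
elim: n => [|n IH].
  rewrite /sys_iter /= DA mxE mulr1n expr1 e (_ : 1`! = 1)%N // mul1r; congr (_%:F).
  by rewrite /gal_seq /= invr1 scale1r derivC; ring.
have -> : sys_iter A n.+2 0 0 =
    sys_iter A n.+1 0 0 * a + rf_deriv (sys_iter A n.+1 0 0).
  rewrite [in LHS]/sys_iter /= -/(sys_iter A n.+1) mxE; congr (_ + _).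
    by rewrite mxE big_ord1 DA [in X in _ * X]mxE mulr1n.
  by rewrite mxE.
move: IH; set B := sys_iter A n.+1 0 0; set F := gal_seq T p n.+1 => IH.
have nzTn m : T ^+ m != 0 by apply: expf_neq0.
have e1 : B * (T ^+ n.+1)%:F = ((n.+1)`!%:R * F)%:F by rewrite tofracM rmorph_nat.
have := rf_derivE (nzTn _) e1 => e2.
have e3 : rf_deriv B * (T ^+ n.+2)%:F = (n.+1)`!%:R * (T * F^`() - T^`() *+ n.+1 * F)%:F.
  have nzTF : (T ^+ n)%:F != 0 by rewrite tofrac_eq0.
  apply: (mulIf nzTF); rewrite -mulrA -tofracM -exprD (_ : n.+2 + n = n.+1 * 2)%N; last by lia.
  rewrite exprM e2 -(rmorph_nat (@tofrac _)) -!tofracM; congr (_%:F).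
  rewrite derivM deriv_exp -(rmorph_nat (@polyC _)) derivC /= exprS.
  by move: (T ^+ n) (_%:P) => t c; ring.
rewrite mulrDl e3 exprS tofracM mulrCA [B * a]mulrC.
have -> : T%:F * (a * B * (T ^+ n.+1)%:F) = (n.+1)`!%:R * (p * F)%:F.
  by rewrite tofracM -e -[a * B * _]mulrA IH; ring.
rewrite -mulrDr -tofracD (factS n.+1) natrM -[RHS]mulrA [RHS]mulrCA.
congr (_ * _); rewrite -(rmorph_nat (@tofrac _)) -tofracM; congr (_%:F).
by rewrite mulr_natl (gal_seq_flow T p); ring.
Qed.

Lemma gal_bounded_same (a : ratfun) T p T' p' : T != 0 -> T' != 0 ->
  a * T%:F = p%:F -> a * T'%:F = p'%:F -> gal_bounded T p -> gal_bounded T' p'.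
Proof.
move=> nzT nzT' e e' h; apply: (gal_bounded_cancel nzT).
have -> : T * p' = T' * p.
  by apply/eqP; rewrite -tofrac_eq !tofracM -e -e'; apply/eqP; ring.
by rewrite mulrC; apply: gal_boundedM.
Qed.

(** The denominator T of minimal degree need not be the one in the hypothesis,
    but the condition does not depend on it; a least common denominator exists
    because some common denominator does. *)
Lemma galochkin_1 (a : ratfun) T p (A : 'M[ratfun]_1) :
  T != 0 -> a * T%:F = p%:F -> A = a%:M -> gal_bounded T p -> galochkin A.
Proof.
move=> nzT e DA hT U [[nzU hU] _].
have [q Dq] := hU 0 0.
have e' : a * U%:F = q%:F by rewrite -Dq DA mxE mulr1n mulrC.
have [C hC] := gal_bounded_same nzT nzU e e' hT.
have hg k D : (0 < D)%N -> (forall n, (n <= k)%N -> D%:R *: gal_seq U q n \is a integral) ->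
    galochkin_denom A U k D.
  move=> D0 hD; split=> // -[//|n] /andP[_ lenk] i j.
  exists (D%:R *: gal_seq U q n.+1); split; first exact: hD.
  have [_ e2] := sys_iter_gal_seq nzU e' DA n.
  rewrite !ord1; have nzf : (n.+1)`!%:R != 0 :> ratfun.
    rewrite -(rmorph_nat (@tofrac _)) tofrac_eq0 -(rmorph_nat (@polyC _)) polyC_eq0.
    by rewrite pnatr_eq0 -lt0n fact_gt0.
  apply: (mulIf nzf); rewrite mulrAC mulfVK // -mulrA -tofracXn [_%:F * _]mulrC e2.
  by rewrite scaler_nat rmorphMn /= -mulr_natl; ring.
have hmin k : exists D, least_galochkin_denom A U k D /\ (D <= C ^ k.+1)%N.
  have [D [/andP[D0 DC] hD]] := hC k.
  have ex : exists E, `[< galochkin_denom A U k E >].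
    by exists D; apply/asboolP; apply: hg.
  case: (ex_minnP ex) => E /asboolP hE minE; exists E; split.
    by split=> // E' /asboolP /minE.
  by apply: leq_trans DC; apply: minE; apply/asboolP; apply: hg.
have /choice[D hD] := hmin.
by exists D; split=> [k|]; [case: (hD k)|exists C => k; case: (hD k)].
Qed.

Lemma G_operator_of_bounded (a : ratfun) T p :
  T != 0 -> a * T%:F = p%:F -> gal_bounded T p -> G_operator ('X - a%:P).
Proof.
move=> nzT e hT; split; first by rewrite polyXsubC_eq0.
rewrite lead_coefXsubC invr1 scale1r.
have galA s (A : 'M[ratfun]_s) : s = 1%N -> (forall i j, A i j = a) -> galochkin A.
  move=> es hA; subst s; apply: (galochkin_1 nzT e _ hT).
  by apply/matrixP => i j; rewrite hA !ord1 mxE mulr1n.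
apply: galA; first by rewrite size_XsubC.
have small (i : 'I_(size ('X - a%:P)).-1) : i = 0%N :> nat.
  by case: i => i /=; rewrite size_XsubC; case: i.
move=> i j; rewrite mxE !small size_XsubC /= coefB coefX coefC /=.
by rewrite sub0r opprK.
Qed.

(** * From one solution to the operator *)

Section SolutionToBound.
Variables (R : realType) (iota : {rmorphism algC -> R[i]}).

Lemma rational_seqP y : ~ irrational_seq y ->
  exists V P : {poly algC}, V != 0 /\ forall n, cauchy_coef V y n = P`_n.
Proof.
move=> nirr; have [V [nzV [n hn]]] : exists V : {poly algC}, V != 0 /\
    exists n, forall k, (n <= k)%N -> cauchy_coef V y k = 0.
  apply: contrapT => h; apply: nirr => V nzV n; apply: contrapT => h2.
  apply: h; exists V; split=> //; exists n => k lek.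
  by apply/eqP; apply: contrapT => /negP nz; apply: h2; exists k.
exists V, (\poly_(k < n) cauchy_coef V y k); split=> // k.
by rewrite coef_poly; case: ltnP => // /hn.
Qed.

(** If y = P/Q, then p/(X S) is the logarithmic derivative of P/Q. *)
Lemma rational_solution (S p : {poly algC}) (y : nat -> algC) :
  euler_eq S p 0 y -> ~ irrational_seq y -> (exists n, y n != 0) ->
  gal_bounded ('X * S) p.
Proof.
move=> he nirr exy.
have [Q [P [nzQ Pk]]] := rational_seqP nirr.
have nzP : P != 0.
  have [q [Q1 [DQ nzQ1 _]]] := lowest_coef nzQ.
  case: (ex_minnP exy) => v nzv minv.
  have y0 i : (i < v)%N -> y i = 0.
    by move=> lti; apply/eqP; apply: contraTT lti => /minv; rewrite -leqNgt.
  apply/eqP => P0; have /esym := Pk (q + v)%N; rewrite P0 coef0 /cauchy_coef.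
  have ltq : (q < (q + v).+1)%N by rewrite ltnS leq_addr.
  rewrite (bigD1 (Ordinal ltq)) //= addKn big1 ?addr0.
    move/esym/eqP; rewrite mulf_eq0 (negbTE nzv) orbF.
    by rewrite DQ coefMXn ltnn subnn (negbTE nzQ1).
  move=> i ni; have [lti|lei] := ltnP i q.
    by rewrite DQ coefMXn lti mul0r.
  rewrite y0 ?mulr0 //; have : (i : nat) != q by apply: contraNneq ni => e; apply/eqP/val_inj.
  by move=> ne; have := ltn_ord i; lia.
apply: (@gal_bounded_rational P Q) => //.
apply/eqP; rewrite -subr_eq0; apply/eqP/polyP => k; rewrite coef0.
pose Y : {poly algC} := \poly_(i < k.+1) y i.
suff /dvdXnP h : 'X^(k.+1) %| 'X * S * (P^`() * Q - P * Q^`()) - p * (P * Q) by apply: h.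
have /dvdpP[E DE] := euler_trunc k.+1 he; rewrite -/Y subr0 in DE.
have /dvdpP[u Du] : 'X^(k.+1) %| Q * Y - P.
  by apply/dvdXnP => i lti; rewrite coefB coef_mul_trunc // Pk subrr.
have DP : P = Q * Y - u * 'X^(k.+1) by rewrite -Du opprB addrC subrK.
have h2 : 'X^(k.+1) %| 'X * S * (u * 'X^(k.+1))^`() - 0 * (u * 'X^(k.+1)).
  by apply: dvdXn_flow; [rewrite dvdp_mulr | rewrite dvdp_mull].
rewrite mul0r subr0 in h2; have /dvdpP[v Dv] := h2.
apply/dvdpP; exists (Q ^+ 2 * E - v * Q + 'X * S * u * Q^`() + p * u * Q).
transitivity (Q ^+ 2 * (E * 'X^(k.+1)) - (v * 'X^(k.+1)) * Q
    + ('X * S * Q^`() + p * Q) * (u * 'X^(k.+1))); last by ring.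
rewrite -DE -Dv DP derivB (derivM Q Y); move: (u * 'X^(k.+1)) => U; ring.
Qed.

(** The series y is the regular factor of a solution z^al y of the equation
    with a = p/T, up to the twist by z^al, which is bounded by
    [gal_bounded_power]. *)
Lemma bounded_of_solution (T p e : {poly algC}) (al : rat) (y : nat -> algC) :
  T != 0 -> euler_eq T ('X * p - (ratr al)%:P * T) e y -> gevrey_seq iota y ->
  (irrational_seq y \/ (e = 0 /\ exists n, y n != 0)) ->
  gal_bounded ('X * T) ('X * p).
Proof.
move=> nzT he gy h.
suff h1 : gal_bounded ('X * T) ('X * p - (ratr al)%:P * T).
  by have := gal_boundedD h1 (gal_bounded_power al T); rewrite subrK.
have [irr|nirr] := pselect (irrational_seq y); first exact: chudnovsky gy irr.
case: h => // -[e0 exy]; rewrite e0 in he.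
exact: rational_solution he nirr exy.
Qed.

End SolutionToBound.

(** * Uniqueness of real exponential expansions *)

Section ExponentialPolynomials.
Variable R : realType.
Implicit Types (g h : R -> R) (P : {poly R}).

Definition negligible_at_infinity g : Prop :=
  forall e : R, 0 < e -> exists X : R, forall x, X <= x -> `|g x| <= e.
Local Notation negl := negligible_at_infinity.

Lemma neglD g h : negl g -> negl h -> negl (fun x => g x + h x).
Proof.
move=> hg hh e e0; have e20 : 0 < e / 2 by rewrite divr_gt0.
have [X hX] := hg _ e20; have [Y hY] := hh _ e20.
exists (Num.max X Y) => x; rewrite ge_max => /andP[xX xY].
by apply: le_trans (ler_normD _ _) _; have := hX x xX; have := hY x xY; lra.
Qed.

Lemma negl0 : negl (fun=> 0).
Proof. by move=> e e0; exists 0 => x _; rewrite normr0 ltW. Qed.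

Lemma negl_ext g h : g =1 h -> negl g -> negl h.
Proof. by move=> e hg d d0; have [X hX] := hg d d0; exists X => x /hX; rewrite e. Qed.

Lemma neglZ c g : negl g -> negl (fun x => c * g x).
Proof.
move=> hg e e0; have c0 : 0 < `|c| + 1 by rewrite ltr_wpDl.
have [X hX] := hg (e / (`|c| + 1)) (divr_gt0 e0 c0); exists X => x /hX h.
rewrite normrM; apply: (@le_trans _ _ ((`|c| + 1) * (e / (`|c| + 1)))).
  by rewrite ler_pM // lerDl.
by rewrite mulrC divfK // gt_eqF.
Qed.

Lemma negl_sum (I : Type) (r : seq I) (Q : pred I) (F : I -> R -> R) :
  (forall i, Q i -> negl (F i)) -> negl (fun x => \sum_(i <- r | Q i) F i x).
Proof.
move=> hF; elim: r => [|i r IH].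
  by apply: negl_ext negl0 => x; rewrite big_nil.
case E : (Q i).
  by apply: negl_ext (neglD (hF i E) IH) => x; rewrite big_cons E.
by apply: negl_ext IH => x; rewrite big_cons E.
Qed.

Lemma negl_expXn (d : R) n : 0 < d -> negl (fun x => expR (- (d * x)) * x ^+ n).
Proof.
move=> d0 e e0; pose c := n.+1`!%:R / d ^+ n.+1.
have c0 : 0 < c by rewrite divr_gt0 ?exprn_gt0 // ltr0n fact_gt0.
exists (c / e) => x hx; have x0 : 0 < x by apply: lt_le_trans hx; rewrite divr_gt0.
have dx0 : 0 <= d * x by rewrite ltW // mulr_gt0.
have h : (d * x) ^+ n.+1 / n.+1`!%:R <= expR (d * x).
  by apply: le_trans (expR_ge1Dxn n dx0); rewrite lerDr.
have f0 : 0 < n.+1`!%:R :> R by rewrite ltr0n fact_gt0.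
rewrite ger0_norm; last by rewrite mulr_ge0 ?expR_ge0 // exprn_ge0 // ltW.
rewrite expRN mulrC ler_pdivrMr ?expR_gt0 //.
apply: le_trans (_ : e * ((d * x) ^+ n.+1 / n.+1`!%:R) <= _); last by rewrite ler_pM2l.
have -> : e * ((d * x) ^+ n.+1 / n.+1`!%:R) = x ^+ n * (x * e / c).
  rewrite /c exprMn (exprS x); move: (d ^+ n.+1) (exprn_gt0 n.+1 d0) => D D0.
  by field; rewrite !gt_eqF.
rewrite ler_peMr ?exprn_ge0 ?(ltW x0) //.
by rewrite ler_pdivlMr // mul1r -ler_pdivrMr.
Qed.

Lemma negl_exp_poly (d : R) P : 0 < d -> negl (fun x => expR (- (d * x)) * P.[x]).
Proof.
move=> d0.
have : negl (fun x => \sum_(i < size P) P`_i * (expR (- (d * x)) * x ^+ i)).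
  by apply: negl_sum => i _; apply: neglZ; apply: negl_expXn.
apply: negl_ext => x; rewrite horner_coef mulr_sumr; apply: eq_bigr => i _; ring.
Qed.

Lemma poly_bounded_below P : P != 0 ->
  exists2 c : R, 0 < c & exists X : R, forall x, X <= x -> c <= `|P.[x]|.
Proof.
move=> nzP; exists `|lead_coef P|; first by rewrite normr_gt0 lead_coef_eq0.
wlog lc0 : P nzP / 0 < lead_coef P.
  move=> h; have [lt0|gt0|e] := ltgtP (lead_coef P) 0.
  - have [||X hX] := h (- P); rewrite ?oppr_eq0 ?lead_coefN ?oppr_gt0 //.
    by exists X => x /hX; rewrite hornerN lead_coefN !normrN.
  - exact: h.
  - by move/eqP: e; rewrite lead_coef_eq0 (negbTE nzP).
have [X hX] := polyrcf.poly_pinfty_gt_lc lc0; exists X => x lex.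
rewrite gtr0_norm //; apply: le_trans (ler_norm _); exact: hX.
Qed.

Definition exp_poly (M : seq (rat * {poly R})) (x : R) : R :=
  \sum_(t <- M) expR (- (ratr t.1 * x)) * t.2.[x].

Lemma min_seq_rat (s : seq rat) b : b \in s ->
  exists2 m, m \in s & forall x, x \in s -> m <= x.
Proof.
elim: s b => [//|a s IH] b _; case: s IH => [_|c s IH].
  by exists a; rewrite ?mem_head // => x; rewrite inE => /eqP->.
have [m ms hm] := IH c (mem_head _ _).
have [le|lt] := leP a m.
  exists a; first exact: mem_head.
  by move=> x; rewrite inE => /predU1P[->//|/hm]; apply: le_trans.
exists m; first by rewrite inE ms orbT.
by move=> x; rewrite inE => /predU1P[->|/hm//]; apply: ltW.
Qed.

Lemma sum_by_key (T U : eqType) (V : nmodType) (k : T -> U) (M : seq T) (F : T -> V) :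
  \sum_(t <- M) F t = \sum_(u <- undup (map k M)) \sum_(t <- M | k t == u) F t.
Proof.
rewrite (exchange_big_dep predT) //= big_seq [RHS]big_seq.
apply: eq_bigr => t tM; rewrite big_mkcond /=.
have tU : k t \in undup (map k M) by rewrite mem_undup map_f.
rewrite (bigD1_seq (k t)) ?undup_uniq //= eqxx big1 ?addr0 // => u.
by rewrite eq_sym => /negbTE->.
Qed.

Lemma exp_poly_group (M : seq (rat * {poly R})) x :
  exp_poly M x = \sum_(b <- undup (map fst M))
     expR (- (ratr b * x)) * (\sum_(t <- M | t.1 == b) t.2).[x].
Proof.
rewrite /exp_poly (sum_by_key fst); apply: eq_bigr => b _.
by rewrite horner_sum mulr_sumr; apply: eq_bigr => t /eqP->.
Qed.

(** Let b_0 be the least exponent with a nonzero polynomial P. By the mean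
    value theorem on [x, x + 1] the derivative of f takes somewhere a value of
    size at most a multiple of exp(- B x), although it is approximately exp(-
    b_0 xi) P(xi) there and P is bounded below at infinity. *)
Lemma exp_poly_derivative_unique (M : seq (rat * {poly R})) (B : nat) (f df : R -> R) (K x0 : R) :
  (forall x, x0 < x -> is_derive x 1 f (df x)) ->
  (forall x, x0 < x -> `|f x| <= K * expR (- (B%:R * x))) ->
  (forall x, x0 < x -> `|df x - exp_poly M x| <= K * expR (- (B%:R * x))) ->
  forall b : rat, b < B%:R -> \sum_(t <- M | t.1 == b) t.2 = 0.
Proof.
move=> hf hfB hdf b ltb; pose P b := \sum_(t <- M | t.1 == b) t.2.
rewrite -/(P b); apply: contrapT => /eqP nzb.
pose U := undup (map fst M).
pose s := [seq b <- U | (b < B%:R) && (P b != 0)].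
have PU b1 : P b1 != 0 -> b1 \in U.
  rewrite mem_undup; apply: contraNT => nb.
  rewrite /P big_seq_cond big1 // => t /andP[tM /eqP e].
  by case/negP: nb; rewrite -e map_f.
have bs : b \in s by rewrite mem_filter ltb nzb PU.
have [b0 b0s minb] := min_seq_rat bs.
move: (b0s); rewrite mem_filter => /andP[/andP[ltb0 nzb0] b0U].
have K0 : 0 <= K.
  have x1 : x0 < x0 + 1 by rewrite ltrDl.
  by have := le_trans (normr_ge0 _) (hfB _ x1); rewrite pmulr_lge0 ?expR_gt0.
have hsmall : negl (fun x => \sum_(b <- U | b != b0) expR (- (ratr (b - b0) * x)) * (P b).[x]).
  apply: negl_sum => b1 nb1; have [lt|ge] := ltP b0 b1.
    by apply: negl_exp_poly; rewrite ltr0q subr_gt0.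
  apply: negl_ext negl0 => x; case: (boolP ((b1 \in s))) => [/minb|].
    by move=> le; case/eqP: nb1; apply/le_anti; rewrite ge le.
  rewrite mem_filter (le_lt_trans ge ltb0) /=.
  have [->|nz] := eqVneq (P b1) 0; first by rewrite horner0 mulr0.
  by rewrite PU.
have [c c0 [X1 hX1]] := poly_bounded_below nzb0.
have c30 : 0 < c / 3 by rewrite divr_gt0.
have [X2 hX2] := hsmall _ c30.
have hd : 0 < B%:R - ratr b0 :> R.
  by rewrite subr_gt0 -(ratr_nat R) ltr_rat.
have : negl (fun x => K * (2 * expR B%:R + 1) * (expR (- ((B%:R - ratr b0) * x)) * 1%:P.[x])).
  by apply: neglZ; apply: negl_exp_poly.
move=> /(_ _ c30)[X3 hX3].
pose x := Num.max (Num.max X1 X2) (Num.max X3 (x0 + 1)).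
have [xX1 xX2 xX3 xx0] : [/\ X1 <= x, X2 <= x, X3 <= x & x0 < x].
  rewrite /x !le_max !lexx !orbT; split=> //.
  by apply: (@lt_le_trans _ _ (x0 + 1)); rewrite ?ltrDl // !le_max lexx !orbT.
have [xi xiI Dxi] : exists2 c, c \in `]x, (x + 1)[%R & f (x + 1) - f x = df c * (x + 1 - x).
  apply: MVT; first by rewrite ltrDl.
    by move=> z; rewrite in_itv /= => /andP[lt _]; apply: hf; apply: lt_trans lt.
  apply: derivable_within_continuous => z; rewrite in_itv /= => /andP[le _].
  have dz := hf z (lt_le_trans xx0 le); exact: ex_derive.
move: xiI; rewrite in_itv /= => /andP[ltxi ltxi1].
have lexi := ltW ltxi.
have := hX1 xi (le_trans xX1 lexi).
have := hX2 xi (le_trans xX2 lexi).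
have := hX3 xi (le_trans xX3 lexi).
have := hdf xi (lt_trans xx0 ltxi).
rewrite exp_poly_group -/U (bigD1_seq b0) ?undup_uniq //= -/(P b0).
move: Dxi; rewrite addrAC subrr add0r mulr1 => Dxi.
set W := \sum_(b1 <- U | b1 != b0) _; set V := \sum_(b1 <- U | b1 != b0) _.
have WV : W = expR (- (ratr b0 * xi)) * V.
  rewrite /W /V mulr_sumr; apply: eq_bigr => b1 _; rewrite mulrA -expRD; congr (expR _ * _).
  by rewrite rmorphB; ring.
move: (expR_gt0 (ratr b0 * xi)); set E := expR (ratr b0 * xi) => E0.
have EN : expR (- (ratr b0 * xi)) = E^-1 by rewrite expRN.
have EB : expR (- ((B%:R - ratr b0) * xi)) = expR (- (B%:R * xi)) * E.
  by rewrite -expRD; congr expR; ring.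
have fx : `|f x| <= K * (expR B%:R * expR (- (B%:R * xi))).
  apply: le_trans (hfB x xx0) _; rewrite ler_wpM2l // -expRD ler_expR.
  have : B%:R * xi <= B%:R * (x + 1) by rewrite ler_wpM2l // ltW.
  by rewrite mulrDr mulr1; lra.
have fx1 : `|f (x + 1)| <= K * (expR B%:R * expR (- (B%:R * xi))).
  have lt1 : x0 < x + 1 by apply: lt_trans xx0 _; rewrite ltrDl.
  apply: le_trans (hfB _ lt1) _; rewrite ler_wpM2l // -expRD ler_expR.
  have : B%:R * xi <= B%:R * (x + 1) by rewrite ler_wpM2l // ltW.
  have : 0 <= B%:R :> R by [].
  by lra.
rewrite WV EN EB hornerC mulr1.
move: (expR_gt0 (- (B%:R * xi))) fx fx1 Dxi (expR_gt0 (B%:R : R)).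
move: (expR (- (B%:R * xi))) (expR B%:R) (P b0).[xi] (df xi) (f x) (f (x + 1)) => eB EE p d u v.
move=> eB0 hu hv Duv EE0 h1 h2 h3 h4.
have hd' : `|d| <= 2 * K * (EE * eB).
  by rewrite -Duv; apply: le_trans (ler_normB _ _) _; lra.
have h1' : `|E^-1 * (p + V)| <= K * eB + 2 * K * (EE * eB).
  have -> : E^-1 * (p + V) = d - (d - (E^-1 * p + E^-1 * V)) by ring.
  by apply: le_trans (ler_normB _ _) _; lra.
have h5 : `|p + V| <= K * (2 * EE + 1) * (eB * E).
  move: h1'; rewrite normrM normfV (gtr0_norm E0) mulrC ler_pdivrMr //.
  by move/le_trans; apply; rewrite le_eqVlt; apply/orP; left; apply/eqP; ring.
have h6 : K * (2 * EE + 1) * (eB * E) <= c / 3 by apply: le_trans (ler_norm _) h2.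
have h7 : `|p| <= `|p + V| + `|V|.
  by have := ler_normB (p + V) V; rewrite addrK.
have h8 : c <= c / 3 + c / 3.
  exact: le_trans h4 (le_trans h7 (lerD (le_trans h5 h6) h3)).
by move: c0 h8; clear; lra.
Qed.

End ExponentialPolynomials.

(** * Complex exponential monomials *)

Section ComplexExponential.
Variable R : realType.
Local Notation C := R[i].
Implicit Types z : R[i].

Lemma cexpD (z1 z2 : C) : cexp (z1 + z2 : C) = cexp z1 * cexp z2 :> C.
Proof.
case: z1 => a1 b1; case: z2 => a2 b2; rewrite /cexp /= expRD cosD sinD.
apply/eqP; rewrite eq_complex /=; apply/andP; split; apply/eqP; ring.
Qed.

Lemma cexp0 : cexp (0 : C) = 1 :> C.
Proof.
rewrite /cexp /= expR0 cos0 sin0.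
by apply/eqP; rewrite eq_complex /=; apply/andP; split; apply/eqP; ring.
Qed.

Lemma cexp_neq0 z : cexp z != 0 :> C.
Proof.
have : cexp z * cexp (- z : C) = 1 :> C by rewrite -cexpD subrr cexp0.
by move=> h; apply/eqP => e; move/eqP: h; rewrite e mul0r eq_sym oner_eq0.
Qed.

Lemma cexp_nat n z : cexp (n%:R * z : C) = (cexp z : C) ^+ n :> C.
Proof.
elim: n => [|n IH]; first by rewrite mul0r cexp0 expr0.
by rewrite -[n.+1]addn1 natrD mulrDl mul1r cexpD IH addn1 exprSr.
Qed.

Lemma cexp_real (x : R) : cexp (x%:C%C : C) = (expR x)%:C%C :> C.
Proof.
rewrite /cexp /= cos0 sin0; apply/eqP; rewrite eq_complex /=.
by apply/andP; split; apply/eqP; ring.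
Qed.

Lemma norm_cexp z : `|cexp z : C| = (expR (complex.Re z))%:C%C.
Proof.
case: z => a b; rewrite normc_def /cexp /=; congr (_%:C%C).
rewrite !mul0r subr0 addr0 !exprMn -mulrDr cos2Dsin2 mulr1 sqrtr_sqr.
by rewrite ger0_norm // expR_ge0.
Qed.

Lemma ratrC (b : rat) : ratr b = (ratr b : R)%:C%C :> C.
Proof. by rewrite (fmorph_rat (real_complex R)). Qed.

End ComplexExponential.

Section RealPart.
Variables (R : realType) (rho : R[i] -> R).
Hypothesis rhoD : forall z1 z2, rho (z1 + z2) = rho z1 + rho z2.
Hypothesis rhoZ : forall x z, rho (x%:C%C * z) = x * rho z.

Lemma rho0 : rho 0 = 0.
Proof. by have := rhoZ 0 0; rewrite mulr0 mul0r. Qed.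

Lemma rhoN z : rho (- z) = - rho z.
Proof. by have := rhoZ (-1) z; rewrite rmorphN rmorph1 !mulN1r. Qed.

Lemma rhoMn z n : rho (z *+ n) = rho z *+ n.
Proof. by elim: n => [|n IH]; rewrite ?mulr0n ?rho0 // !mulrS rhoD IH. Qed.

Lemma rho_sum (I : Type) (r : seq I) (P : pred I) (F : I -> R[i]) :
  rho (\sum_(i <- r | P i) F i) = \sum_(i <- r | P i) rho (F i).
Proof. by apply: (big_morph rho rhoD rho0). Qed.

(** Coefficientwise real or imaginary part. *)
Definition rho_poly (q : {poly R[i]}) : {poly R} := \poly_(i < size q) rho q`_i.

Lemma coef_rho_poly q i : (rho_poly q)`_i = rho q`_i.
Proof.
by rewrite coef_poly; case: ltnP => // le; rewrite nth_default // rho0.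
Qed.

Lemma horner_rho_poly q x : (rho_poly q).[x] = rho q.[x%:C%C].
Proof.
rewrite /rho_poly horner_poly horner_coef rho_sum; apply: eq_bigr => i _.
by rewrite -rmorphXn mulrC [in RHS]mulrC rhoZ.
Qed.

End RealPart.

Section Transfer.
Variable R : realType.
Local Notation C := R[i].

(** (c, b, j) stands for c exp(b l) l^j, where l = L - x. *)
Definition mono := (C * rat * nat)%type.

Definition mono_val (L : C) (t : mono) (x : R) : C :=
  t.1.1 * cexp (ratr t.1.2 * (L - x%:C%C) : C) * (L - x%:C%C) ^+ t.2.

Definition mono_coef (M : seq mono) (b : rat) (j : nat) : C :=
  \sum_(t <- M | (t.1.2 == b) && (t.2 == j)) t.1.1.

Definition mono_poly (L : C) (t : mono) : {poly C} :=
  (t.1.1 * cexp (ratr t.1.2 * L : C)) *: (L%:P - 'X) ^+ t.2.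

Lemma mono_valE L t x :
  mono_val L t x = (expR (- (ratr t.1.2 * x)))%:C%C * (mono_poly L t).[x%:C%C].
Proof.
rewrite /mono_val.
have -> : cexp (ratr t.1.2 * (L - x%:C%C) : C) =
    cexp (ratr t.1.2 * L : C) * cexp (- (ratr t.1.2 * x%:C%C) : C) :> C.
  by rewrite -cexpD mulrBr.
have -> : cexp (- (ratr t.1.2 * x%:C%C) : C) = (expR (- (ratr t.1.2 * x)))%:C%C :> C.
  by rewrite ratrC -rmorphM -rmorphN cexp_real.
rewrite /mono_poly hornerZ horner_exp hornerD hornerN hornerC hornerX; ring.
Qed.

Lemma is_derive_exp_poly (M : seq (rat * {poly R})) (x : R) :
  is_derive x 1 (exp_poly M)
    (exp_poly [seq (t.1, t.2^`() - ratr t.1 *: t.2) | t <- M] x).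
Proof.
elim: M => [|[b p] M IH].
  have -> : exp_poly [::] = cst (0 : R) by apply/funext => y; rewrite /exp_poly big_nil.
  by rewrite /=; apply: is_derive_cst.
have -> : exp_poly ((b, p) :: M) =
    (fun y => expR (- (ratr b * y)) * p.[y]) + exp_poly M.
  by apply/funext => y; rewrite /exp_poly big_cons.
rewrite [X in is_derive _ _ _ X]/exp_poly /= big_cons /=.
apply: is_deriveD => //.
have h1 : is_derive x 1 (fun y : R => - (ratr b * y)) (- ratr b).
  have -> : (fun y : R => - (ratr b * y)) = (- ratr b) \*: id.
    by apply/funext => y /=; rewrite scaleNr.
  by apply: is_derive_eq; rewrite scaler1.
have h2 : is_derive x 1 (expR \o (fun y : R => - (ratr b * y)))
   (expR (- (ratr b * x)) * - ratr b).
  exact: is_derive1_comp.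
have h3 := is_derive_poly p x.
have -> : (fun y => expR (- (ratr b * y)) * p.[y]) =
    (expR \o (fun y : R => - (ratr b * y))) * horner p by [].
apply: is_derive_eq; rewrite /= !hornerE; rewrite /GRing.scale /=; ring.
Qed.

(** The monomials of f, differentiated, and those of its derivative form one
    exponential polynomial that approximates zero; it is compared for the real
    and the imaginary parts separately, where the mean value theorem is
    available. *)
Lemma transfer_rho (rho : C -> R) L (M M' : seq mono) (B : nat) (f df : R -> C) (K x0 : R) :
  (forall z1 z2, rho (z1 + z2) = rho z1 + rho z2) ->
  (forall x z, rho (x%:C%C * z) = x * rho z) ->
  (forall z, `|rho z|%:C%C <= `|z|) ->
  (forall x, x0 < x -> is_derive x 1 (fun y => rho (f y)) (rho (df x))) ->
  (forall x, x0 < x -> `|f x - \sum_(t <- M) mono_val L t x| <= (K * expR (- (B%:R * x)))%:C%C) ->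
  (forall x, x0 < x -> `|df x + \sum_(t <- M') mono_val L t x| <= (K * expR (- (B%:R * x)))%:C%C) ->
  forall b : rat, b < B%:R -> forall i,
    rho (\sum_(t <- M' | t.1.2 == b) mono_poly L t +
     \sum_(t <- M | t.1.2 == b) ((mono_poly L t)^`() - (ratr b : C) *: mono_poly L t))`_i = 0.
Proof.
move=> rhoD rhoZ rhole hf hM hM' b ltb i.
pose rp := rho_poly rho.
pose N := [seq (t.1.2, rp (mono_poly L t)) | t <- M].
pose N' := [seq (t.1.2, rp (mono_poly L t)) | t <- M'].
have eN (P : seq mono) x : rho (\sum_(t <- P) mono_val L t x) =
    exp_poly [seq (t.1.2, rp (mono_poly L t)) | t <- P] x.
  rewrite /exp_poly big_map rho_sum //; apply: eq_bigr => t _ /=.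
  by rewrite mono_valE rhoZ horner_rho_poly.
pose dN := [seq (t.1, t.2^`() - ratr t.1 *: t.2) | t <- N].
pose Z := [seq (t.1, - t.2) | t <- N' ++ dN].
have eZ x : exp_poly Z x = - (exp_poly N' x + exp_poly dN x).
  rewrite /exp_poly /Z map_cat big_cat !big_map opprD -!sumrN.
  by congr (_ + _); apply: eq_bigr => t _; rewrite hornerN mulrN.
have mM P Q z y : z = P - Q -> `|z| <= y%:C%C -> `|rho P - rho Q| <= y.
  move=> -> h; rewrite -lecR; apply: le_trans h.
  by rewrite -rhoN // -rhoD; apply: rhole.
have hZ : forall b : rat, b < B%:R -> \sum_(t <- Z | t.1 == b) t.2 = 0.
  apply: (@exp_poly_derivative_unique R Z B (fun x => rho (f x) - exp_poly N x)
     (fun x => rho (df x) - exp_poly dN x) K x0).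
  - move=> x ltx; have h1 := hf x ltx; have h2 := is_derive_exp_poly N x.
    exact: is_deriveB.
  - by move=> x ltx; rewrite -eN; apply: mM (hM x ltx).
  - move=> x ltx; rewrite eZ opprK addrCA addrC subrK.
    have := hM' x ltx; rewrite -[X in _ + X]opprK => h.
    have := mM _ _ _ _ erefl h; rewrite (rhoN rhoZ) opprK eN.
    by rewrite addrC.
have := congr1 (fun q : {poly R} => - q`_i) (hZ b ltb).
rewrite coef0 oppr0 /Z map_cat big_cat !big_map /= !sumrN coefD !coefN.
rewrite -opprD opprK => <-.
rewrite /dN coefD rhoD; congr (_ + _).
  rewrite coef_sum rho_sum // coef_sum /N' ?big_map /=; apply: eq_bigr => t _.
  by rewrite coef_rho_poly.
rewrite coef_sum rho_sum // coef_sum /N ?big_map /=; apply: eq_bigr => t /eqP ->.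
move: (mono_poly L t) => q; rewrite !coefB !coef_deriv !coefZ !coef_rho_poly // rhoD rhoN // rhoMn //.
by rewrite ratrC rhoZ.
Qed.

(** After the substitution X := L - X the polynomials multiplying exp(- b x)
    become the generating polynomials in l, whose coefficients can be
    compared. *)
Lemma mono_coef_transfer L (M M' : seq mono) (B : nat) (f df : R -> C) (K x0 : R) :
  (forall x, x0 < x -> is_derive x 1 (fun y => complex.Re (f y)) (complex.Re (df x))) ->
  (forall x, x0 < x -> is_derive x 1 (fun y => complex.Im (f y)) (complex.Im (df x))) ->
  (forall x, x0 < x -> `|f x - \sum_(t <- M) mono_val L t x| <= (K * expR (- (B%:R * x)))%:C%C) ->
  (forall x, x0 < x -> `|df x + \sum_(t <- M') mono_val L t x| <= (K * expR (- (B%:R * x)))%:C%C) ->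
  forall b : rat, b < B%:R -> forall j,
    mono_coef M' b j = ratr b * mono_coef M b j + j.+1%:R * mono_coef M b j.+1.
Proof.
move=> hre him hM hM' b ltb j.
pose W := \sum_(t <- M' | t.1.2 == b) mono_poly L t +
     \sum_(t <- M | t.1.2 == b) ((mono_poly L t)^`() - (ratr b : C) *: mono_poly L t).
have W0 : W = 0.
  apply/polyP => i; rewrite coef0; apply/eqP; rewrite eq_complex /=.
  rewrite (@transfer_rho (fun z : C => complex.Re z) L M M' B f df K x0) //.
  - rewrite (@transfer_rho (fun z : C => complex.Im z) L M M' B f df K x0) ?eqxx //.
    + by case=> ? ? [? ?].
    + by move=> x [? ?] /=; ring.
    + exact: normc_ge_Im.
  - by case=> ? ? [? ?].
  - by move=> x [? ?] /=; ring.
  - exact: normc_ge_Re.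
pose e := cexp (ratr b * L : C) : C.
have nze : e != 0 by apply: cexp_neq0.
pose U : {poly C} := \sum_(t <- M' | t.1.2 == b) t.1.1 *: 'X^(t.2) -
  \sum_(t <- M | t.1.2 == b) (t.1.1 *: ((ratr b : C) *: 'X^(t.2) + 'X^(t.2.-1) *+ t.2)).
have WU : W \Po (L%:P - 'X) = e *: U.
  rewrite /W raddfD /= [X in X + _]raddf_sum [X in _ + X]raddf_sum /=.
  rewrite /U scalerBr !scaler_sumr -sumrN.
  have compL n : ((L%:P - 'X) ^+ n) \Po (L%:P - 'X) = 'X^n :> {poly C}.
    rewrite rmorphXn /= rmorphB /= comp_polyC comp_polyX; congr (_ ^+ _).
    by rewrite opprB addrC subrK.
  congr (_ + _); apply: eq_bigr => t /eqP eb.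
    by rewrite /mono_poly eb linearZ /= compL scalerA mulrC.
  rewrite /mono_poly eb derivZ deriv_exp derivB derivC derivX sub0r.
  rewrite raddfB /= !linearZ /= compL -/e raddfMn /= mulN1r raddfN /= compL.
  move: (ratr b : C) => rb; apply/polyP => k.
  by rewrite !(coefN, coefD, coefZ, coefMn); ring.
have U0 : U = 0.
  apply: (scalerI nze); rewrite scaler0 -WU W0; exact: comp_poly0.
have := congr1 (fun q : {poly C} => q`_j) U0.
rewrite coef0 /U coefB !coef_sum => /eqP; rewrite subr_eq0 => /eqP h.
transitivity (\sum_(t <- M' | t.1.2 == b) (t.1.1 *: 'X^(t.2))`_j).
  rewrite /mono_coef big_mkcondr; apply: eq_bigr => t _.
  by rewrite coefZ coefXn eq_sym; case: eqP; rewrite ?mulr1 ?mulr0.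
rewrite h; transitivity (\sum_(t <- M | t.1.2 == b)
   (ratr b * (if t.2 == j then t.1.1 else 0) + j.+1%:R * (if t.2 == j.+1 then t.1.1 else 0))).
  apply: eq_bigr => t _; rewrite coefZ coefD coefZ coefMn !coefXn [j == _]eq_sym.
  case: t => -[c b1] [|i] /=.
    by rewrite mulr0n; case: eqP; rewrite ?(mulr0,mulr1,addr0) // mulrC.
  rewrite eqSS [j == i]eq_sym; case: (i =P j) => [->|_].
    have -> : (j.+1 == j) = false by apply/negbTE; rewrite neq_ltn ltnSn orbT.
    by rewrite mulr0n !mulr0 !add0r mulrnAr mulr1 mulr_natl.
  by rewrite mulr0n mul0rn addr0 !mulr0 addr0; case: eqP => _; rewrite ?mulr0n ?mulr0 ?mulr1 // mulrC.
by rewrite big_split /= -!mulr_sumr /mono_coef !big_mkcondr.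
Qed.

End Transfer.

(** * Expansions with rational exponents and logarithms *)

Section LogSeries.
Variable R : realType.
Local Notation C := R[i].

(** lt_coef * z^lt_exp * log(z)^lt_log * \sum_n lt_ser n z^n *)
Record logterm := LogTerm {
  lt_coef : C; lt_exp : rat; lt_log : nat; lt_ser : nat -> C }.

(** Coefficient at a rational exponent, zero outside the natural numbers. *)
Definition coef_at (V : zmodType) (A : nat -> V) (g : rat) : V :=
  if g \is a Num.nat then A (Num.truncn g) else 0.

(** The coefficient of z^b log(z)^j in the formal sum of the terms. *)
Definition formal_coef (T : eqType) (tm : T -> logterm) (I : seq T) (b : rat) (j : nat) : C :=
  \sum_(s <- I | lt_log (tm s) == j)
    lt_coef (tm s) * coef_at (lt_ser (tm s)) (b - lt_exp (tm s)).

(** The number of natural numbers less than c. *)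
Definition ncut (c : rat) : nat := if 0 < c then `|Num.ceil c|%N else 0%N.

Lemma ncutP c n : (n < ncut c)%N = (n%:R < c).
Proof.
rewrite /ncut; case: ltP => [c0|c0]; last first.
  by rewrite ltn0; apply/esym/negbTE; rewrite -leNgt (le_trans c0).
have h : (`|Num.ceil c|%N)%:Z = Num.ceil c.
  by rewrite gez0_abs // ltW // ceil_gt0.
by rewrite -ltz_nat h ceil_gt_int.
Qed.

Definition cut_terms (T : eqType) (tm : T -> logterm) (I : seq T) (B : rat) : seq (mono R) :=
  [seq (lt_coef (tm s) * lt_ser (tm s) n, lt_exp (tm s) + n%:R, lt_log (tm s)) |
     s <- I, n <- iota 0 (ncut (B - lt_exp (tm s)))].

Lemma mono_coef_cut (T : eqType) (tm : T -> logterm) (I : seq T) (B b : rat) j : b < B ->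
  mono_coef (cut_terms tm I B) b j = formal_coef tm I b j.
Proof.
move=> ltbB; rewrite /mono_coef /cut_terms big_mkcond big_allpairs_dep /formal_coef [RHS]big_mkcond /=.
apply: eq_bigr => s _; rewrite -big_mkcond /=; case: (tm s) => c a l A /=.
case: (l =P j) => [_|_]; last by rewrite big_pred0 // => n; rewrite andbF.
rewrite /coef_at; case: ifP => [/natrP[k Dk]|nnat]; last first.
  rewrite mulr0 big_pred0 // => n; rewrite andbT; apply/negbTE; apply: contraFN nnat.
  by move=> /eqP <-; rewrite addrAC subrr add0r natr_nat.
have ltk : (k < ncut (B - a))%N by rewrite ncutP -Dk ltrD2r.
rewrite Dk natrK (eq_bigl (fun n => n == k)); last first.
  move=> n; rewrite andbT; rewrite -(inj_eq (addrI (- a))) addKr addrC Dk eqr_nat.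
  by [].
rewrite big_mkcond (bigD1_seq k) ?iota_uniq ?mem_iota //= eqxx big1 ?addr0 // => n.
by move/negbTE->.
Qed.

Definition term_val (L : C) (t : logterm) (g : R -> C) (x : R) : C :=
  lt_coef t * cexp (ratr (lt_exp t) * (L - x%:C%C) : C) * (L - x%:C%C) ^+ lt_log t * g x.

Lemma mono_val_sum L c a j (A : nat -> C) N x :
  \sum_(n < N) mono_val L (c * A n, a + n%:R, j) x =
  c * cexp (ratr a * (L - x%:C%C) : C) * (L - x%:C%C) ^+ j *
    \sum_(n < N) A n * (cexp (L - x%:C%C : C) : C) ^+ n.
Proof.
rewrite mulr_sumr; apply: eq_bigr => n _; rewrite /mono_val /=.
have -> : cexp (ratr (a + n%:R) * (L - x%:C%C) : C) =
   cexp (ratr a * (L - x%:C%C) : C) * (cexp (L - x%:C%C : C) : C) ^+ n :> C.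
  have -> : ratr (a + n%:R) = ratr a + n%:R :> C by rewrite rmorphD /= ratr_nat.
  by rewrite mulrDl (cexpD (ratr a * _)) cexp_nat.
by ring.
Qed.

Lemma cut_terms_val (T : eqType) (tm : T -> logterm) (I : seq T) (B : rat) L x :
  \sum_(t <- cut_terms tm I B) mono_val L t x =
  \sum_(s <- I) \sum_(n < ncut (B - lt_exp (tm s)))
    mono_val L (lt_coef (tm s) * lt_ser (tm s) n, lt_exp (tm s) + n%:R, lt_log (tm s)) x.
Proof.
rewrite /cut_terms big_allpairs_dep; apply: eq_bigr => s _.
by rewrite -(big_mkord xpredT (fun n => mono_val L (lt_coef (tm s) * lt_ser (tm s) n,
  lt_exp (tm s) + n%:R, lt_log (tm s)) x)) /index_iota subn0.
Qed.

Lemma normcR (z : C) : `|z| = (complex.Re `|z|)%:C%C.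
Proof. by rewrite normc_def. Qed.

Lemma Re_norm_ge0 (z : C) : 0 <= complex.Re `|z|.
Proof. by rewrite normc_def /= sqrtr_ge0. Qed.

(** The remainder bound of a convergent power series near 0, in the variable
    z = exp(L - x). *)
Definition approximable (L : C) (A : nat -> C) (g : R -> C) : Prop :=
  exists K X : R, forall x, X <= x -> forall m,
    `|g x - \sum_(n < m) A n * (cexp (L - x%:C%C : C) : C) ^+ n| <= (K * (K * expR (- x)) ^+ m)%:C%C.

(** Cutting at exponents below B + 1 leaves a remainder of order
    exp(- (B + 1) x) times a power of l; one factor exp(- x) absorbs this
    power. *)
Lemma approximable_tail L t g (B : nat) : approximable L (lt_ser t) g ->
  exists K X : R, forall x, X <= x ->
    `|term_val L t g x - \sum_(n < ncut (B.+1%:R - lt_exp t))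
        mono_val L (lt_coef t * lt_ser t n, lt_exp t + n%:R, lt_log t) x|
      <= (K * expR (- (B%:R * x)))%:C%C.
Proof.
case: t => c a j A /= [K [X hX]]; set N := ncut _.
pose P : {poly R} := ((complex.Re `|L|)%:P + 'X) ^+ j.
have [Y hY] := negl_exp_poly P (@ltr01 R) (@ltr01 R).
pose cc : R := complex.Re (`|c| * `|cexp (ratr a * L : C) : C|).
exists (cc * (K * K ^+ N)), (Num.max (Num.max X Y) 0) => x.
rewrite !ge_max => /andP[/andP[xX xY] x0].
have -> : term_val L (LogTerm c a j A) g x - \sum_(n < N)
     mono_val L (c * A n, a + n%:R, j) x =
   c * cexp (ratr a * (L - x%:C%C) : C) * (L - x%:C%C) ^+ j *
    (g x - \sum_(n < N) A n * (cexp (L - x%:C%C : C) : C) ^+ n).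
  by rewrite mono_val_sum [RHS]mulrBr.
pose E : C := cexp (ratr a * (L - x%:C%C) : C); pose E0 : C := cexp (ratr a * L : C).
rewrite -[cexp _]/E (normrM (c * E * _)) (normrM (c * E)) (normrM c).
have e1 : `|E| = `|E0| * (expR (- (ratr a * x)))%:C%C.
  rewrite /E /E0.
  have -> : cexp (ratr a * (L - x%:C%C) : C) =
      cexp (ratr a * L : C) * cexp (- (ratr a * x%:C%C) : C) :> C.
    by rewrite -cexpD mulrBr.
  rewrite (normrM (cexp _ : C)); congr (_ * _).
  by rewrite ratrC -rmorphM -rmorphN cexp_real ger0_norm // lecR expR_ge0.
have e2 : `|(L - x%:C%C) ^+ j : C| <= (expR x)%:C%C.
  rewrite normrX; apply: (@le_trans _ _ ((complex.Re `|L| + x)%:C%C ^+ j)).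
    apply: lerXn2r; rewrite ?nnegrE //.
      by rewrite lecR addr_ge0 // Re_norm_ge0.
    rewrite rmorphD /= -normcR; apply: le_trans (ler_normB _ _) _; rewrite lerD2l.
    by rewrite ger0_norm // lecR.
  rewrite -rmorphXn lecR; have := hY x xY.
  rewrite /P horner_exp hornerD hornerC hornerX mul1r normrM ger0_norm ?expR_ge0 //.
  rewrite expRN mulrC ler_pdivrMr ?expR_gt0 // mul1r; apply: le_trans; exact: ler_norm.
have h := hX x xX N.
have KN : 0 <= K * K ^+ N.
  have := le_trans (normr_ge0 _) h; rewrite lecR exprMn mulrA pmulr_lge0 //.
  by rewrite exprn_gt0 // expR_gt0.
have cc0 : 0 <= cc.
  by rewrite /cc -normrM Re_norm_ge0.
have Dcc : `|c| * `|E0| = cc%:C%C by rewrite /cc -normrM -normcR.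
rewrite e1 !mulrA Dcc.
apply: (@le_trans _ _ (cc%:C%C * (expR (- (ratr a * x)))%:C%C * (expR x)%:C%C *
    (K * (K * expR (- x)) ^+ N)%:C%C)).
  apply: ler_pM => //; first by rewrite !mulr_ge0 // lecR // expR_ge0.
  by rewrite ler_wpM2l // mulr_ge0 // lecR // expR_ge0.
rewrite -!rmorphM /= lecR.
have -> : cc * expR (- (ratr a * x)) * expR x * (K * (K * expR (- x)) ^+ N) =
    cc * (K * K ^+ N) * (expR (- (ratr a * x)) * expR x * expR (- x) ^+ N).
  rewrite exprMn; move: (expR (- (ratr a * x))) (expR x) (expR (- x) ^+ N) (K ^+ N).
  by move=> *; ring.
rewrite -(mulrA cc K); apply: ler_wpM2l; first by rewrite mulr_ge0.
rewrite -expRM_natl -!expRD ler_expR.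
have hN : B.+1%:R <= ratr a + N%:R :> R.
  have : ~~ (N < N)%N by rewrite ltnn.
  rewrite {2}/N ncutP -leNgt lerBlDr addrC => hq.
  by rewrite -(ratr_nat R N) -rmorphD -(ratr_nat R B.+1) ler_rat.
have : B.+1%:R * x <= (ratr a + N%:R) * x by rewrite ler_wpM2r.
rewrite -natr1; clear; move: (ratr a) (N%:R) (B%:R) => u v y.
by rewrite mulrDl mul1r mulrDl => h; lra.
Qed.

(** The operator d/dx is - z d/dz on the ray; hence the coefficient of
    z^b log(z)^j in z f' is b times the same coefficient of f, plus j + 1
    times that of z^b log(z)^(j+1). *)
Theorem formal_coef_derive (L : C) (T T' : eqType) (tm : T -> logterm) (tm' : T' -> logterm)
    (g : T -> R -> C) (g' : T' -> R -> C) (I : seq T) (I' : seq T') (f df : R -> C) (x0 : R) :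
  (forall s, s \in I -> approximable L (lt_ser (tm s)) (g s)) ->
  (forall s, s \in I' -> approximable L (lt_ser (tm' s)) (g' s)) ->
  (forall x, x0 < x -> is_derive x 1 (fun y => complex.Re (f y)) (complex.Re (df x))) ->
  (forall x, x0 < x -> is_derive x 1 (fun y => complex.Im (f y)) (complex.Im (df x))) ->
  (forall x, x0 < x -> f x = \sum_(s <- I) term_val L (tm s) (g s) x) ->
  (forall x, x0 < x -> df x = - \sum_(s <- I') term_val L (tm' s) (g' s) x) ->
  forall b j, formal_coef tm' I' b j =
    ratr b * formal_coef tm I b j + j.+1%:R * formal_coef tm I b j.+1.
Proof.
move=> hI hI' hre him hf hdf b j.
have sumtail (U : eqType) (um : U -> logterm) (h : U -> R -> C) (J : seq U) (B : nat) :
  (forall s, s \in J -> approximable L (lt_ser (um s)) (h s)) ->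
  exists K X : R, forall x, X <= x ->
    `|\sum_(s <- J) term_val L (um s) (h s) x -
      \sum_(t <- cut_terms um J B.+1%:R) mono_val L t x| <= (K * expR (- (B%:R * x)))%:C%C.
  elim: J => [|s J IH] hJ.
    exists 0, 0 => x _; rewrite /cut_terms /= !big_nil subrr normr0 mul0r lecR //.
  have [|K1 [X1 h1]] := IH; first by move=> s1 s1J; apply: hJ; rewrite inE s1J orbT.
  have [K2 [X2 h2]] := approximable_tail B (hJ s (mem_head _ _)).
  exists (K2 + K1), (Num.max X2 X1) => x; rewrite ge_max => /andP[x2 x1].
  rewrite cut_terms_val !big_cons -cut_terms_val.
  rewrite opprD addrACA; apply: le_trans (ler_normD _ _) _.
  by rewrite mulrDl rmorphD lerD // ?h2 ?h1.
pose B := Num.bound `|b|.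
have ltbB : b < B%:R by apply: le_lt_trans (ler_norm _) _; apply: archi_boundP.
have [K1 [X1 h1]] := sumtail _ _ _ _ B hI; have [K2 [X2 h2]] := sumtail _ _ _ _ B hI'.
have ltbB1 : b < B.+1%:R by apply: lt_trans ltbB _; rewrite ltr_nat.
rewrite -!(mono_coef_cut _ _ _ ltbB1).
apply: (@mono_coef_transfer R L _ _ B f df (Num.max K1 K2) (Num.max x0 (Num.max X1 X2))) => //.
- by move=> x; rewrite gt_max => /andP[h _]; apply: hre.
- by move=> x; rewrite gt_max => /andP[h _]; apply: him.
- move=> x; rewrite !gt_max => /and3P[h0 hx1 hx2]; rewrite hf //.
  apply: le_trans (h1 x (ltW hx1)) _; rewrite lecR ler_wpM2r ?expR_ge0 //.
  by rewrite le_max lexx.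
- move=> x; rewrite !gt_max => /and3P[h0 hx1 hx2]; rewrite hdf // addrC -opprB normrN.
  apply: le_trans (h2 x (ltW hx2)) _; rewrite lecR ler_wpM2r ?expR_ge0 //.
  by rewrite le_max lexx orbT.
Qed.

End LogSeries.

(** * Curves in the complex plane *)

Section Paths.
Variable R : realType.
Local Notation C := (R[i]^o).

Lemma cvg_complexP (T : Type) (F : set_system T) {FF : Filter F} (h : T -> C) (l : C) :
  h @ F --> l <-> forall e : R, 0 < e -> \forall t \near F, `|l - h t| < e%:C%C.
Proof.
split=> [/cvgrPdist_lt H e e0|H].
  by apply: (H e%:C%C); rewrite ltcR.
apply/cvgrPdist_lt => e; rewrite ltcE => /andP[/eqP i0 r0].
have -> : e = (complex.Re e)%:C%C by case: e i0 {r0} => a b /= ->.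
exact: H.
Qed.

Lemma near_cvg (T : Type) (V : nbhsType) (F : set_system T) {FF : Filter F} (h k : T -> V) (l : V) :
  (\forall t \near F, k t = h t) -> h @ F --> l -> k @ F --> l.
Proof.
move=> e; apply: cvg_trans; apply: near_eq_cvg.
by apply: filterS e => t ->.
Qed.

Lemma cvg_real_complex (T : Type) (F : set_system T) {FF : Filter F} (h : T -> R) (l : R) :
  h @ F --> l -> (fun t => (h t)%:C%C : C) @ F --> (l%:C%C : C).
Proof.
move/cvgrPdist_lt => H; apply/cvg_complexP => e e0.
near=> t.
rewrite -rmorphB normc_def /= expr0n addr0 sqrtr_sqr ltcR.
near: t; exact: H.
Unshelve. all: by end_near. Qed.

Lemma cvg_rho (rho : C -> R) (T : Type) (F : set_system T) {FF : Filter F} (h : T -> C) (l : C) :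
  (forall z1 z2, rho (z1 - z2) = rho z1 - rho z2) ->
  (forall z, `|rho z|%:C%C <= `|z|) ->
  h @ F --> l -> (fun t => rho (h t)) @ F --> rho l.
Proof.
move=> rhoB rhole /cvg_complexP H; apply/cvgrPdist_lt => e e0.
near=> t.
rewrite -rhoB -ltcR; apply: le_lt_trans (rhole _) _.
near: t; exact: H.
Unshelve. all: by end_near. Qed.

(** The curve is differentiated over R, whereas derivatives of functions with
    values in R[i] are taken over R[i]; hence the explicit difference
    quotients. *)
Definition path_derive (g : R -> C) (x : R) (v : C) : Prop :=
  (fun t : R => (t%:C%C)^-1 * (g (t + x) - g x) : C) @ 0^' --> v.

Lemma path_derive_cvg g x v : path_derive g x v -> (fun t => g (t + x) - g x) @ 0^' --> (0 : C).
Proof.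
move=> H.
have h0 : (fun t : R => t%:C%C : C) @ 0^' --> (0 : C).
  by apply: cvg_real_complex; apply: nbhs_dnbhs.
have h := cvgM h0 H; rewrite mul0r in h.
refine (near_cvg _ (h _)); near=> t => /=.
have nt : t != 0 by near: t; exact: nbhs_dnbhs_neq.
rewrite /= mulrA mulfV ?mul1r //.
by rewrite (eq_complex t%:C%C) /= eqxx andbT.
Unshelve. all: by end_near. Qed.

(** The difference quotient of f, extended by its limit at 0, is continuous
    there, so that the curve may return to the point g x. *)
Lemma path_derive_comp (f : C -> C) g x v d :
  path_derive g x v -> is_derive (g x) 1 f d -> path_derive (f \o g) x (d * v).
Proof.
move=> Hg Hf; set z := g x.
pose D (h : C) : C := if h == 0 then d else h^-1 * (f (h + z) - f z).
have cD : {for 0, continuous D}.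
  apply/continuous_withinNx; rewrite {2}/D eqxx.
  have : (fun h : C => h^-1 *: ((f \o shift z) (h *: (1 : C)) - f z) : C) @ 0^' --> (d : C).
    by case: Hf => hd <-; exact: hd.
  move=> hh; refine (near_cvg _ hh); near=> h.
  have nh : h != 0 by near: h; exact: nbhs_dnbhs_neq.
  by rewrite /D (negbTE nh) /= /GRing.scale /= mulr1.
have hk := path_derive_cvg Hg.
have hD : (fun t => D (g (t + x) - g x)) @ 0^' --> d.
  have : D z' @[z' --> (0 : C)] --> d by have := cD; rewrite /prop_for /continuous_at {2}/D eqxx.
  exact: cvg_comp.
have h := cvgM hD Hg.
refine (near_cvg _ (h _)); near=> t.
rewrite /D /=; case: eqP => [e|/eqP ne].
  have -> : g (t + x) = g x by apply/eqP; rewrite -subr_eq0 e.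
  by rewrite !subrr !mulr0.
rewrite subrK mulrCA; congr (_ * _); rewrite mulrAC mulVf // mul1r //.
Unshelve. all: by end_near. Qed.

Lemma path_derive_rho (rho : C -> R) g x v :
  (forall z1 z2, rho (z1 - z2) = rho z1 - rho z2) ->
  (forall (y : R) z, rho (y%:C%C * z) = y * rho z) ->
  (forall z, `|rho z|%:C%C <= `|z|) ->
  path_derive g x v -> is_derive x 1 (fun y => rho (g y)) (rho v).
Proof.
move=> rhoB rhoZ rhole Hg.
have h : (fun h : R => h^-1 *: (((fun y => rho (g y)) \o shift x) (h *: (1 : R)) - rho (g x)) : R) @ 0^' --> (rho v : R).
  have := cvg_rho rhoB rhole Hg; move=> hh; refine (near_cvg _ (hh _)); near=> t.
  by rewrite /= -fmorphV rhoZ rhoB /GRing.scale /= mulr1.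
apply: DeriveDef; first by apply/cvg_ex; exists (rho v).
by apply: cvg_lim.
Unshelve. all: by end_near. Qed.

Lemma path_derive_Re g x v : path_derive g x v ->
  is_derive x 1 (fun y => complex.Re (g y)) (complex.Re v).
Proof.
apply: (@path_derive_rho (fun z : C => complex.Re z)).
- by case=> ? ? [? ?].
- by move=> y [? ?] /=; ring.
- exact: normc_ge_Re.
Qed.

Lemma path_derive_Im g x v : path_derive g x v ->
  is_derive x 1 (fun y => complex.Im (g y)) (complex.Im v).
Proof.
apply: (@path_derive_rho (fun z : C => complex.Im z)).
- by case=> ? ? [? ?].
- by move=> y [? ?] /=; ring.
- exact: normc_ge_Im.
Qed.

Lemma path_derive_real (h : R -> R) (x d : R) (u v : C) : is_derive x 1 h d ->
  path_derive (fun y => u + (h y)%:C%C * v) x (d%:C%C * v).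
Proof.
case=> hd Dd.
have H : (fun t : R => t^-1 *: ((h \o shift x) (t *: (1 : R)) - h x) : R) @ 0^' --> (d : R) by rewrite -Dd; exact: hd.
have := cvgM (cvg_real_complex H) (@cvg_cst _ v _ 0^' _).
move=> hh; refine (near_cvg _ (hh _ _ _)); near=> t.
rewrite /= /GRing.scale /= mulr1 opprD addrACA subrr add0r -mulrBl mulrA.
by rewrite -rmorphB -fmorphV -rmorphM.
Unshelve. all: by end_near. Qed.

End Paths.

(** * The logarithm along a ray *)

Section Ray.
Variables (R : realType) (w : R[i]^o) (r : R).
Hypotheses (hw : w != 0) (hr : 0 < r).
Local Notation C := (R[i]^o).

Definition ray (x : R) : C := (expR (- x))%:C%C * (- w).

Lemma path_derive_ray x : path_derive ray x (- ray x).
Proof.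
have h : is_derive x 1 (fun y : R => expR (- y)) (- expR (- x)).
  have -> : (fun y : R => expR (- y)) = expR \o -%R by [].
  have h1 : is_derive x 1 (-%R : R -> R) (- 1).
    exact: (@is_deriveN R R R id x 1 1 _).
  by have := is_derive1_comp (is_derive_expR (- x)) h1; rewrite mulrN1.
have := @path_derive_real R _ _ _ 0 (- w) h; rewrite rmorphN mulNr -/(ray x).
by congr (path_derive _ _ _); apply/funext => y; rewrite add0r.
Qed.

Lemma ray_slit : exists X, forall x, X < x -> slit_disc w r (ray x).
Proof.
pose n := complex.Re `|w|.
have wn : `|w| = n%:C%C by rewrite /n -normcR.
have n0 : 0 < n by rewrite -ltcR -wn normr_gt0.
exists (ln (n / r)) => x ltx; split.
  rewrite /ray (normrM (_ : C)) normrN wn ger0_norm ?lecR ?expR_ge0 //.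
  rewrite -rmorphM ltcR expRN mulrC ltr_pdivrMr ?expR_gt0 // mulrC -ltr_pdivrMr //.
  by rewrite -[X in X < _]lnK ?posrE ?divr_gt0 // ltr_expR.
move=> t t0; rewrite /ray mulrN -subr_eq0 -opprD oppr_eq0 -mulrDl mulf_neq0 //.
rewrite -rmorphD eq_complex /= eqxx andbT gt_eqF //.
by rewrite ltr_pwDl // expR_gt0.
Qed.

(** The function l (ray x) + x has constant exponential. Its real part is thus
    constant; if its continuous imaginary part took two values, it would also
    take two values differing by some d in ]0, 1], but cos d = 1 forces d = 0. *)
Lemma log_ray (l : C -> C) : log_determination (slit_disc w r) l ->
  exists L X, forall x, X < x -> slit_disc w r (ray x) /\ l (ray x) = L - x%:C%C.
Proof.
move=> [cl hl]; have [X hX] := ray_slit.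
pose h (x : R) : C := l (ray x) + x%:C%C.
have hexp x : X < x -> cexp (h x) = - w.
  move=> lx; rewrite /h (cexpD (l (ray x))) (hl _ (hX x lx)) cexp_real /ray.
  by rewrite mulrAC -rmorphM -expRD addNr expR0 mul1r.
have Reh x : X < x -> expR (complex.Re (h x)) = complex.Re `|w|.
  by move=> lx; rewrite -[w]opprK -(hexp x lx) normrN norm_cexp.
have Imh x : X < x -> (cos (complex.Im (h x)) +i* sin (complex.Im (h x)))%C =
     (complex.Re `|w|)%:C%C^-1 * (- w).
  move=> lx; rewrite -(hexp x lx) -(Reh x lx) /cexp mulKf //.
  by rewrite eq_complex /= eqxx andbT gt_eqF // expR_gt0.
have cont a b : X < a -> {within `[a, b], continuous (fun x => complex.Im (h x))}.
  move=> lta; apply/subspace_continuousP => x /=; rewrite in_itv /= => /andP[ax xb].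
  have ltx : X < x by exact: lt_le_trans ax.
  apply: (@cvg_rho R (fun z => complex.Im z)).
  - by case=> ? ? [? ?].
  - exact: normc_ge_Im.
  apply: cvgD; last first.
    by apply: cvg_real_complex; apply: cvg_within.
  have := (@subspace_continuousP _ _ _ l).1 cl (ray x) (hX x ltx).
  apply: cvg_comp => P; rewrite /nbhs /= /within /= => hP.
  have cr : {for x, continuous ray}.
    apply: cvgM; last exact: cvg_cst.
    apply: cvg_real_complex; apply: (@cvg_comp _ _ _ -%R expR); last exact: continuous_expR.
    exact: (@cvgN _ R _ _ _ id).
  have := cr _ hP; rewrite /= => hq; near=> y => ly.
  have : slit_disc w r (ray y) -> P (ray y) by near: y.
  apply; apply: hX; move: ly; rewrite in_itv /= => /andP[ay _].
  exact: lt_le_trans ay.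
have Imc a b : X < a -> a < b -> complex.Im (h a) = complex.Im (h b).
  move=> lta ltab; apply/eqP; apply: contrapT => /negP ne.
  pose u := complex.Im (h a); pose v := complex.Im (h b).
  pose d : R := Num.min 1 `|v - u|.
  have d0 : 0 < d by rewrite lt_min ltr01 normr_gt0 subr_eq0 eq_sym.
  have d1 : d <= 1 by rewrite ge_min lexx.
  have dv : d <= `|v - u| by rewrite ge_min lexx orbT.
  pose t := if u < v then u + d else u - d.
  have ht : Num.min u v <= t <= Num.max u v.
    rewrite /t; case: ltP => uv.
      by move: dv; rewrite gtr0_norm ?subr_gt0 // => dv; apply/andP; split; lra.
    by move: dv; rewrite ler0_norm ?subr_le0 // => dv; apply/andP; split; lra.
  have [c] := IVT (ltW ltab) (cont a b lta) ht.
  rewrite in_itv /= => /andP[ac _] hc.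
  have ltc : X < c by exact: lt_le_trans ac.
  have := Imh c ltc; rewrite -(Imh a lta) hc => -[ecos esin].
  have cd : cos d = 1.
    have -> : cos d = cos (t - u).
      by rewrite /t; case: ifP => _; rewrite addrAC subrr add0r ?cosN.
    by rewrite cosB ecos esin -!expr2 cos2Dsin2.
  have : d = 0.
    apply: cos_inj; rewrite ?in_itv /= ?cos0 ?lexx ?pi_ge0 ?(ltW d0) //=.
    by apply: le_trans d1 _; apply: le_trans (pi_ge2 R); lra.
  by move=> e; move: d0; rewrite e ltxx.
pose x0 := X + 1; have ltx0 : X < x0 by rewrite ltrDl.
exists (h x0), X => x ltx; split; first exact: hX.
suff -> : h x0 = h x by rewrite /h addrK.
have Im0 : complex.Im (h x0) = complex.Im (h x).
  by have [lt|lt|->] := ltgtP x0 x => //; [apply: Imc|apply/esym/Imc].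
have Re0 : complex.Re (h x0) = complex.Re (h x).
  by apply: expR_inj; rewrite !Reh.
by move: (h x0) (h x) Im0 Re0 => [? ?] [? ?] /= -> ->.
Unshelve. all: by end_near.
Qed.

End Ray.

(** * Convergent terms and their multiples *)

Section PowerTails.
Variable R : realType.
Local Notation C := R[i].

(** The tail is dominated by a geometric series of ratio c p <= 1/2. *)
Lemma power_tail (A : nat -> C) (c p : R) (z S : C) m :
  0 < c -> (forall n, `|A n| <= (c ^+ n.+1)%:C%C) -> `|z| = p%:C%C -> 2 * (c * p) <= 1 ->
  series (fun n => A n * z ^+ n : R[i]^o) @ \oo --> (S : R[i]^o) ->
  `|S - \sum_(n < m) A n * z ^+ n| <= (2 * c * (c * p) ^+ m)%:C%C.
Proof.
move=> c0 hA zp cp hS.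
have p0 : 0 <= p by have := normr_ge0 z; rewrite zp lecR.
have part k : forall m, `|\sum_(i < k) A (m + i)%N * z ^+ (m + i)| <= (2 * c * (c * p) ^+ m)%:C%C.
  elim: k => [|k IH] n.
    by rewrite big_ord0 normr0 lecR !mulr_ge0 // ?exprn_ge0 ?mulr_ge0 // ltW.
  rewrite big_ord_recl addn0; apply: le_trans (ler_normD _ _) _.
  have h1 : `|A n * z ^+ n| <= (c * (c * p) ^+ n)%:C%C.
    rewrite normrM normrX zp exprMn mulrA -exprS rmorphM /= [(p ^+ n)%:C%C]rmorphXn /=.
    by rewrite ler_wpM2r // exprn_ge0 // lecR.
  have h2 : `|\sum_(i < k) A (n + lift ord0 i)%N * z ^+ (n + lift ord0 i)| <=
      (c * (c * p) ^+ n)%:C%C.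
    have := IH n.+1; under eq_bigr do rewrite addSnnS; move=> h; apply: le_trans h _.
    rewrite lecR exprS; have cp0 : 0 <= c * p by rewrite mulr_ge0 // ltW.
    have := exprn_ge0 n cp0; move: ((c * p) ^+ n) => u u0.
    have -> : 2 * c * (c * p * u) = c * (2 * (c * p) * u) by ring.
    by rewrite ler_pM2l // -[X in _ <= X]mul1r ler_wpM2r.
  apply: le_trans (lerD h1 h2) _; rewrite -rmorphD lecR.
  by move: ((c * p) ^+ n) => u; rewrite -mulr2n -[X in _ <= X]mulrA [2 * _]mulr_natl.
rewrite normcR lecR; apply/ler_addgt0Pr => e e0.
have /cvg_complexP /(_ e e0) [N _ hN] := hS.
have := hN (N + m)%N (leq_addr _ _); rewrite /series /= big_mkord addnC big_split_ord /= => h.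
rewrite -lecR -normcR [_ + e]addrC rmorphD.
set P := \sum_(n < m) _ in h *; set Q := \sum_(n < N) _ in h.
have -> : S - P = (S - (P + Q)) + Q by rewrite opprD addrA subrK.
by apply: le_trans (ler_normD _ _) _; apply: lerD; [apply: ltW|apply: part].
Qed.

Lemma approximable_series (L : C) (A : nat -> C) (c X : R) (g : R -> C) :
  0 < c -> (forall n, `|A n| <= (c ^+ n.+1)%:C%C) ->
  (forall x, X < x -> series (fun n => A n * (cexp (L - x%:C%C : C) : C) ^+ n : R[i]^o) @ \oo
      --> (g x : R[i]^o)) ->
  approximable L A g.
Proof.
move=> c0 hA hg; pose e := expR (complex.Re L); have e0 : 0 < e by exact: expR_gt0.
have ze x : `|cexp (L - x%:C%C : C) : C| = (e * expR (- x))%:C%C.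
  by rewrite norm_cexp raddfB /= expRD.
exists (Num.max (2 * c) (c * e)), (Num.max (X + 1) (ln (2 * (c * e)))) => x.
rewrite ge_max => /andP[xX xl] m.
have ltx : X < x by apply: lt_le_trans xX; rewrite ltrDl.
have ce : 0 < c * e by rewrite mulr_gt0.
have hc : 2 * (c * (e * expR (- x))) <= 1.
  rewrite expRN !mulrA ler_pdivrMr ?expR_gt0 // mul1r -!mulrA.
  by rewrite -[X in X <= _]lnK ?posrE ?mulr_gt0 // ler_expR.
apply: le_trans (power_tail m c0 hA (ze x) hc (hg x ltx)) _.
rewrite lecR; apply: ler_pM.
- by rewrite mulr_ge0 // ltW.
- by rewrite exprn_ge0 // !mulr_ge0 ?expR_ge0 // ltW.
- by rewrite le_max lexx.
apply: lerXn2r; rewrite ?nnegrE ?mulr_ge0 ?expR_ge0 ?(ltW c0) ?(ltW e0) //.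
  by rewrite le_max (ltW ce) orbT.
by rewrite mulrA ler_wpM2r ?expR_ge0 // le_max lexx orbT.
Qed.

End PowerTails.

Section ShiftedTerms.
Variable R : realType.
Local Notation C := R[i].

(** The term z^i times the i-th coefficient of a polynomial, so that a family
    of terms multiplied by polynomials is again a family of terms. *)
Definition shift_term (U : Type) (tm : U -> logterm R) (P : U -> {poly C}) (u : U * nat) :=
  LogTerm ((P u.1)`_u.2 * lt_coef (tm u.1)) (lt_exp (tm u.1) + u.2%:R)
     (lt_log (tm u.1)) (lt_ser (tm u.1)).

Definition shift_index (U : Type) (J : seq U) (N : nat) := [seq (u, i) | u <- J, i <- iota 0 N].

Lemma formal_coef_shift (U : eqType) (tm : U -> logterm R) (P : U -> {poly C}) (J : seq U) N b j :
  formal_coef (shift_term tm P) (shift_index J N) b j =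
  \sum_(u <- J | lt_log (tm u) == j) \sum_(i < N)
    (P u)`_i * (lt_coef (tm u) * coef_at (lt_ser (tm u)) (b - i%:R - lt_exp (tm u))).
Proof.
rewrite /formal_coef big_mkcond big_allpairs_dep [RHS]big_mkcond /=.
apply: eq_bigr => u _; rewrite -big_mkcond /=; case: ifP => [_|_]; last by rewrite big_pred0.
rewrite -(big_mkord xpredT (fun i => (P u)`_i * (lt_coef (tm u) *
   coef_at (lt_ser (tm u)) (b - i%:R - lt_exp (tm u))))) /index_iota subn0.
by apply: eq_bigr => i _; rewrite mulrA opprD addrA addrAC.
Qed.

Lemma shift_val (U : eqType) (tm : U -> logterm R) (P : U -> {poly C}) (J : seq U) N L (g : U -> R -> C) (x : R) :
  (forall u, size (P u) <= N)%N ->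
  \sum_(v <- shift_index J N) term_val L (shift_term tm P v) (g v.1) x =
  \sum_(u <- J) (P u).[cexp (L - x%:C%C : C)] * term_val L (tm u) (g u) x.
Proof.
move=> hN; rewrite big_allpairs_dep; apply: eq_bigr => u _ /=.
rewrite (horner_coef_wide _ (hN u)) mulr_suml.
rewrite -(big_mkord xpredT (fun i => (P u)`_i * (cexp (L - x%:C%C : C) : C) ^+ i *
   term_val L (tm u) (g u) x)) /index_iota subn0.
apply: eq_bigr => i _; rewrite /term_val /=.
have -> : cexp (ratr (lt_exp (tm u) + i%:R) * (L - x%:C%C) : C) =
   cexp (ratr (lt_exp (tm u)) * (L - x%:C%C) : C) * (cexp (L - x%:C%C : C) : C) ^+ i :> C.
  have -> : ratr (lt_exp (tm u) + i%:R) = ratr (lt_exp (tm u)) + i%:R :> C by rewrite rmorphD /= ratr_nat.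
  by rewrite mulrDl (cexpD (ratr (lt_exp (tm u)) * _)) cexp_nat.
by ring.
Qed.

Lemma ncut_cvg (a : rat) : (fun B : nat => ncut (B%:R - a)) @ \oo --> \oo.
Proof.
move=> P [n _ hn]; exists (Num.bound (n%:R + `|a|)) => // B /= leB; apply: hn => /=.
case: n leB => // n leB; rewrite ncutP ltrBrDr.
have na0 : 0 <= n.+1%:R + `|a| by rewrite addr_ge0.
have := archi_boundP na0; rewrite -(ler_nat rat) in leB; rewrite -natr1 in leB * => h.
apply: le_lt_trans (lerD (lexx _) (ler_norm a)) _.
by apply: lt_le_trans leB; apply: lt_trans h; rewrite ltrD2r ltrDl.
Qed.

(** At a fixed point the value is the limit of its truncations, and each
    truncation regroups into formal coefficients, all zero. *)
Lemma zero_value (U : eqType) (tm : U -> logterm R) (I : seq U) L (g : U -> R -> C) x :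
  (forall s, s \in I ->
     series (fun n => lt_ser (tm s) n * (cexp (L - x%:C%C : C) : C) ^+ n : R[i]^o) @ \oo
      --> (g s x : R[i]^o)) ->
  (forall b j, formal_coef tm I b j = 0) ->
  \sum_(s <- I) term_val L (tm s) (g s) x = 0.
Proof.
move=> hg k0.
have cut0 B : \sum_(t <- cut_terms tm I B) mono_val L t x = 0.
  rewrite (sum_by_key (fun t : mono R => (t.1.2, t.2))) big_seq big1 // => -[b j].
  rewrite mem_undup => /mapP[t0 /allpairsPdep[s [n [sI]]]].
  rewrite mem_iota ncutP /= => ltn -> /= [-> ->].
  set b1 := _ + _; set j1 := lt_log _.
  transitivity (\sum_(t <- cut_terms tm I B | (t.1.2 == b1) && (t.2 == j1))
     t.1.1 * (cexp (ratr b1 * (L - x%:C%C) : C) * (L - x%:C%C) ^+ j1)).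
    by apply: eq_big => [[[c b2] j2]|[[c b2] j2]] //= /eqP[-> ->]; rewrite mulrA.
  by rewrite -mulr_suml -/(mono_coef _ _ _) mono_coef_cut ?k0 ?mul0r // /b1 -ltrBrDl.
have h : (fun B : nat => \sum_(t <- cut_terms tm I B%:R) mono_val L t x : R[i]^o) @ \oo -->
   (\sum_(s <- I) term_val L (tm s) (g s) x : R[i]^o).
  have -> : (fun B : nat => \sum_(t <- cut_terms tm I B%:R) mono_val L t x : R[i]^o) =
    (fun B => \sum_(s <- I) (lt_coef (tm s) * cexp (ratr (lt_exp (tm s)) * (L - x%:C%C) : C) *
     (L - x%:C%C) ^+ lt_log (tm s) * \sum_(n < ncut (B%:R - lt_exp (tm s)))
        lt_ser (tm s) n * (cexp (L - x%:C%C : C) : C) ^+ n : R[i]^o)).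
    by apply/funext => B; rewrite cut_terms_val; apply: eq_bigr => s _; rewrite mono_val_sum.
  rewrite big_seq; under eq_fun do rewrite big_seq.
  apply: cvg_big => [|s sI]; first exact: add_continuous.
  apply: cvgM; first exact: cvg_cst.
  have := cvg_comp _ _ (@ncut_cvg (lt_exp (tm s))) (hg s sI).
  apply: near_cvg; apply: nearW => B; rewrite /series /=; by rewrite big_mkord.
have h0 : (fun B : nat => \sum_(t <- cut_terms tm I B%:R) mono_val L t x : R[i]^o) @ \oo --> (0 : R[i]^o).
  have -> : (fun B : nat => \sum_(t <- cut_terms tm I B%:R) mono_val L t x : R[i]^o) = fun=> 0.
    by apply/funext => B; rewrite cut0.
  exact: cvg_cst.
exact: (cvg_unique _ h h0).
Qed.

End ShiftedTerms.

(** * Coefficient sequences in a class of exponents *)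

Section GevreyClosure.
Variables (R : realType) (iota : {rmorphism algC -> R[i]}).

Lemma gevrey_seq0 : gevrey_seq iota (fun=> 0).
Proof.
exists 1%N; split=> n; first by move=> s; rewrite rmorph0 rmorph0 normr0.
by exists 1%N => [|m _]; rewrite ?exp1n // mulr0 rpred0.
Qed.

Lemma gevrey_seqZ c y : gevrey_seq iota y -> gevrey_seq iota (fun n => c * y n).
Proof.
move=> [K [hK dK]]; have [B hB] := house_exists iota c; have [d d0 hd] := Aint_denom c.
have B1 n : (B <= B.+1 ^ n.+1)%N by rewrite expnS (leq_trans (leqnSn B)) // leq_pmulr // expn_gt0.
have d1 n : (d <= d ^ n.+1)%N by rewrite expnS leq_pmulr // expn_gt0 d0.
exists (B.+1 * d * K)%N; split=> n.
  apply: house_leW (house_leM hB (hK n)); rewrite !expnMn leq_mul2r.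
  by apply/orP; right; apply: leq_trans (B1 n) _; rewrite leq_pmulr // expn_gt0 d0.
have [D /andP[D0 DK] hD] := dK n; exists (d * D)%N => [|m lemn].
  rewrite muln_gt0 d0 D0 /= !expnMn leq_mul // (leq_trans (d1 n)) // leq_pmull //.
  by rewrite expn_gt0.
by rewrite natrM mulrACA rpredM ?hD.
Qed.

Lemma gevrey_seqD y z : gevrey_seq iota y -> gevrey_seq iota z ->
  gevrey_seq iota (fun n => y n + z n).
Proof.
move=> [K [hK dK]] [L [hL dL]]; exists (2 * K.+1 * L.+1)%N.
have bnd n : (K ^ n.+1 + L ^ n.+1 <= (2 * K.+1 * L.+1) ^ n.+1)%N /\
    (K ^ n.+1 * L ^ n.+1 <= (2 * K.+1 * L.+1) ^ n.+1)%N.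
  have hK1 : (K ^ n.+1 <= K.+1 ^ n.+1)%N by rewrite leq_exp2r.
  have hL1 : (L ^ n.+1 <= L.+1 ^ n.+1)%N by rewrite leq_exp2r.
  have K0 : (0 < K.+1 ^ n.+1)%N by rewrite expn_gt0.
  have L0 : (0 < L.+1 ^ n.+1)%N by rewrite expn_gt0.
  have two : (2 <= 2 ^ n.+1)%N by rewrite expnS leq_pmulr // expn_gt0.
  rewrite !expnMn; move: (K ^ _)%N (L ^ _)%N (K.+1 ^ _)%N (L.+1 ^ _)%N (2 ^ _)%N
    hK1 hL1 K0 L0 two => {hK dK hL dL K L} x x1 u v t hx hx1 u0 v0 ht.
  have h1 : (2 * (u * v) <= t * u * v)%N by rewrite -mulnA leq_mul2r ht orbT.
  have h2 : (x * x1 <= u * v)%N by rewrite leq_mul.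
  by split; nia.
split=> n; first exact: house_leW (bnd n).1 (house_leD (hK n) (hL n)).
have [D /andP[D0 DK] hD] := dK n; have [E /andP[E0 EL] hE] := dL n.
exists (D * E)%N => [|m lemn].
  by rewrite muln_gt0 D0 E0 /=; apply: leq_trans (bnd n).2; rewrite leq_mul.
rewrite natrM mulrDr; apply: rpredD; last by rewrite -mulrA rpredM ?hE ?Aint_nat.
by rewrite [D%:R * _]mulrC -mulrA rpredM ?hD ?Aint_nat.
Qed.

Lemma gevrey_seq_sum (I : Type) (r : seq I) (P : pred I) (y : I -> nat -> algC) :
  (forall s, P s -> gevrey_seq iota (y s)) ->
  gevrey_seq iota (fun n => \sum_(s <- r | P s) y s n).
Proof.
move=> h; elim: r => [|s r IH].
  have -> : (fun n => \sum_(s <- [::] | P s) y s n) = fun=> 0 by apply/funext => n; rewrite big_nil.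
  exact: gevrey_seq0.
case Ps: (P s); last first.
  have -> : (fun n => \sum_(s0 <- s :: r | P s0) y s0 n) = (fun n => \sum_(s <- r | P s) y s n).
    by apply/funext => n; rewrite big_cons Ps.
  exact: IH.
have -> : (fun n => \sum_(s0 <- s :: r | P s0) y s0 n) = (fun n => y s n + \sum_(s <- r | P s) y s n).
  by apply/funext => n; rewrite big_cons Ps.
by apply: gevrey_seqD => //; apply: h.
Qed.

(** A shift of the index by N multiplies the growth constant by K^N, since
    n + N + 1 <= (n + 1) (N + 1). *)
Lemma gevrey_shift (a : nat -> algC) (g : rat) : gevrey0_coefs iota a ->
  gevrey_seq iota (fun n => coef_at a (g + n%:R)).
Proof.
move=> [c [c0 [hc [d hd]]]]; pose K := (Num.bound c).+1; pose N := Num.bound `|g|.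
have cK n : c ^+ n <= (K ^ n)%N%:R.
  rewrite natrX lerXn2r ?nnegrE ?ler0n ?(ltW c0) //; apply: le_trans (ler_norm _) _.
  rewrite ger0_norm ?(ltW c0) //; apply: le_trans (ltW (archi_boundP (ltW c0))) _.
  by rewrite ler_nat leqnSn.
have idx n k : k%:R = g + n%:R -> (k <= n + N)%N.
  move=> e; rewrite -(ler_nat rat) e addrC natrD lerD2l.
  by apply: le_trans (ler_norm _) _; apply: ltW; apply: archi_boundP.
have KX n m : (m <= (n + N).+1)%N -> (K ^ m <= (K ^ N.+1) ^ n.+1)%N.
  by move=> le; rewrite -expnM leq_pexp2l //; nia.
exists (K ^ N.+1)%N; split=> n.
  rewrite /coef_at; case: ifP => [/natrP[k Dk]|_] sigma; last first.
    by rewrite !rmorph0 normr0.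
  rewrite Dk natrK; apply: le_trans (hc sigma k) _.
  rewrite -[_%:R](rmorph_nat (real_complex R)) lecR; apply: le_trans (cK _) _.
  by rewrite ler_nat KX // ltnS idx.
have [d0 [dK dA]] := hd (n + N)%N; exists (d (n + N)%N) => [|m lemn].
  rewrite d0 /= -(ler_nat R); apply: le_trans dK _; apply: le_trans (cK _) _.
  by rewrite ler_nat KX.
rewrite /coef_at; case: ifP => [/natrP[k Dk]|_]; last by rewrite mulr0 rpred0.
by rewrite Dk natrK dA // (leq_trans (idx _ _ (esym Dk))) // leq_add2r.
Qed.

End GevreyClosure.

Section ExponentClasses.
Variables (R : realType) (iota : {rmorphism algC -> R[i]}).

Lemma coef_at_laurent (P : {poly algC}) M m :
  coef_at (fun n => P`_n) (- M%:R + m%:R) = ('X^M * P)`_m.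
Proof.
rewrite coefXnM /coef_at addrC; case: ltnP => [lt|le]; last by rewrite -natrB // natr_nat natrK.
case: ifP => // /natrP[n e]; suff : (m < m)%N by rewrite ltnn.
have : M%:R <= m%:R :> rat by rewrite -subr_ge0 e.
by rewrite ler_nat => /(leq_trans lt).
Qed.

Lemma sum_ord_support (V : nmodType) (F : nat -> V) n m :
  (forall i, (n <= i)%N -> F i = 0) -> (forall i, (m <= i)%N -> F i = 0) ->
  \sum_(i < n) F i = \sum_(i < m) F i.
Proof.
wlog le : n m / (n <= m)%N.
  by move=> h hn hm; have [/h->|/ltnW/h->] := leqP n m.
move=> hn _; rewrite (big_ord_widen m F le) [RHS](bigID (fun i : 'I_m => (i < n)%N)) /=.
by rewrite [X in _ = _ + X]big1 ?addr0 // => i; rewrite -leqNgt => /hn.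
Qed.

Variables (T p Q : {poly algC}) (N : nat) (k : rat -> nat -> algC).
Hypotheses (nzT : T != 0) (sT : (size T <= N)%N) (sp : (size ('X * p)%R <= N)%N).
Hypothesis hk : forall b j,
  \sum_(i < N) T`_i * (ratr (b - i%:R) * k (b - i%:R) j + j.+1%:R * k (b - i%:R) j.+1) =
  \sum_(i < N) ('X * p)`_i * k (b - i%:R) j + coef_at (fun n => Q`_n) b *+ (j == 0%N).
Hypothesis low : exists b0, forall b j, b < b0 -> k b j = 0.
Hypothesis finlog : exists J, forall b j, (J <= j)%N -> k b j = 0.
Hypothesis gev : forall b j, gevrey_seq iota (fun n => k (b + n%:R) j).

(** Along a class of exponents modulo Z the relations between the coefficients
    without the next logarithm form the recurrence of a power series times
    z^al. *)
Lemma class_euler (e : {poly algC}) al j :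
  (forall n : nat, k (al - n.+1%:R) j = 0) -> (forall n : nat, k (al + n%:R) j.+1 = 0) ->
  (forall n : nat, k (al - n.+1%:R) j.+1 = 0) ->
  (forall m, e`_m = coef_at (fun n => Q`_n) (al + m%:R) *+ (j == 0%N)) ->
  euler_eq T ('X * p - (ratr al)%:P * T) e (fun n => k (al + n%:R) j).
Proof.
move=> lowal top lowtop he m; rewrite he.
have mv (u v w : algC) : u = v + w -> w = u - v by move=> ->; rewrite addrC addKr.
rewrite (mv _ _ _ (hk (al + m%:R) j)).
rewrite -sumrB.
pose G i := T`_i * (ratr (al + m%:R - i%:R) * k (al + m%:R - i%:R) j +
    j.+1%:R * k (al + m%:R - i%:R) j.+1) - ('X * p)`_i * k (al + m%:R - i%:R) j.
rewrite (@sum_ord_support _ G N m.+1).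
- apply: eq_bigr => i _; have lei : (i <= m)%N by rewrite -ltnS.
  rewrite /G -addrA -natrB // top mulr0 addr0 coefB coefCM rmorphD /= ratr_nat.
  by move: (k _ _) (T`_i) => u v; ring.
- move=> i le; rewrite /G !nth_default ?mul0r ?subr0 //; exact: leq_trans le.
move=> i lt; have [n ->] : exists n, i = (m + n.+1)%N.
  by exists (i - m.+1)%N; rewrite addnS -addSn subnKC.
rewrite /G natrD opprD addrA addrK lowal lowtop.
by rewrite !mulr0 addr0 mulr0 subr0.
Qed.

(** In the class of be, take the highest power of the logarithm that occurs:
    its series satisfies the homogeneous equation, since by hypothesis the
    inhomogeneous term does not reach it. *)
Lemma bounded_of_homogeneous be j : k be j != 0 ->
  (j = 0%N -> forall m n : nat, coef_at (fun n => Q`_n) (be - m%:R + n%:R) = 0) ->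
  gal_bounded ('X * T) ('X * p).
Proof.
move=> nzk hQ; have [b0 hb0] := low; have [J hJ] := finlog.
pose m := Num.bound `|be - b0|; pose al := be - m%:R.
have lt_al : al < b0.
  rewrite /al ltrBlDr addrC -ltrBlDr; apply: le_lt_trans (ler_norm _) _.
  exact: archi_boundP (normr_ge0 _).
have lowal n i : k (al - n.+1%:R) i = 0.
  by apply: hb0; apply: le_lt_trans lt_al; rewrite gerBl.
pose good i := `[< exists n : nat, k (al + n%:R) i != 0 >].
have good_j : exists i, good i.
  by exists j; apply/asboolP; exists m; rewrite /al subrK.
have good_le i : good i -> (i <= J)%N.
  move/asboolP=> [n]; apply: contraNT; rewrite -ltnNge => /ltnW lt.
  by rewrite hJ.
case: (ex_maxnP good_j good_le) => i /asboolP exi maxi.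
have jgood : good j by apply/asboolP; exists m; rewrite /al subrK.
have top n : k (al + n%:R) i.+1 = 0.
  apply/eqP; apply: contraT => nz; have : good i.+1 by apply/asboolP; exists n.
  by move/maxi; rewrite ltnn.
apply: (bounded_of_solution nzT (e := 0) (al := al) (y := fun n => k (al + n%:R) i)).
- apply: class_euler => // n; rewrite coef0.
  case: eqP => [i0|_]; last by rewrite mulr0n.
  rewrite mulr1n /al hQ //.
  by have := maxi _ jgood; rewrite i0 leqn0 => /eqP.
- exact: gev.
- by right.
Qed.

(** Exponents outside Z and logarithms do not meet the inhomogeneous term and
    fall under [bounded_of_homogeneous]; what remains is a Laurent series, and
    if it is irrational, [chudnovsky] applies to it. *)
Lemma bounded_or_laurent : gal_bounded ('X * T) ('X * p) \/
  (forall b j, k b j != 0 -> j = 0%N /\ b \is a Num.int) /\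
  exists M : nat, (forall b j, b < - M%:R -> k b j = 0) /\
  exists (V P : {poly algC}), V != 0 /\
    forall n, cauchy_coef V (fun n => k (- M%:R + n%:R) 0%N) n = P`_n.
Proof.
case: (pselect (exists b j, k b j != 0 /\ ((0 < j)%N \/ b \isn't a Num.int))).
  move=> [b [j [nz h]]]; left; apply: (bounded_of_homogeneous nz) => j0 m n.
  case: h => [|nint]; first by rewrite j0.
  rewrite /coef_at; case: ifP => // nat_.
  have : b \is a Num.int.
    have -> : b = (b - m%:R + n%:R) - n%:R + m%:R by rewrite addrK subrK.
    by rewrite rpredD ?rpredB ?rpred_nat //; apply: intr_nat.
  by rewrite (negbTE nint).
move=> none; have shape b j : k b j != 0 -> j = 0%N /\ b \is a Num.int.
  move=> nz; split.
    by apply/eqP; apply: contraT => jn; case: none; exists b, j; split=> //; left; rewrite lt0n.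
  by apply: contraT => bn; case: none; exists b, j; split=> //; right.
have [b0 hb0] := low; pose M := Num.bound `|b0|; pose al : rat := - M%:R.
have lt_al : al < b0.
  rewrite /al ltrNl; apply: le_lt_trans (ler_norm _) _; rewrite normrN; exact: archi_boundP (normr_ge0 _).
have lowM b j : b < al -> k b j = 0 by move=> lt; apply: hb0; apply: lt_trans lt_al.
have high b j : k b j.+1 = 0.
  by apply/eqP; apply: contraT => /shape[].
have eu : euler_eq T ('X * p - (ratr al)%:P * T) ('X^M * Q) (fun n => k (al + n%:R) 0%N).
  apply: class_euler => // [n|m]; first by rewrite lowM // gtrBl ltr0n.
  by rewrite eqxx mulr1n coef_at_laurent.
case: (pselect (irrational_seq (fun n => k (al + n%:R) 0%N))) => irr.
  left; apply: (bounded_of_solution nzT eu) => //; by left.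
right; split=> //; exists M; split=> //.
exact: rational_seqP irr.
Qed.

End ExponentClasses.

(** * Algebraic coordinates of the constants *)

Section AlgebraicCoordinates.
Variables (R : realType) (iota : {rmorphism algC -> R[i]}).
Local Notation C := R[i].

(** A finite family of complex numbers spans a finite-dimensional space over
    the algebraic numbers; a basis is built greedily, starting from 1. *)
Lemma algebraic_coordinates (V : seq C) : exists n (mu : nat -> C),
  [/\ mu 0%N = 1,
      forall c : nat -> algC, \sum_(i < n.+1) iota (c i) * mu i = 0 ->
        forall i, (i < n.+1)%N -> c i = 0
    & forall v, v \in V -> exists c : nat -> algC, v = \sum_(i < n.+1) iota (c i) * mu i].
Proof.
elim: V => [|v V [n [mu [mu0 free span]]]].
  exists 0%N, (fun=> 1); split=> // c; rewrite big_ord1 mulr1 => /eqP.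
  by rewrite fmorph_eq0 => /eqP c0 [|i].
have [vspan|nspan] := pselect (exists c : nat -> algC, v = \sum_(i < n.+1) iota (c i) * mu i).
  by exists n, mu; split=> // u; rewrite inE => /predU1P[->|/span].
pose nu i := if (i < n.+1)%N then mu i else v.
have nuE (c : nat -> algC) : \sum_(i < n.+2) iota (c i) * nu i =
    \sum_(i < n.+1) iota (c i) * mu i + iota (c n.+1) * v.
  rewrite big_ord_recr /= /nu ltnn; congr (_ + _); apply: eq_bigr => i _.
  by rewrite ltn_ord.
exists n.+1, nu; split=> //.
  move=> c; rewrite nuE => e; have c0 : c n.+1 = 0.
    apply/eqP; apply: contraT => nz; case: nspan.
    exists (fun i => - (c n.+1)^-1 * c i).
    have nz1 : iota (c n.+1) != 0 by rewrite fmorph_eq0.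
    apply: (mulfI nz1); rewrite mulr_sumr -[LHS](addKr (\sum_(i < n.+1) iota (c i) * mu i)).
    rewrite e addr0 -sumrN; apply: eq_bigr => i _.
    by rewrite rmorphM rmorphN fmorphV mulrA mulrA mulrN divff // mulN1r mulNr.
  move: e; rewrite c0 rmorph0 mul0r addr0 => /free h i; rewrite ltnS leq_eqVlt.
  by case/predU1P => [->|/h].
move=> u; rewrite inE => /predU1P[->|/span[c ->]].
  exists (fun i => (i == n.+1)%:R); rewrite (nuE (fun i => (i == n.+1)%:R)) eqxx rmorph1 mul1r big1 ?add0r // => i _.
  by rewrite (ltn_eqF (ltn_ord i)) rmorph0 mul0r.
exists (fun i => if (i < n.+1)%N then c i else 0); rewrite (nuE (fun i => if (i < n.+1)%N then c i else 0)) ltnn rmorph0 mul0r addr0.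
by apply: eq_bigr => i _; rewrite ltn_ord.
Qed.

End AlgebraicCoordinates.

(** Formal power series form an integral domain: V A y = A P = V B. Truncated
    products replace the ring of power series, at the price of the order q of
    V. *)
Lemma series_cancel (V P A B : {poly algC}) y : V != 0 ->
  (forall n, cauchy_coef V y n = P`_n) -> A * P = B * V ->
  forall n, cauchy_coef A y n = B`_n.
Proof.
move=> nzV hV e n; have [q [V1 [DV nzV1 _]]] := lowest_coef nzV.
pose L := (n.+1 + q)%N; pose Y : {poly algC} := \poly_(i < L) y i.
have ltn : (n < L)%N by rewrite ltn_addr.
rewrite -(coef_mul_trunc _ _ ltn) -/Y; apply/eqP; rewrite -subr_eq0 -coefB; apply/eqP.
suff : 'X^(n.+1) %| A * Y - B by move/dvdXnP; apply.
have h : 'X^L %| V * Y - P.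
  by apply/dvdXnP => i lti; rewrite coefB coef_mul_trunc // hV subrr.
have : 'X^L %| V * (A * Y - B).
  have -> : V * (A * Y - B) = A * (V * Y - P) by rewrite mulrBr mulrBr e; ring.
  by rewrite dvdp_mull.
have -> : V * (A * Y - B) = 'X^q * (V1 * (A * Y - B)) by rewrite DV; ring.
rewrite /L addnC exprD dvdp_mul2l ?expf_neq0 ?polyX_eq0 // Gauss_dvdpr //.
by rewrite coprimep_expl // coprimep_sym coprimepX /root horner_coef0.
Qed.

Section ConstantTerm.
Variables (R : realType) (iota : {rmorphism algC -> R[i]}).
Local Notation C := R[i].
Variables (U : eqType) (S : seq U) (lam : U -> C) (al : U -> rat) (lg : U -> nat)
  (a : U -> nat -> algC).

(** The index None stands for the constant function 1, to which the polynomial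
    parts of the equation are attached. *)
Definition ext_term (u : option U) : logterm R :=
  if u is Some s then LogTerm (lam s) (al s) (lg s) (fun n => iota (a s n))
  else LogTerm 1 0 0 (fun n => (n == 0%N)%:R).

Definition ext_index : seq (option U) := None :: map Some S.

(** The polynomial V multiplies f, and W is added. *)
Definition ext_poly (V W : {poly algC}) (u : option U) : {poly C} :=
  map_poly iota (if u is Some _ then V else W).

(** The coefficient of z^b log(z)^j in the expansion of f. *)
Definition total_coef (b : rat) (j : nat) : C :=
  \sum_(s <- S | lg s == j) lam s * coef_at (fun n => iota (a s n)) (b - al s).

Lemma coef_at_delta (c : rat) : coef_at (fun n => (n == 0%N)%:R : C) c = (c == 0)%:R.
Proof.
rewrite /coef_at; case: ifP => [/natrP[n ->]|nc]; first by rewrite natrK pnatr_eq0.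
by case: eqP nc => // ->; rewrite rpred0.
Qed.

Lemma formal_coef_ext (V W : {poly algC}) (N : nat) (b : rat) j : (size W <= N)%N ->
  formal_coef (shift_term ext_term (ext_poly V W)) (shift_index ext_index N) b j =
  coef_at (fun n => iota W`_n) b *+ (j == 0%N) +
  \sum_(i < N) iota V`_i * total_coef (b - i%:R) j.
Proof.
move=> sW; rewrite formal_coef_shift /ext_index big_mkcond big_cons big_map -big_mkcond /=.
rewrite exchange_big /=; congr (_ + _); last first.
  apply: eq_bigr => i _; rewrite /total_coef mulr_sumr; apply: eq_bigr => s _.
  by rewrite coef_map.
rewrite [j == 0%N]eq_sym; case: (0%N =P j) => _; last by rewrite mulr0n.
under eq_bigr do rewrite coef_at_delta subr0 subr_eq0.
rewrite mulr1n /coef_at; case: ifP => [/natrP[n Db]|nb].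
  rewrite Db natrK; have [lt|le] := ltnP n N.
    rewrite (bigD1 (Ordinal lt)) //= eqxx big1 ?addr0 => [|i ni].
      by rewrite coef_map !mulr1.
    rewrite eqr_nat eq_sym.
    have /negbTE-> : (i : nat) != n by apply: contraNneq ni => e; apply/eqP/val_inj.
    by rewrite !mulr0.
  rewrite nth_default ?(leq_trans sW) // rmorph0 big1 // => i _.
  rewrite eqr_nat gtn_eqF ?mulr0 //.
  exact: leq_trans (ltn_ord i) le.
rewrite big1 // => i _; by case: eqP nb => [->|]; rewrite ?rpred_nat // !mulr0.
Qed.

Lemma ext_val (V W : {poly algC}) (N : nat) (L : C) (g : option U -> R -> C) (x : R) :
  (size V <= N)%N -> (size W <= N)%N -> g None x = 1 ->
  \sum_(v <- shift_index ext_index N)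
     term_val L (shift_term ext_term (ext_poly V W) v) (g v.1) x =
  (map_poly iota W).[cexp (L - x%:C%C : C)] +
  (map_poly iota V).[cexp (L - x%:C%C : C)] *
    \sum_(s <- S) lam s * cexp (ratr (al s) * (L - x%:C%C) : C) *
       (L - x%:C%C) ^+ lg s * g (Some s) x.
Proof.
move=> sV sW g1; rewrite shift_val; last by case=> [s|]; rewrite size_map_poly.
rewrite big_cons big_map mulr_sumr; congr (_ + _).
by rewrite /term_val /= g1 rmorph0 mul0r cexp0 expr0 !mulr1.
Qed.

End ConstantTerm.

(** * The expansion of a Nilsson-Gevrey solution *)

Section FirstOrder.
Variables (R : realType) (iota : {rmorphism algC -> R[i]}).
Local Notation C := (R[i]^o).

Lemma is_derive_horner (P : {poly R[i]}) (z : C) :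
  is_derive z 1 (fun y : C => P.[y] : C) (P^`().[z] : C).
Proof.
elim/poly_ind: P => [|P c IH].
  have -> : (fun y : C => (0 : {poly R[i]}).[y] : C) = cst (0 : C).
    by apply/funext => y; rewrite horner0.
  by rewrite deriv0 horner0; apply: is_derive_cst.
have -> : (fun y : C => (P * 'X + c%:P).[y] : C) =
    (fun y : C => P.[y] : C) * (@id C) + cst (c : C).
  by apply/funext => y; rewrite hornerMXaddC.
have dP := is_deriveD (is_deriveM IH (@is_derive_id C C z 1)) (@is_derive_cst C C C (c : C) z 1).
apply: (is_derive_eq dP).
rewrite derivMXaddC hornerD hornerMX addr0 /GRing.scale /= mulr1 mulrC addrC.
by rewrite addrC.
Qed.

(** Values are computed in lowest terms; any other fraction gives the same
    relation after clearing denominators. *)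
Lemma rf_eval_clear (x : ratfun) (T p : {poly algC}) (z : C) : T != 0 ->
  x * T%:F = p%:F -> rf_regular iota x z ->
  (map_poly iota T).[z] * rf_eval iota x z = (map_poly iota p).[z].
Proof.
move=> nzT e hz; have := congr1 (fun u => (map_poly iota u).[z]) (rf_cross nzT e).
rewrite !rmorphM !hornerM /= /rf_eval => h.
by rewrite mulrA [_ * (map_poly iota (rf_num x)).[z]]mulrC h mulfK.
Qed.

Lemma series_delta (z : C) :
  series (fun n => (n == 0%N)%:R * z ^+ n : C) @ \oo --> (1 : C).
Proof.
apply: (near_cvg _ (cvg_cst (1 : C))); exists 1%N => // n /= n0.
rewrite /series /= big_ltn // expr0 mulr1 big_nat_cond big1 ?addr0 // => i.
by rewrite andbT; case: i => // i _; rewrite mul0r.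
Qed.

Lemma common_denominator (a b : ratfun) : exists T p q : {poly algC},
  [/\ T != 0, a * T%:F = p%:F & b * T%:F = q%:F].
Proof.
exists (rf_den a * rf_den b), (rf_num a * rf_den b), (rf_num b * rf_den a); split.
- by rewrite mulf_neq0 ?rf_den_neq0.
- by rewrite !rmorphM /= mulrA rf_numden.
- by rewrite [rf_den a * _]mulrC !rmorphM /= mulrA rf_numden.
Qed.

End FirstOrder.

Section NilssonGevrey.
Variables (R : realType) (iota : {rmorphism algC -> R[i]}).
Local Notation C := (R[i]^o).
Local Notation index := (rat * nat * nat)%type.
Variables (w : C) (r : R) (f : C -> C) (a b : ratfun) (T p q : {poly algC}).
Variables (l : C -> C) (S : seq index) (lam : index -> C) (A : index -> nat -> algC)
  (F : index -> C -> C).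
Hypotheses (hw : w != 0) (hr : 0 < r).
Hypothesis hl : log_determination (slit_disc w r) l.
Hypothesis hA : forall s, s \in S -> gevrey0_coefs iota (A s).
Hypothesis hF : forall s, s \in S -> forall z, slit_disc w r z ->
  series (fun n => iota (A s n) * z ^+ n : C) @ \oo --> F s z.
Hypothesis hf : forall z, slit_disc w r z ->
  f z = \sum_(s <- S) lam s * cexp (ratr s.1.1 * l z) * l z ^+ s.1.2 * F s z.
Hypothesis hode : forall z, slit_disc w r z ->
  rf_regular iota a z /\ rf_regular iota b z /\
  is_derive z 1 f (rf_eval iota a z * f z + rf_eval iota b z).
Hypotheses (nzT : T != 0) (ha : a * T%:F = p%:F) (hb : b * T%:F = q%:F).

Let al (s : index) := s.1.1.
Let lg (s : index) := s.1.2.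
Let total := total_coef iota S lam al lg A.
Let tm (V W : {poly algC}) := shift_term (ext_term iota lam al lg A) (ext_poly iota V W).

Lemma derive_cleared z : slit_disc w r z ->
  is_derive z 1 (fun y : C => (map_poly iota T).[y] * f y : C)
    ((map_poly iota (T^`() + p)).[z] * f z + (map_poly iota q).[z]).
Proof.
move=> hz; have [ra [rb df]] := hode hz.
have dT := is_derive_horner (map_poly iota T) z.
have -> : (fun y : C => (map_poly iota T).[y] * f y : C) =
  (fun y : C => (map_poly iota T).[y] : C) * f by [].
apply: is_derive_eq; rewrite /GRing.scale /= rmorphD hornerD /= -deriv_map.
rewrite -(rf_eval_clear nzT ha ra) -(rf_eval_clear nzT hb rb) mulrDr mulrDl !mulrA addrC.
by rewrite addrA [f z * _]mulrC.
Qed.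

Let g (z : C) (u : option index) : C := if u is Some s then F s z else 1.

Lemma ext_series z u : slit_disc w r z -> u \in ext_index S ->
  series (fun n => lt_ser (ext_term iota lam al lg A u) n * z ^+ n : C) @ \oo --> g z u.
Proof.
move=> hz; rewrite inE => /predU1P[->|/mapP[s sS ->]]; first exact: series_delta.
exact: hF.
Qed.

Lemma ext_bounded u : u \in ext_index S ->
  exists2 c : R, 0 < c & forall n, `|lt_ser (ext_term iota lam al lg A u) n| <= (c ^+ n.+1)%:C%C.
Proof.
rewrite inE => /predU1P[->|/mapP[s sS ->]] /=.
  exists 1 => // n; rewrite expr1n rmorph1.
  by case: eqP => _; rewrite ?normr1 ?normr0 ?ler01.
have [c [c0 [hc _]]] := hA sS; exists c => // n.
exact: (hc idfun n).
Qed.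

Lemma mem_shift_index (U : eqType) (J : seq U) N v : v \in shift_index J N -> v.1 \in J.
Proof. by case/allpairsP => -[u i] /= [uJ _ ->]. Qed.

(** The equation T f' = p f + q, in the form z (T f)' = z (T' + p) f + z q,
    compared coefficientwise along the ray. *)
Lemma total_equation N be j :
  (size T <= N)%N -> (size ('X * (T^`() + p))%R <= N)%N -> (size ('X * q)%R <= N)%N ->
  coef_at (fun n => iota ('X * q)`_n) be *+ (j == 0%N) +
    \sum_(i < N) iota ('X * (T^`() + p))`_i * total (be - i%:R) j =
  ratr be * (\sum_(i < N) iota T`_i * total (be - i%:R) j) +
    j.+1%:R * (\sum_(i < N) iota T`_i * total (be - i%:R) j.+1).
Proof.
move=> sT sp sq; have [L [X hX]] := log_ray hw hr hl.
have zE x : X < x -> cexp (L - x%:C%C : C) = ray w x.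
  by move=> /hX[hz <-]; case: hl => _; apply.
pose J := shift_index (ext_index S) N.
pose h (v : option index * nat) x := g (ray w x) v.1.
have appr (V W : {poly algC}) v : v \in J -> approximable L (lt_ser (tm V W v)) (h v).
  move/mem_shift_index => vJ; have [c c0 hc] := ext_bounded vJ.
  apply: (approximable_series c0 hc (X := X)) => x ltx; rewrite zE //.
  by apply: ext_series => //; case: (hX x ltx).
have val (V W : {poly algC}) x : X < x -> (size V <= N)%N -> (size W <= N)%N ->
    \sum_(v <- J) term_val L (tm V W v) (h v) x =
    (map_poly iota W).[ray w x] + (map_poly iota V).[ray w x] * f (ray w x).
  move=> ltx sV sW; have [hz el] := hX x ltx.
  rewrite -zE // (ext_val iota S lam al lg A L (g := fun u x => g (ray w x) u) sV sW) //.
  by rewrite (zE x ltx) (hf hz) el.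
have s0 : (size (0 : {poly algC})%R <= N)%N by rewrite size_poly0.
have := @formal_coef_derive R L _ _ (tm T 0) (tm ('X * (T^`() + p)) ('X * q)) h h J J
  (fun x => (map_poly iota T).[ray w x] * f (ray w x))
  (fun x => ((map_poly iota (T^`() + p)).[ray w x] * f (ray w x) +
     (map_poly iota q).[ray w x]) * (- ray w x)) X (appr _ _) (appr _ _).
have dpsi x : X < x -> path_derive ((fun y : C => (map_poly iota T).[y] * f y : C) \o ray w) x
   (((map_poly iota (T^`() + p)).[ray w x] * f (ray w x) +
     (map_poly iota q).[ray w x]) * (- ray w x)).
  move=> ltx; apply: path_derive_comp; first exact: path_derive_ray.
  by apply: derive_cleared; case: (hX x ltx).
move=> /(_ (fun x ltx => path_derive_Re (dpsi x ltx)) (fun x ltx => path_derive_Im (dpsi x ltx))).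
have e1 x : X < x -> (map_poly iota T).[ray w x] * f (ray w x) =
    \sum_(v <- J) term_val L (tm T 0 v) (h v) x.
  by move=> ltx; rewrite val // rmorph0 horner0 add0r.
have e2 x : X < x -> ((map_poly iota (T^`() + p)).[ray w x] * f (ray w x) +
     (map_poly iota q).[ray w x]) * (- ray w x) =
    - \sum_(v <- J) term_val L (tm ('X * (T^`() + p)) ('X * q) v) (h v) x.
  move=> ltx; rewrite val // !rmorphM /= map_polyX !hornerM !hornerX mulrN; congr (- _).
  by rewrite [LHS]mulrC mulrDr mulrA addrC.
move=> /(_ e1 e2 be j); rewrite /tm !formal_coef_ext //.
have c0 j0 : coef_at (fun n => iota (0 : {poly algC})`_n) be *+ (j0 == 0%N) = 0 :> R[i].
  rewrite (_ : (fun n => _) = fun=> 0) ?/coef_at ?if_same ?mul0rn //.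
  by apply/funext => n; rewrite coef0 rmorph0.
by rewrite !c0 !add0r.
Qed.

Lemma coef_atM (V W : zmodType) (h : {additive V -> W}) (B : nat -> V) c :
  h (coef_at B c) = coef_at (fun n => h (B n)) c.
Proof. by rewrite /coef_at; case: ifP => //; rewrite raddf0. Qed.

Let coord (c : index -> algC) be j : algC :=
  \sum_(s <- S | lg s == j) c s * coef_at (A s) (be - al s).

Lemma coord_low : exists b0, forall c be j, be < b0 -> coord c be j = 0.
Proof.
exists (- \sum_(s <- S) `|al s|) => c be j lt; rewrite /coord big_seq_cond big1 // => s /andP[sS _].
rewrite /coef_at; case: ifP => [/natr_ge0|_]; last by rewrite mulr0.
rewrite subr_ge0 leNgt; case/negP; apply: lt_le_trans lt _.
rewrite lerNl (big_rem s) //=; apply: le_trans (ler_norm _) _; rewrite normrN lerDl.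
by apply: sumr_ge0.
Qed.

Lemma coord_finlog : exists J, forall c be j, (J <= j)%N -> coord c be j = 0.
Proof.
exists (\max_(s <- S) lg s).+1 => c be j lt; rewrite /coord big_seq_cond big1 // => s.
case/andP=> sS /eqP e; move: lt; rewrite -e ltnNge => /negP[].
exact: leq_bigmax_seq.
Qed.

Lemma coord_gevrey c be j : gevrey_seq iota (fun n => coord c (be + n%:R) j).
Proof.
rewrite /coord; under [X in gevrey_seq _ X]funext => n do rewrite big_seq_cond.
apply: gevrey_seq_sum => s /andP[sS _]; apply: gevrey_seqZ.
have := gevrey_shift (be - al s) (hA sS); congr (gevrey_seq _ _).
by apply/funext => n; rewrite addrAC.
Qed.

Section Coordinates.
Variables (n : nat) (mu : nat -> R[i]) (c : index -> nat -> algC).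
Hypothesis mu0 : mu 0%N = 1.
Hypothesis free : forall e : nat -> algC, \sum_(i < n.+1) iota (e i) * mu i = 0 ->
  forall i, (i < n.+1)%N -> e i = 0.
Hypothesis hc : forall s, s \in S -> lam s = \sum_(i < n.+1) iota (c s i) * mu i.

Let k i := coord (fun s => c s i).

Lemma total_coord be j : total be j = \sum_(i < n.+1) iota (k i be j) * mu i.
Proof.
rewrite /total /total_coef big_seq_cond.
under eq_bigr => s /andP[sS _] do rewrite (hc sS) mulr_suml.
rewrite -big_seq_cond exchange_big /=; apply: eq_bigr => i _.
rewrite /k /coord rmorph_sum /= mulr_suml; apply: eq_bigr => s _.
by rewrite rmorphM /= coef_atM mulrAC.
Qed.

(** Expanding [total_equation] in the free family gives one relation for each
    index i; since mu 0 = 1, the inhomogeneous term belongs to i = 0. The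
    weights of T' are those that turn the exponent of z^b into that of the
    shifted term. *)
Lemma coord_equation N i be j : (i < n.+1)%N ->
  (size T <= N)%N -> (size ('X * (T^`() + p))%R <= N)%N -> (size ('X * q)%R <= N)%N ->
  \sum_(m < N) T`_m * (ratr (be - m%:R) * k i (be - m%:R) j + j.+1%:R * k i (be - m%:R) j.+1) =
  \sum_(m < N) ('X * p)`_m * k i (be - m%:R) j +
  coef_at (fun m => (if i == 0%N then 'X * q else 0)`_m) be *+ (j == 0%N).
Proof.
move=> lti sT sp sq; have tot := total_equation be j sT sp sq.
pose V (P : {poly algC}) i j := \sum_(m < N) P`_m * k i (be - m%:R) j.
have totV (P : {poly algC}) j1 : \sum_(m < N) iota P`_m * total (be - m%:R) j1 =
    \sum_(i < n.+1) iota (V P i j1) * mu i.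
  under eq_bigr do rewrite total_coord mulr_sumr.
  rewrite exchange_big; apply: eq_bigr => i1 _; rewrite rmorph_sum mulr_suml.
  by apply: eq_bigr => m _; rewrite rmorphM mulrA.
pose E i := coef_at (fun m => ('X * q)`_m) be *+ (j == 0%N) *+ (i == 0%N) +
   V ('X * (T^`() + p)) i j - (ratr be * V T i j + j.+1%:R * V T i j.+1).
have E0 : \sum_(i < n.+1) iota (E i) * mu i = 0.
  have h x : \sum_(i < n.+1) iota (x *+ (i == 0%N :> nat)) * mu i = iota x.
    rewrite big_ord_recl /= mu0 mulr1n mulr1 big1 ?addr0 // => i1 _.
    by rewrite mulr0n rmorph0 mul0r.
  have lin (u v x y : algC) m : iota (u + v - (ratr be * x + j.+1%:R * y)) * m =
      iota u * m + iota v * m - (ratr be * (iota x * m) + j.+1%:R * (iota y * m)).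
    have eb : iota (ratr be) = ratr be by exact: fmorph_rat.
    rewrite rmorphB !rmorphD (rmorphM iota (ratr be)) (rmorphM iota j.+1%:R) eb rmorph_nat.
    by ring.
  rewrite /E; under eq_bigr do rewrite lin.
  rewrite sumrB !big_split /= h -totV -!mulr_sumr -!totV rmorphMn /= coef_atM tot.
  by rewrite subrr.
have := free E0 lti; rewrite /E => /eqP; rewrite subr_eq0 => /eqP e.
have -> : coef_at (fun m => (if i == 0%N then 'X * q else 0)`_m) be *+ (j == 0%N) =
   coef_at (fun m => ('X * q)`_m) be *+ (j == 0%N) *+ (i == 0%N).
  case: (i == 0%N); rewrite ?mulr1n // mulr0n /coef_at coef0 if_same mul0rn //.
move: e; move: (coef_at _ _ *+ _ *+ _) => u e.
have -> : u = ratr be * V T i j + j.+1%:R * V T i j.+1 - V ('X * (T^`() + p)) i j.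
  by rewrite -e addrK.
rewrite /V !mulr_sumr addrA -!big_split -sumrB /=; apply: eq_bigr => m _.
have -> : ('X * (T^`() + p))`_m = m%:R * T`_m + ('X * p)`_m.
  rewrite mulrDr coefD; congr (_ + _); rewrite coefXM coef_deriv.
  by case: (m : nat) => [|m1] //=; rewrite ?mul0r // mulr_natl.
rewrite rmorphB /= ratr_nat; move: (k _ _ j) (k _ _ j.+1) (T`_m) => x y z; ring.
Qed.

(** If no coordinate gives a bounded operator, the expansion of f is a Laurent
    series V^-1 P z^-M with polynomials V and P. In lowest terms num/den, the
    function den f - num has a vanishing expansion, hence is zero on the whole
    slit disc. In particular den has no zero there, since num would vanish
    too. *)
Lemma bounded_or_rational : gal_bounded ('X * T) ('X * p) \/
  exists x : ratfun, forall z, slit_disc w r z ->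
    rf_regular iota x z /\ f z = rf_eval iota x z.
Proof.
pose N := maxn (size T) (maxn (size ('X * (T^`() + p))%R)
  (maxn (size ('X * q)%R) (size ('X * p)%R))).
have sT : (size T <= N)%N by rewrite leq_maxl.
have sTp : (size ('X * (T^`() + p))%R <= N)%N by rewrite /N maxnCA leq_maxl.
have sq : (size ('X * q)%R <= N)%N by rewrite /N !leq_max leqnn !orbT.
have sp : (size ('X * p)%R <= N)%N by rewrite /N !leq_max leqnn !orbT.
have low i : exists b0, forall be j, be < b0 -> k i be j = 0.
  by have [b0 h] := coord_low; exists b0 => be j; apply: h.
have finlog i : exists J, forall be j, (J <= j)%N -> k i be j = 0.
  by have [J h] := coord_finlog; exists J => be j; apply: h.
have gev i be j : gevrey_seq iota (fun n => k i (be + n%:R) j) by exact: coord_gevrey.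
have eqk i (lti : (i < n.+1)%N) be j := coord_equation be j lti sT sTp sq.
case: (pselect (exists i be j, [/\ (0 < i)%N, (i < n.+1)%N & k i be j != 0])).
  move=> [[|i] [be [j [// _ lti nz]]]]; left.
  apply: (bounded_of_homogeneous nzT sT sp (eqk _ lti) (low _) (finlog _) (gev _) nz) => _ m m1.
  by rewrite /coef_at /= coef0 if_same.
move=> none; have k0 i be j : (0 < i)%N -> (i < n.+1)%N -> k i be j = 0.
  move=> i0 lti; apply/eqP; apply: contraT => nz; case: none.
  by exists i, be, j.
have [bnd|[shape [M [lowM [V [P [nzV hV]]]]]]] :=
  bounded_or_laurent nzT sT sp (eqk 0%N isT) (low _) (finlog _) (gev _); first by left.
right; (* The expansion of f is P / V, shifted by the lowest exponent - M. *)
pose x : ratfun := P%:F / V%:F; exists (x / ('X^M : {poly algC})%:F).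
set rho := x / _; move=> z hz.
have nzVM : V * 'X^M != 0 by rewrite mulf_neq0 // expf_neq0 // polyX_eq0.
have erho : rho * (V * 'X^M)%:F = P%:F.
  have nzVF : V%:F != 0 by rewrite tofrac_eq0.
  have nzXF : ('X^M : {poly algC})%:F != 0 by rewrite tofrac_eq0 expf_neq0 // polyX_eq0.
  by rewrite /rho /x rmorphM /= [V%:F * _]mulrC mulrA (divfK nzXF) (divfK nzVF).
have cross := rf_cross nzVM erho; set den := rf_den rho in cross *; set num := rf_num rho in cross *.
have hden m : cauchy_coef den (fun n => k 0%N (- M%:R + n%:R) 0%N) m = ('X^M * num)`_m.
  by apply: (series_cancel nzV hV); rewrite mulrC -cross; ring.
suff key : (map_poly iota den).[z] * f z = (map_poly iota num).[z].
  have reg : rf_regular iota rho z.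
    rewrite /rf_regular -/den; apply/negP => /eqP d0; move: key; rewrite d0 mul0r => /esym n0.
    have := coprime_rf rho; rewrite -(coprimep_map iota) -/num -/den => cop.
    have rn : root (map_poly iota num) z by rewrite /root n0.
    by have := coprimep_root cop rn; rewrite d0 eqxx.
  by split=> //; rewrite /rf_eval -/den -/num -key mulrAC divff ?mul1r.
have total0 be j : total be j = iota (k 0%N be j).
  rewrite total_coord big_ord_recl mu0 mulr1 big1 ?addr0 // => i _.
  by rewrite k0 ?rmorph0 ?mul0r // ltnS ltn_ord.
pose D := maxn (size den) (size num); pose J := shift_index (ext_index S) D.
have sden : (size den <= D)%N by rewrite leq_maxl.
have snum : (size (- num)%R <= D)%N by rewrite size_polyN leq_maxr.
have kden be : coef_at (fun n => (- num)`_n) be + \sum_(m < D) den`_m * k 0%N (be - m%:R) 0%N = 0.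
  have [lt|ge] := ltP be (- M%:R).
    rewrite big1 => [|m _]; last by rewrite lowM ?mulr0 // (le_lt_trans _ lt) // gerBl.
    rewrite addr0 /coef_at; case: ifP => // /natr_ge0.
    by rewrite leNgt (lt_le_trans lt) // oppr_le0.
  case be_int : (be \is a Num.int); last first.
    rewrite big1 => [|m _].
      rewrite addr0 /coef_at; case: ifP => // /intr_nat; by rewrite be_int.
    case: (eqVneq (k 0%N (be - m%:R) 0%N) 0) => [->|/shape[_ h]]; first by rewrite mulr0.
    have : be - m%:R + m%:R \is a Num.int by rewrite rpredD ?rpred_nat.
    by rewrite subrK be_int.
  have [n1 ->] : exists n1 : nat, be = - M%:R + n1%:R.
    have : (be + M%:R) \is a Num.nat.
      by rewrite natrEint rpredD ?rpred_nat //= -lerBlDr sub0r.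
    by case/natrP => n1 e; exists n1; rewrite -e addrC addrK.
  rewrite coef_at_laurent mulrN coefN -hden /cauchy_coef; apply/eqP; rewrite addrC subr_eq0; apply/eqP.
  pose G m := den`_m * k 0%N (- M%:R + n1%:R - m%:R) 0%N.
  rewrite (@sum_ord_support _ G D n1.+1).
  - by apply: eq_bigr => m _; rewrite /G -addrA natrB // -ltnS.
  - by move=> m le; rewrite /G nth_default ?mul0r // (leq_trans sden).
  - by move=> m lt; rewrite /G lowM ?mulr0 // -addrA gtrDl subr_lt0 ltr_nat.
have := @zero_value R _ (tm den (- num)) J (l z) (fun v _ => g z v.1) 0.
have ez : cexp (l z - 0%:C%C : C) = z by rewrite subr0; case: hl => _; apply.
rewrite (ext_val iota S lam al lg A (l z) (g := fun u _ => g z u) sden snum) // ez.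
have ef : \sum_(s <- S) lam s * cexp (ratr (al s) * (l z - 0%:C%C) : C) *
       (l z - 0%:C%C) ^+ lg s * g z (Some s) = f z.
  by rewrite subr0 (hf hz).
rewrite ef rmorphN hornerN addrC => h; apply/eqP; rewrite -subr_eq0; apply/eqP; apply: h.
  by move=> v /mem_shift_index vJ; apply: ext_series.
move=> be j; rewrite /tm formal_coef_ext //.
have e1 : \sum_(i < D) iota den`_i * total (be - i%:R) j =
   iota (\sum_(m < D) den`_m * k 0%N (be - m%:R) j).
  by rewrite rmorph_sum; apply: eq_bigr => m _; rewrite total0 rmorphM.
rewrite -/total e1 -(coef_atM iota) -rmorphMn -rmorphD.
case: j {e1} => [|j]; first by rewrite eqxx mulr1n kden rmorph0.
rewrite mulr0n add0r big1 ?rmorph0 // => m _.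
by case: (eqVneq (k 0%N (be - m%:R) j.+1) 0) => [->|/shape[]]; rewrite ?mulr0.
Qed.

End Coordinates.

End NilssonGevrey.

(** * Solutions of the homogeneous equation *)

Section Wronskian.
Variables (R : realType) (iota : {rmorphism algC -> R[i]}).
Local Notation C := (R[i]^o).

Lemma cauchy_schwarz_complex (u v : C) : complex.Re u * complex.Re v + complex.Im u * complex.Im v <=
  complex.Re `|u| * complex.Re `|v|.
Proof.
apply: le_trans (ler_norm _) _; rewrite -lecR rmorphM /= -!normcR.
have -> : `|u| * `|v| = `|u * (complex.Re v -i* complex.Im v)%C| :> R[i].
  rewrite (normrM (u : R[i])); congr (_ * _).
  by rewrite !normc_def /= sqrrN.
have := @normc_ge_Re R (u * (complex.Re v -i* complex.Im v)%C).
by case: u v => [u1 u2] [v1 v2] /=; rewrite mulrN opprK.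
Qed.

(** Along the segment from z0 to z, the squared modulus N of g satisfies
    N' <= 2 K |z - z0| N, so that exp(- 2 K |z - z0| t) N does not exceed its
    value 0 at z0. *)
Lemma gronwall (g : C -> C) (z0 : C) (rho K : R) :
  (forall z, `|z - z0| < rho%:C%C -> exists2 d, is_derive z 1 g d & `|d| <= K%:C%C * `|g z|) ->
  g z0 = 0 -> forall z, `|z - z0| < rho%:C%C -> g z = 0.
Proof.
move=> hg g0 z hz; set v := z - z0 in hz.
pose ga (t : R) : C := z0 + t%:C%C * v.
have nv : `|v| = (complex.Re `|v|)%:C%C by rewrite -normcR.
have in_disc t : 0 <= t <= 1 -> `|ga t - z0| < rho%:C%C.
  move=> /andP[t0 t1]; rewrite /ga addrC addKr (normrM (_ : C)) ger0_norm ?lecR //.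
  apply: le_lt_trans hz; rewrite -[X in _ <= X]mul1r ler_wpM2r //.
  by rewrite lecR.
pose ka := K * complex.Re `|v|.
pose N (t : R) : R := complex.Re (g (ga t)) ^+ 2 + complex.Im (g (ga t)) ^+ 2.
pose E (t : R) : R := expR (- (2 * ka) * t) * N t.
have dE (t : R) : 0 <= t <= 1 -> exists2 e : R, is_derive t 1 E e & e <= 0.
  move=> ht; have [d hd bd] := hg _ (in_disc t ht).
  have pga : path_derive ga t v.
    by have := @path_derive_real R id t 1 z0 v (@is_derive_id R R t 1); rewrite rmorph1 mul1r.
  have pg := path_derive_comp pga hd.
  have dRe := path_derive_Re pg; have dIm := path_derive_Im pg.
  have dex : is_derive t 1 (fun t : R => expR (- (2 * ka) * t)) (expR (- (2 * ka) * t) * - (2 * ka)).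
    have h1 : is_derive t 1 (fun y : R => - (2 * ka) * y) (- (2 * ka)).
      have := @is_deriveZ R R R id (- (2 * ka)) t 1 1 (@is_derive_id R R t 1).
      by rewrite /GRing.scale /= mulr1.
    exact: (is_derive1_comp (is_derive_expR (- (2 * ka) * t)) h1).
  have dN := is_deriveD (is_deriveM dRe dRe) (is_deriveM dIm dIm).
  have := is_deriveM dex dN; set e := (X in is_derive _ _ _ X) => de.
  exists e.
    by move: de; congr (is_derive _ _ _ _); apply/funext => y; rewrite /E /N !expr2.
  rewrite /e /GRing.scale /= -[X in _ + X * _]/(complex.Re (g (ga t)) * complex.Re (g (ga t)) +
    complex.Im (g (ga t)) * complex.Im (g (ga t))).
  have ex0 := expR_ge0 (- (2 * ka) * t); move: (expR _) ex0 => x x0.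
  have := cauchy_schwarz_complex (g (ga t)) (d * v).
  have bn : complex.Re `|d * v| <= ka * complex.Re `|g (ga t)|.
    rewrite -lecR -normcR (normrM (d : C)) {1}nv /ka mulrAC rmorphM /=; apply: ler_wpM2r.
      by rewrite -nv.
    by rewrite rmorphM /= -normcR.
  have sq : complex.Re `|g (ga t)| ^+ 2 = complex.Re (g (ga t)) ^+ 2 + complex.Im (g (ga t)) ^+ 2.
    by rewrite normc_def /= sqr_sqrtr // addr_ge0 ?sqr_ge0.
  have n0 := Re_norm_ge0 (g (ga t)).
  move: (complex.Re `|g (ga t)|) (complex.Re `|d * v|) n0 bn sq => n m n0 bn sq.
  rewrite !expr2 in sq.
  move: (complex.Re (g (ga t))) (complex.Im (g (ga t))) (complex.Re (d * v)) (complex.Im (d * v)) sq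
    => a1 a2 b1 b2 sq hcs.
  have h : a1 * b1 + a2 * b2 <= ka * (a1 * a1 + a2 * a2).
    by rewrite -sq; apply: le_trans hcs _; rewrite mulrCA ler_wpM2l.
  have -> : x * (a1 * b1 + a1 * b1 + (a2 * b2 + a2 * b2)) + (a1 * a1 + a2 * a2) * (x * - (2 * ka)) =
    - (2 * x * (ka * (a1 * a1 + a2 * a2) - (a1 * b1 + a2 * b2))) by ring.
  by rewrite oppr_le0 mulr_ge0 ?subr_ge0 // mulr_ge0.
have E1 : E 1 <= E 0.
  have itv x : x \in `]0, 1[%R -> 0 <= x <= 1 by rewrite in_itv /= => /andP[/ltW-> /ltW->].
  have hd x : x \in `]0, 1[%R -> derivable E x 1 by move=> /itv /dE[e []].
  have hd0 x : x \in `]0, 1[%R -> E^`()%classic x <= 0.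
    by move=> /itv /dE[e de e0]; rewrite derive1E derive_val.
  have hc : {within `[0, 1], continuous E}.
    by apply: derivable_within_continuous => x; rewrite in_itv /= => /dE[e []].
  exact: (ler0_derive1_nincr hd hd0 hc (lexx 0) ler01 (lexx 1)).
have : N 1 <= 0.
  move: E1; rewrite /E /N {3 4}/ga mul0r addr0 g0 /= !expr2 !mul0r addr0 mulr0.
  by rewrite pmulr_rle0 // expR_gt0.
rewrite /N; have -> : ga 1 = z by rewrite /ga rmorph1 mul1r addrC subrK.
move=> h; apply/eqP; rewrite eq_complex /=.
have a0 := sqr_ge0 (complex.Re (g z)); have b0 := sqr_ge0 (complex.Im (g z)).
have /andP[] : (complex.Re (g z) ^+ 2 == 0) && (complex.Im (g z) ^+ 2 == 0).
  by apply/andP; split; apply/eqP; lra.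
by rewrite !sqrf_eq0 => -> ->.
Qed.

Lemma is_derive_continuous (h : C -> C) (z d : C) : is_derive z 1 h d -> {for z, continuous h}.
Proof.
by case=> hd _; apply: differentiable_continuous; apply/derivable1_diffP.
Qed.

Lemma continuous_rf_eval (x : ratfun) (z : C) : rf_regular iota x z ->
  {for z, continuous (fun y : C => rf_eval iota x y : C)}.
Proof.
have cont (P : {poly R[i]}) : (fun y : C => P.[y] : C) @ z --> (P.[z] : C).
  exact: is_derive_continuous (is_derive_horner P z).
move=> hz; have hn := cont (map_poly iota (rf_num x)); have hd := cont (map_poly iota (rf_den x)).
exact: (cvgM hn (cvgV hz hd)).
Qed.

Lemma ball_complexP (z0 : C) (P : C -> Prop) : (\forall z \near z0, P z) ->
  exists2 rho : R, 0 < rho & forall z, `|z - z0| < rho%:C%C -> P z.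
Proof.
move=> /nbhs_ballP[e /= e0 he]; have : 0 < (e : R[i]) by [].
rewrite ltcE => /andP[/eqP ei er]; exists (complex.Re e) => // z hz; apply: he.
rewrite -ball_normE /ball_ /= distrC.
by have -> : e = (complex.Re e)%:C%C by case: (e) ei => x y /= ->.
Qed.

Lemma diffop_XsubC (a : ratfun) (U : set C) (g : C -> C) (z : C) :
  rf_regular iota a z -> U z -> diffop_solution iota ('X - a%:P) U g ->
  is_derive z 1 g (rf_eval iota a z * g z).
Proof.
move=> ra Uz /(_ z Uz) []; rewrite size_XsubC => reg [/(_ 0%N isT) der eq].
apply: DeriveDef => //; rewrite -derive1E.
have r0 := reg 0%N; have r1 := reg 1%N; move: eq r0 r1.
rewrite !big_ord_recl big_ord0 /= !coefB !coefX !coefC /= sub0r subr0 addr0.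
have e1 : (1 : ratfun) * (1 : {poly algC})%:F = 1%:F by rewrite mul1r.
have ea : - a * (rf_den a)%:F = (- rf_num a)%:F by rewrite mulNr rf_numden rmorphN.
move=> eq r0 r1; have h1 := rf_eval_clear (oner_neq0 _) e1 r1.
have ha := rf_eval_clear (rf_den_neq0 a) ea r0.
rewrite rmorph1 hornerC mul1r in h1; rewrite h1 mul1r in eq.
rewrite rmorphN hornerN in ha.
have ha' : rf_eval iota (- a) z = - rf_eval iota a z.
  by apply: (mulfI ra); rewrite ha mulrN /rf_eval mulrCA divff ?mulr1.
by move: eq; rewrite ha' mulNr addrC => /eqP; rewrite subr_eq0 => /eqP.
Qed.

(** The zero set of g is open by [gronwall], as a is bounded near each point,
    and its complement is open by continuity. *)
Lemma solution_neq0 (a : ratfun) (U : set C) (g : C -> C) :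
  (forall z, U z -> rf_regular iota a z) ->
  open U -> connected U -> diffop_solution iota ('X - a%:P) U g ->
  (exists z, U z /\ g z != 0) -> forall z, U z -> g z != 0.
Proof.
move=> reg oU cU sol [z1 [Uz1 gz1]].
have der z (Uz : U z) := diffop_XsubC (reg z Uz) Uz sol.
have cont z : U z -> {for z, continuous g}.
  by move=> Uz; exact: is_derive_continuous (der z Uz).
pose B := [set z | U z /\ g z != 0].
have openB : open B.
  rewrite openE => z [Uz gz]; rewrite /interior.
  have nU : nbhs z U by apply: open_nbhs_nbhs; split.
  have ng : \forall y \near z, g y != 0.
    have pos : 0 < complex.Re `|g z| by rewrite -ltcR -normcR normr_gt0.
    move/cvg_complexP: (cont z Uz) => /(_ _ pos); rewrite -normcR; apply: filterS => y.
    by apply: contraTneq => ->; rewrite subr0 ltxx.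
  by near=> y; split; near: y.
have openZ : open [set z | U z /\ g z = 0].
  rewrite openE => z0 [Uz0 gz0]; rewrite /interior.
  have nU : nbhs z0 U by apply: open_nbhs_nbhs; split.
  have na : \forall y \near z0, `|rf_eval iota a z0 - rf_eval iota a y| < 1%:C%C.
    by move/cvg_complexP: (continuous_rf_eval (reg z0 Uz0)); apply.
  have : \forall y \near z0, U y /\ `|rf_eval iota a z0 - rf_eval iota a y| < 1%:C%C.
    by near=> y; split; near: y.
  case/ball_complexP => rho rho0 hrho.
  pose K := complex.Re `|rf_eval iota a z0| + 1.
  have zero := @gronwall g z0 rho K _ gz0.
  have h z : `|z - z0| < rho%:C%C -> U z /\ g z = 0.
    move=> hz; split; first by case: (hrho z hz).
    apply: zero hz => y hy; have [Uy ay] := hrho y hy.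
    exists (rf_eval iota a y * g y); first exact: der.
    rewrite (normrM (_ : C)) ler_wpM2r // /K rmorphD /= -normcR.
    rewrite -[X in `|X|](subrK (rf_eval iota a z0)) addrC.
    by apply: le_trans (ler_normD _ _) _; rewrite lerD2l distrC ltW.
  apply/nbhs_ballP; exists rho%:C%C => /=; first by rewrite ltcR.
  by move=> y; rewrite -ball_normE /ball_ /= distrC => /h.
have eB : B = U.
  apply: cU; first by exists z1.
  - by exists B => //; apply/seteqP; split=> [z [Uz gz]|z [Uz []]].
  - exists (~` [set z | U z /\ g z = 0]); first exact: open_closedC.
    apply/seteqP; split=> [z [Uz gz]|z [Uz nz]].
      by split=> // -[_ e]; move: gz; rewrite e eqxx.
    by split=> //; apply/eqP => e; apply: nz.
by move=> z; rewrite -eB => -[].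
Unshelve. all: by end_near. Qed.

Lemma quotient_derive (f g : C -> C) (z da db : C) : g z != 0 ->
  is_derive z 1 f (da * f z + db) -> is_derive z 1 g (da * g z) ->
  is_derive z 1 (fun y : C => f y / g y : C) (db / g z).
Proof.
move=> gz df dg.
have dV : is_derive z 1 (fun y : C => (g y)^-1) (- (g z ^- 2) *: (da * g z)).
  case: dg => hg eg; apply: DeriveDef; first exact: derivableV.
  by rewrite deriveV // eg.
apply: (is_derive_eq (is_deriveM df dV)).
rewrite /GRing.scale /=; move: (f z) (g z) gz => u v nzv.
by field.
Qed.

End Wronskian.

(** * The inhomogeneous equation *)

Theorem proposition2 (R : realType) (iota : {rmorphism algC -> R[i]})
  (w : R[i]^o) (r : R) (f : R[i]^o -> R[i]^o) (a b : ratfun)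
  (hw : w != 0) (hr : 0 < r)
  (hf : NGA0 iota w r f)
  (hfrat : ~ exists q : ratfun, forall z, slit_disc w r z ->
             rf_regular iota q z /\ f z = rf_eval iota q z)
  (hb : b != 0)
  (hode : forall z, slit_disc w r z ->
     rf_regular iota a z /\ rf_regular iota b z /\
     is_derive z 1 f (rf_eval iota a z * f z + rf_eval iota b z)) :
  G_operator ('X - a%:P) /\
  forall (U : set R[i]^o) (g : R[i]^o -> R[i]^o),
    open U -> connected U -> U `<=` slit_disc w r ->
    diffop_solution iota ('X - a%:P) U g ->
    (exists z, U z /\ g z != 0) ->
    exists u : R[i]^o -> R[i]^o, forall z, U z ->
      g z != 0 /\
      is_derive z 1 u (rf_eval iota b z / g z) /\
      f z = g z * u z.
Proof.
split.
  have [T [p [q [nzT eT eb]]]] := common_denominator a b.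
  have [l [S0 [lam [A [F [hl [hA [hF hfs]]]]]]]] := hf.
  pose S : seq (rat * nat * nat) := finmap.enum_fset S0.
  have [n [mu [mu0 free span]]] := algebraic_coordinates iota (map lam S).
  have /choice[c hc] : forall s, exists c : nat -> algC,
      s \in S -> lam s = \sum_(i < n.+1) iota (c i) * mu i.
    move=> s; case: (boolP (s \in S)) => [sS|_]; last by exists (fun=> 0).
    by have [c e] := span _ (map_f lam sS); exists c.
  have [bnd|//] := bounded_or_rational hw hr hl hA hF hfs hode nzT eT eb mu0 free hc.
  apply: (@G_operator_of_bounded _ ('X * T) ('X * p)) => //.
    by rewrite mulf_neq0 // polyX_eq0.
  by rewrite !rmorphM /= mulrCA eT.
move=> U g oU cU subU sol exg.
have reg z : U z -> rf_regular iota a z by move=> /subU /hode[].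
have nzg := solution_neq0 reg oU cU sol exg.
exists (fun z => f z / g z) => z Uz; have gz := nzg z Uz.
have [_ [_ df]] := hode z (subU z Uz).
split=> //; split; last by rewrite mulrC divfK.
exact: (quotient_derive gz df (diffop_XsubC (reg z Uz) Uz sol)).
Qed.
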